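(* Suppose $u(x)$ and $v(x)$ are $C^2$ positive solutions of the system $$0\le -\Delta u,\qquad 0\le -\Delta v\le g(u)$$ in a punctured neighborhood of the origin in $\mathbb{R}^2$, where $g:(0,\infty)\to(0,\infty)$ is continuous and exponentially bounded at $\infty$, i.e. $\log^+ g(t)=O(t)$ as $t\to\infty$. Then $$v(x)=O\left(\log\frac1{|x|}\right)\quad\text{as }x\to0.$$ If, in addition, $-\Delta u\le f(v)$ in a punctured neighborhood of the origin, where $f:(0,\infty)\to(0,\infty)$ is a continuous function satisfying $\log^+ f(t)=O(t^\lambda)$ as $t\to\infty$ for some $\lambda>1$, then $$u(x)=o\left(\left(\log\frac1{|x|}\right)^\lambda\right)\quad\text{as }x\to0.$$
   Context: $\log^+ s:=\log s$ if $s>1$ and $\log^+ s:=0$ if $s\le 1$. *)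

(* Defs.v *)
From Stdlib Require Import Reals.
From Coquelicot Require Import Coquelicot.
Open Scope R_scope.

Definition plane : Type := (R * R)%type.

Definition origin : plane := (0, 0).

(* Coquelicot's balls on [R * R] are open squares, which give the usual topology
   of the plane. *)
Definition punctured_nbhd : (plane -> Prop) -> Prop := locally' origin.

(* Coquelicot's norm on [R * R] is [sqrt (|x1|^2 + |x2|^2)]. *)
Definition eucl_norm (x : plane) : R := norm x.

(* [ex_diff_n f 2] holds at a point when [f] and its partial derivatives of order
   at most 2 exist and are continuous there. Holding at every point of an open set,
   it says that [f] is C^2 on that set. *)
Definition C2_at (u : plane -> R) (x : plane) : Prop :=
  ex_diff_n (fun x1 x2 => u (x1, x2)) 2 (fst x) (snd x).

Definition laplacian (u : plane -> R) (x : plane) : R :=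
  partial_derive 2 0 (fun x1 x2 => u (x1, x2)) (fst x) (snd x) +
  partial_derive 0 2 (fun x1 x2 => u (x1, x2)) (fst x) (snd x).

Definition log_plus (s : R) : R := if Rlt_dec 1 s then ln s else 0.

(* A function (0,oo) -> (0,oo) is represented by a total function on [R]
   whose values outside (0,oo) are unconstrained. *)
Definition pos_continuous (g : R -> R) : Prop :=
  (forall t, 0 < t -> 0 < g t) /\ continuous_on (fun t => 0 < t) g.

Definition is_bigO {T : Type} (F : (T -> Prop) -> Prop) (f g : T -> R) : Prop :=
  exists C : R, F (fun x => Rabs (f x) <= C * Rabs (g x)).

(* [is_domin] takes the dominating function first. *)
Definition is_littleo {T : Type} (F : (T -> Prop) -> Prop) (f g : T -> R) : Prop :=
  is_domin (U := R_NormedModule) (V := R_NormedModule) F g f.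

(* Main.v *)
Require Import Defs.
From Stdlib Require Import Reals Lra Psatz Classical IndefiniteDescription.
From Coquelicot Require Import Coquelicot.
Open Scope R_scope.

(** The proof estimates [u] and [v] by potentials of their Riesz measures, but
    only through Green's identity [∬ phi Delta u = ∬ u Delta phi] with explicit
    radial test functions [phi] supported in the punctured disc (lemma [green]).

    Testing with a truncated logarithm [log (|p|^2 / b)] and letting [b -> 0] shows
    that the averages of [u] over discs of radius comparable to [|x|] around [x]
    are [O (log (1 / |x|))] (lemma [average_bound]) and that [- Delta u] is
    integrable near the origin (lemma [mass_bounded]); hence its mass near the
    origin tends to 0 (lemma [mass_vanishing]). Testing with a truncated Green
    function centred at [x], whose pole is smoothed by a parameter [e], gives
    [u x <= C log (1 / |x|) + 2 * (potential at x of the nearby mass)]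
    (lemma [pointwise_bound]). The same holds for [v].

    For the first claim, [- Delta v <= exp (C (u + 1))]. The mass of [- Delta u] near
    the origin being small, every exponential moment of [u] near [x] is at most a
    power of [1 / |x|], by the argument of Brezis and Merle (lemma
    [exponential_integrability]). So in the potential of [- Delta v] at [x] the part
    at distance at least [|x| ^ K] from [x] is at most [2 K log (1 / |x|)] times a
    bounded mass, and the part nearer to [x] is bounded for [K] large. The lemma
    [value_bound] expresses this splitting by the height [kappa] of the Green
    function instead of the distance to [x].

    For the second claim, the first one gives
    [- Delta u <= exp (C (log (1 / |x|)) ^ lambda)] near [x]. The same lemma applies,
    now with [kappa] a multiple of [(log (1 / |x|)) ^ lambda], whose coefficient is a
    mass that tends to 0. The remaining terms are [O (log (1 / |x|))], which is
    negligible because [lambda > 1].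

    The functions [f] and [g] are only controlled away from 0, so a positive lower
    bound for [u] and [v] is needed as well; it is the minimum principle in the
    punctured disc (lemma [superharmonic_lower_bound]). *)

(** * Continuity *)

Definition cont {U : UniformSpace} (f : U -> R) : Prop := forall p, continuous f p.

Lemma continuous_Rplus {U : UniformSpace} (f g : U -> R) p :
  continuous f p -> continuous g p -> continuous (fun x => f x + g x) p.
Proof. intros Hf Hg. exact (continuous_plus (V := R_NormedModule) f g p Hf Hg). Qed.

Lemma continuous_Rminus {U : UniformSpace} (f g : U -> R) p :
  continuous f p -> continuous g p -> continuous (fun x => f x - g x) p.
Proof. intros Hf Hg. exact (continuous_minus (V := R_NormedModule) f g p Hf Hg). Qed.

Lemma continuous_Ropp {U : UniformSpace} (f : U -> R) p :
  continuous f p -> continuous (fun x => - f x) p.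
Proof. intros Hf. exact (continuous_opp (V := R_NormedModule) f p Hf). Qed.

Lemma continuous_Rmult {U : UniformSpace} (f g : U -> R) p :
  continuous f p -> continuous g p -> continuous (fun x => f x * g x) p.
Proof. intros Hf Hg. exact (continuous_mult (K := R_AbsRing) f g p Hf Hg). Qed.

Lemma continuous_Rpow {U : UniformSpace} (f : U -> R) n p :
  continuous f p -> continuous (fun x => f x ^ n) p.
Proof.
  intros Hf; induction n as [|n IH]; simpl.
  - apply continuous_const.
  - now apply continuous_Rmult.
Qed.

Lemma continuous_comp_R {U : UniformSpace} (f : U -> R) (h : R -> R) p :
  continuous f p -> continuous h (f p) -> continuous (fun x => h (f x)) p.
Proof. intros Hf Hh. exact (continuous_comp f h p Hf Hh). Qed.

Lemma continuous_Rinv' {U : UniformSpace} (f : U -> R) p :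
  continuous f p -> f p <> 0 -> continuous (fun x => / f x) p.
Proof.
  intros Hf H0. apply (continuous_comp_R f Rinv); [exact Hf|].
  apply (continuous_Rinv_comp (fun y => y)); [apply continuous_id | exact H0].
Qed.

Lemma continuous_Rdiv {U : UniformSpace} (f g : U -> R) p :
  continuous f p -> continuous g p -> g p <> 0 -> continuous (fun x => f x / g x) p.
Proof. intros Hf Hg H. apply continuous_Rmult; [exact Hf | now apply continuous_Rinv']. Qed.

Lemma continuous_sqrt_comp' {U : UniformSpace} (f : U -> R) p :
  continuous f p -> continuous (fun x => sqrt (f x)) p.
Proof.
  intros Hf. apply (continuous_comp_R f sqrt); [exact Hf|]. apply continuous_sqrt.
Qed.

Lemma continuous_exp_comp' {U : UniformSpace} (f : U -> R) p :
  continuous f p -> continuous (fun x => exp (f x)) p.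
Proof. intros Hf. apply (continuous_comp_R f exp); [exact Hf | apply continuous_exp]. Qed.

Lemma continuous_fst' {U V W : UniformSpace} (f : U -> V * W) p :
  continuous f p -> continuous (fun x => fst (f x)) p.
Proof.
  intros H. apply (continuous_comp f fst); [exact H|].
  destruct (f p) as [y z]; apply continuous_fst.
Qed.

Lemma continuous_snd' {U V W : UniformSpace} (f : U -> V * W) p :
  continuous f p -> continuous (fun x => snd (f x)) p.
Proof.
  intros H. apply (continuous_comp f snd); [exact H|].
  destruct (f p) as [y z]; apply continuous_snd.
Qed.

Lemma continuous_pair {U V W : UniformSpace} (f : U -> V) (g : U -> W) p :
  continuous f p -> continuous g p -> continuous (fun x => (f x, g x)) p.
Proof.
  intros Hf Hg. apply (continuous_comp_2 f g (fun y z => (y, z))); try assumption.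
  apply continuous_ext with (2 := continuous_id _). now intros [y z].
Qed.

Ltac continuity_step :=
  match goal with
  | |- continuous (fun _ => (_, _)) _ => apply continuous_pair
  | |- continuous fst _ => apply (continuous_fst' (fun x => x))
  | |- continuous (fun x => fst x) _ => apply (continuous_fst' (fun x => x))
  | |- continuous snd _ => apply (continuous_snd' (fun x => x))
  | |- continuous (fun x => snd x) _ => apply (continuous_snd' (fun x => x))
  | |- continuous (fun _ => fst _) _ => apply continuous_fst'
  | |- continuous (fun _ => snd _) _ => apply continuous_snd'
  | |- continuous (fun x => x) _ => exact (continuous_id _)
  | |- continuous (fun _ => _ + _) _ => apply continuous_Rplus
  | |- continuous (fun _ => _ - _) _ => apply continuous_Rminus
  | |- continuous (fun _ => - _) _ => apply continuous_Ropp
  | |- continuous (fun _ => _ / _) _ => apply continuous_Rdiv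
  | |- continuous (fun _ => _ * _) _ => apply continuous_Rmult
  | |- continuous (fun _ => _ ^ _) _ => apply continuous_Rpow
  | |- continuous (fun _ => / _) _ => apply continuous_Rinv'
  | |- continuous (fun _ => sqrt _) _ => apply continuous_sqrt_comp'
  | |- continuous (fun _ => exp _) _ => apply continuous_exp_comp'
  | |- continuous (fun _ => ?c) _ => apply continuous_const
  | _ => assumption
  end.
Ltac solve_cont := repeat continuity_step.

Lemma continuous_Rmin {U : UniformSpace} (f g : U -> R) p :
  continuous f p -> continuous g p -> continuous (fun q => Rmin (f q) (g q)) p.
Proof.
  intros Hf Hg. apply continuous_ext with (fun q => (f q + g q - Rabs (f q - g q)) / 2).
  - intros q. unfold Rmin. destruct (Rle_dec (f q) (g q)).
    + rewrite Rabs_left1 by lra. lra.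
    + rewrite Rabs_right by lra. lra.
  - unfold Rdiv. apply continuous_Rmult; [|apply continuous_const].
    apply continuous_Rminus; [now apply continuous_Rplus|].
    apply (continuous_comp_R (fun q => f q - g q) Rabs); [now apply continuous_Rminus|].
    apply continuous_Rabs.
Qed.

Lemma continuous_Rmax {U : UniformSpace} (f g : U -> R) p :
  continuous f p -> continuous g p -> continuous (fun q => Rmax (f q) (g q)) p.
Proof.
  intros Hf Hg. apply continuous_ext with (fun q => - Rmin (- f q) (- g q)).
  - intros q. pose proof (Ropp_Rmax (f q) (g q)). lra.
  - apply continuous_Ropp, continuous_Rmin; now apply continuous_Ropp.
Qed.

(** * Integration over the square *)

(** Compactness of [[a, b]] makes the continuity in the parameter uniform in the
    integration variable. *)
Lemma continuous_RInt_param {U : UniformSpace} (f : U -> R -> R) (a b : R) (u0 : U) :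
  a <= b ->
  cont (fun z : U * R => f (fst z) (snd z)) ->
  continuous (fun u => RInt (f u) a b) u0.
Proof.
  intros Hab Hf.
  assert (Hc : forall u t, continuous (f u) t).
  { intros u t. apply (continuous_comp_2 (fun _ => u) (fun t => t) f).
    apply continuous_const. apply continuous_id. apply (Hf (u, t)). }
  assert (Hi : forall u, ex_RInt (f u) a b).
  { intros u; apply (ex_RInt_continuous (V := R_CompleteNormedModule)).
    intros z _; apply Hc. }
  apply filterlim_locally. intros eps.
  set (e := eps / (b - a + 1)).
  assert (He : 0 < e).
  { apply Rdiv_lt_0_compat; [apply cond_pos | lra]. }
  assert (He2 : 0 < e / 2) by lra.
  assert (Hd : forall t : R, exists d : posreal, forall (u : U) (s : R),
     ball u0 d u -> Rabs (s - t) < d -> Rabs (f u s - f u0 t) < e / 2).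
  { intros t. destruct (proj1 (filterlim_locally _ _) (Hf (u0, t)) (mkposreal _ He2)) as [d Hd].
    exists d. intros u s Hu Hs. apply (Hd (u, s)). split; assumption. }
  destruct (functional_choice _ Hd) as [delta Hdelta].
  destruct (compactness_value_1d a b delta) as [d Hd'].
  exists d. intros u Hu.
  assert (Hclose : forall t, a <= t <= b -> Rabs (f u t - f u0 t) <= e).
  { intros t Ht. apply NNPP; intros Hn. apply (Hd' t Ht). intros (s & Hs & Hts & Hds).
    apply Hn. pose proof (Hdelta s u t (ball_le u0 _ _ Hds u Hu) Hts) as H1.
    pose proof (Hdelta s u0 t (ball_center u0 (delta s)) Hts) as H2.
    revert H1 H2; unfold Rabs; repeat destruct Rcase_abs; lra. }
  change (Rabs (RInt (f u) a b - RInt (f u0) a b) < eps).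
  assert (Heq : RInt (f u) a b - RInt (f u0) a b = RInt (fun t => f u t - f u0 t) a b).
  { symmetry. exact (RInt_minus (V := R_CompleteNormedModule) _ _ a b (Hi u) (Hi u0)). }
  rewrite Heq.
  apply Rle_lt_trans with ((b - a) * e).
  - apply abs_RInt_le_const; try assumption.
    exact (ex_RInt_minus (V := R_NormedModule) _ _ a b (Hi u) (Hi u0)).
  - unfold e. apply Rlt_le_trans with ((b - a + 1) * (eps / (b - a + 1))).
    + apply Rmult_lt_compat_r; [exact He | lra].
    + right; field; lra.
Qed.

Lemma cont_ex_RInt (f : R -> R) a b : cont f -> ex_RInt f a b.
Proof.
  intros Hf; apply (ex_RInt_continuous (V := R_CompleteNormedModule)).
  intros z _; apply Hf.
Qed.

Lemma cont_slice_r {U V : UniformSpace} (f : U * V -> R) u : cont f -> cont (fun v => f (u, v)).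
Proof. intros Hf v. apply (continuous_comp (fun v => (u, v)) f); [solve_cont | apply Hf]. Qed.

Lemma cont_slice_l {U V : UniformSpace} (f : U * V -> R) v : cont f -> cont (fun u => f (u, v)).
Proof. intros Hf u. apply (continuous_comp (fun u => (u, v)) f); [solve_cont | apply Hf]. Qed.

Lemma cont_swap {U V : UniformSpace} (f : U * V -> R) : cont f -> cont (fun z : V * U => f (snd z, fst z)).
Proof.
  intros Hf z. apply (continuous_comp (fun z : V * U => (snd z, fst z)) f); [solve_cont | apply Hf].
Qed.

Lemma cont_RInt_r {U : UniformSpace} (f : U * R -> R) a b :
  a <= b -> cont f -> cont (fun u => RInt (fun t => f (u, t)) a b).
Proof.
  intros Hab Hf u. apply (continuous_RInt_param (fun u t => f (u, t)) a b u Hab).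
  intros [v t]. apply continuous_ext with f; [now intros [? ?] | apply Hf].
Qed.

(** Both sides vanish at [x = a] and have the same derivative in the upper
    limit of the outer integral. *)
Lemma RInt_swap (f : R * R -> R) a b c d :
  a <= b -> c <= d -> cont f ->
  RInt (fun x => RInt (fun y => f (x, y)) c d) a b
  = RInt (fun y => RInt (fun x => f (x, y)) a b) c d.
Proof.
  intros Hab Hcd Hf.
  set (A := fun x => RInt (fun s => RInt (fun y => f (s, y)) c d) a x).
  set (B := fun x => RInt (fun y => RInt (fun s => f (s, y)) a x) c d).
  assert (HA : forall x, is_derive A x (RInt (fun y => f (x, y)) c d)).
  { intros x. apply (is_derive_RInt (V := R_NormedModule) (fun s => RInt (fun y => f (s, y)) c d) A a x).
    - exists (mkposreal 1 Rlt_0_1). intros y _. apply (RInt_correct (V := R_CompleteNormedModule)).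
      apply cont_ex_RInt, cont_RInt_r; assumption.
    - apply cont_RInt_r; assumption. }
  assert (Hin : forall x y, is_derive (fun x => RInt (fun s => f (s, y)) a x) x (f (x, y))).
  { intros x y. apply (is_derive_RInt (V := R_NormedModule) (fun s => f (s, y)) _ a x).
    - exists (mkposreal 1 Rlt_0_1). intros z _. apply (RInt_correct (V := R_CompleteNormedModule)).
      apply cont_ex_RInt, cont_slice_l, Hf.
    - apply (cont_slice_l f y Hf x). }
  assert (HB : forall x, a <= x -> is_derive B x (RInt (fun y => f (x, y)) c d)).
  { intros x Hx.
    assert (E : RInt (fun y => f (x, y)) c d
      = RInt (fun y => Derive (fun x => RInt (fun s => f (s, y)) a x) x) c d).
    { apply RInt_ext. intros y _. symmetry. apply is_derive_unique, Hin. }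
    rewrite E. apply (is_derive_RInt_param (fun x y => RInt (fun s => f (s, y)) a x)).
    - exists (mkposreal 1 Rlt_0_1). intros z _ t _. eexists; apply Hin.
    - intros t _. apply continuity_2d_pt_filterlim.
      apply filterlim_ext with f.
      + intros [z1 z2]. symmetry. apply is_derive_unique, Hin.
      + replace (Derive (fun z => RInt (fun s => f (s, t)) a z) x) with (f (x, t)).
        apply (Hf (x, t)). symmetry; apply is_derive_unique, Hin.
    - exists (mkposreal 1 Rlt_0_1). intros z _.
      destruct (Rle_dec a z) as [Hz|Hz].
      + apply cont_ex_RInt. apply (cont_RInt_r (fun z => f (snd z, fst z))); [exact Hz|].
        now apply cont_swap.
      + apply ex_RInt_ext with (fun y => - RInt (fun s => f (s, y)) z a).
        { intros y _. exact (opp_RInt_swap (V := R_CompleteNormedModule) _ z a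
            (cont_ex_RInt _ _ _ (cont_slice_l f y Hf))). }
        apply cont_ex_RInt. intros y. apply continuous_Ropp.
        apply (cont_RInt_r (fun z => f (snd z, fst z))); [lra|].
        now apply cont_swap. }
  change (A b = B b).
  destruct (Req_dec a b) as [<-|Hne].
  { unfold A, B. rewrite RInt_point. symmetry.
    etransitivity; [apply RInt_ext; intros y _; apply RInt_point|].
    rewrite (RInt_const (V := R_CompleteNormedModule)). unfold zero; simpl.
    unfold scal; simpl. unfold mult; simpl. ring. }
  assert (Hdiff : A a - B a = A b - B b).
  { apply (eq_is_derive (V := R_NormedModule) (fun x => A x - B x) a b); [|lra].
    intros t Ht.
    replace (@zero R_NormedModule) with
      (RInt (fun y => f (t, y)) c d - RInt (fun y => f (t, y)) c d) by (unfold zero; simpl; ring).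
    apply (is_derive_minus (V := R_NormedModule)); [apply HA | apply HB; lra]. }
  assert (A a = 0) by apply (RInt_point (V := R_CompleteNormedModule)).
  assert (B a = 0).
  { unfold B. 
    etransitivity; [apply RInt_ext; intros y _; apply (RInt_point (V := R_CompleteNormedModule))|].
    rewrite (RInt_const (V := R_CompleteNormedModule)). unfold zero; simpl.
    unfold scal; simpl. unfold mult; simpl. ring. }
  lra.
Qed.

(** All weights used below are supported in the unit disc and continuous, so a
    single square replaces the plane, and iterated Riemann integrals suffice. *)
Definition square_int (f : plane -> R) : R :=
  RInt (fun x => RInt (fun y => f (x, y)) (-1) 1) (-1) 1.

Notation "'∬' f" := (square_int f) (at level 10, f at level 9).

Lemma cont_inner (f : plane -> R) : cont f -> cont (fun x => RInt (fun y => f (x, y)) (-1) 1).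
Proof. intros Hf. apply (cont_RInt_r f (-1) 1); [lra | exact Hf]. Qed.

Lemma square_int_ext (f g : plane -> R) : (forall p, f p = g p) -> ∬ f = ∬ g.
Proof.
  intros H. apply RInt_ext; intros x _. apply RInt_ext; intros y _. apply H.
Qed.

Lemma square_int_plus (f g : plane -> R) :
  cont f -> cont g -> ∬ (fun p => f p + g p) = ∬ f + ∬ g.
Proof.
  intros Hf Hg. unfold square_int.
  rewrite <- (RInt_plus (V := R_CompleteNormedModule)) by (now apply cont_ex_RInt, cont_inner).
  apply RInt_ext; intros x _.
  exact (RInt_plus (V := R_CompleteNormedModule) _ _ _ _
    (cont_ex_RInt _ _ _ (cont_slice_r f x Hf)) (cont_ex_RInt _ _ _ (cont_slice_r g x Hg))).
Qed.

Lemma square_int_scal k (f : plane -> R) :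
  cont f -> ∬ (fun p => k * f p) = k * ∬ f.
Proof.
  intros Hf. unfold square_int.
  transitivity (RInt (fun x => scal k (RInt (fun y => f (x, y)) (-1) 1)) (-1) 1).
  - apply RInt_ext; intros x _.
    exact (RInt_scal (V := R_CompleteNormedModule) _ _ _ k (cont_ex_RInt _ _ _ (cont_slice_r f x Hf))).
  - apply (RInt_scal (V := R_CompleteNormedModule)). now apply cont_ex_RInt, cont_inner.
Qed.

Lemma square_int_minus (f g : plane -> R) :
  cont f -> cont g -> ∬ (fun p => f p - g p) = ∬ f - ∬ g.
Proof.
  intros Hf Hg.
  rewrite (square_int_ext _ (fun p => f p + (-1) * g p)) by (intros; ring).
  rewrite square_int_plus, square_int_scal; try assumption. ring.
  intros p. apply continuous_Rmult; [apply continuous_const | apply Hg].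
Qed.

Lemma square_int_le (f g : plane -> R) :
  cont f -> cont g ->
  (forall p, -1 <= fst p <= 1 -> -1 <= snd p <= 1 -> f p <= g p) -> ∬ f <= ∬ g.
Proof.
  intros Hf Hg H. apply RInt_le; [lra | now apply cont_ex_RInt, cont_inner |
    now apply cont_ex_RInt, cont_inner |].
  intros x Hx. apply RInt_le; [lra | now apply cont_ex_RInt, cont_slice_r |
    now apply cont_ex_RInt, cont_slice_r |].
  intros y Hy. apply H; simpl; lra.
Qed.

Lemma square_int_const k : ∬ (fun _ => k) = 4 * k.
Proof.
  unfold square_int.
  rewrite (RInt_ext _ (fun _ => 2 * k)).
  - rewrite (RInt_const (V := R_CompleteNormedModule)). unfold scal; simpl. unfold mult; simpl. ring.
  - intros x _. rewrite (RInt_const (V := R_CompleteNormedModule)). unfold scal; simpl. unfold mult; simpl. ring.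
Qed.

Lemma square_int_ge0 (f : plane -> R) :
  cont f -> (forall p, -1 <= fst p <= 1 -> -1 <= snd p <= 1 -> 0 <= f p) -> 0 <= ∬ f.
Proof.
  intros Hf H. replace 0 with (∬ (fun _ => 0)) by (rewrite square_int_const; ring).
  apply square_int_le; try assumption. intros p; apply continuous_const.
Qed.

Lemma RInt_ge_on_subinterval (f : R -> R) a b c d k :
  cont f -> a <= c -> c <= d -> d <= b -> (forall x, a <= x <= b -> 0 <= f x) ->
  (forall x, c <= x <= d -> k <= f x) -> (d - c) * k <= RInt f a b.
Proof.
  intros Hf Hac Hcd Hdb H0 Hk.
  assert (Hi : forall p q, ex_RInt f p q) by (intros; now apply cont_ex_RInt).
  rewrite <- (RInt_Chasles (V := R_CompleteNormedModule) f a c b) by apply Hi.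
  rewrite <- (RInt_Chasles (V := R_CompleteNormedModule) f c d b) by apply Hi.
  assert (0 <= RInt f a c) by (apply RInt_ge_0; [lra | apply Hi | intros; apply H0; lra]).
  assert (0 <= RInt f d b) by (apply RInt_ge_0; [lra | apply Hi | intros; apply H0; lra]).
  assert ((d - c) * k <= RInt f c d).
  { replace ((d - c) * k) with (RInt (fun _ => k) c d)
      by (rewrite (RInt_const (V := R_CompleteNormedModule)); reflexivity).
    apply RInt_le; [lra | apply cont_ex_RInt; intro; apply continuous_const | apply Hi |].
    intros; apply Hk; lra. }
  unfold plus; simpl. lra.
Qed.

(** This lower bound detects the mass of an approximate identity. *)
Lemma square_int_ge_on_subsquare (f : plane -> R) x d k :
  cont f -> 0 <= d -> -1 <= fst x - d -> fst x + d <= 1 -> -1 <= snd x - d -> snd x + d <= 1 ->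
  (forall p, 0 <= f p) ->
  (forall p, Rabs (fst p - fst x) <= d -> Rabs (snd p - snd x) <= d -> k <= f p) ->
  4 * d ^ 2 * k <= ∬ f.
Proof.
  intros Hf Hd H1 H2 H3 H4 H0 Hk.
  replace (4 * d ^ 2 * k) with ((fst x + d - (fst x - d)) * (2 * d * k)) by ring.
  apply RInt_ge_on_subinterval; try lra.
  - now apply cont_inner.
  - intros s _. apply RInt_ge_0; [lra | now apply cont_ex_RInt, cont_slice_r | intros; apply H0].
  - intros s Hs. replace (2 * d * k) with ((snd x + d - (snd x - d)) * k) by ring.
    apply RInt_ge_on_subinterval; try lra.
    + now apply cont_slice_r.
    + intros; apply H0.
    + intros t Ht. apply Hk; simpl; apply Rabs_le; lra.
Qed.

Lemma cont_square_int {U : UniformSpace} (f : U * plane -> R) :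
  cont f -> cont (fun u => ∬ (fun p => f (u, p))).
Proof.
  intros Hf u. unfold square_int.
  apply (cont_RInt_r (fun z : U * R => RInt (fun y => f (fst z, (snd z, y))) (-1) 1)); [lra|].
  apply (cont_RInt_r (fun z : (U * R) * R => f (fst (fst z), (snd (fst z), snd z)))); [lra|].
  intros z. apply (continuous_comp (fun z : (U * R) * R => (fst (fst z), (snd (fst z), snd z))) f).
  - solve_cont.
  - apply Hf.
Qed.

(** Four exchanges of one-dimensional integrals. *)
Lemma square_int_swap (f : plane * plane -> R) :
  cont f -> ∬ (fun p => ∬ (fun q => f (p, q))) = ∬ (fun q => ∬ (fun p => f (p, q))).
Proof.
  intros Hf. unfold square_int.
  assert (H4 : forall (W : UniformSpace) (h : W -> plane * plane),
    (forall w, continuous h w) -> cont (fun w => f (h w))).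
  { intros W h Hh w. apply (continuous_comp h f); [apply Hh | apply Hf]. }
  assert (Hle : -1 <= 1) by lra.
  (* exchange the second coordinate of [p] with both coordinates of [q] *)
  transitivity (RInt (fun x => RInt (fun s => RInt (fun t => RInt (fun y =>
     f ((x, y), (s, t))) (-1) 1) (-1) 1) (-1) 1) (-1) 1).
  { apply RInt_ext; intros x _.
    rewrite (RInt_swap (fun z => RInt (fun t => f ((x, fst z), (snd z, t))) (-1) 1)); try exact Hle.
    - apply RInt_ext; intros s _. simpl.
      apply (RInt_swap (fun z => f ((x, fst z), (s, snd z)))); try exact Hle.
      apply H4. intros w; solve_cont.
    - apply (cont_RInt_r (fun z : (R * R) * R => f ((x, fst (fst z)), (snd (fst z), snd z)))); [exact Hle|].
      apply H4; intros w; solve_cont. }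
  rewrite (RInt_swap (fun z => RInt (fun t => RInt (fun y => f ((fst z, y), (snd z, t))) (-1) 1) (-1) 1));
    try exact Hle.
  - apply RInt_ext; intros s _. simpl.
    apply (RInt_swap (fun z => RInt (fun y => f ((fst z, y), (s, snd z))) (-1) 1)); try exact Hle.
    apply (cont_RInt_r (fun z : (R * R) * R => f ((fst (fst z), snd z), (s, snd (fst z))))); [exact Hle|].
    apply H4; intros w; solve_cont.
  - apply (cont_RInt_r (fun z : (R * R) * R =>
      RInt (fun y => f ((fst (fst z), y), (snd (fst z), snd z))) (-1) 1)); [exact Hle|].
    apply (cont_RInt_r (fun z : ((R * R) * R) * R =>
      f ((fst (fst (fst z)), snd z), (snd (fst (fst z)), snd (fst z))))); [exact Hle|].
    apply H4; intros w; solve_cont.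
Qed.

(** * Green's identity *)

(** A C^2 function on [Omega], with its partial derivatives as witnesses: naming
    them avoids carrying [Derive] terms through computations with explicit test
    functions. *)
Definition has_laplacian (Omega : plane -> Prop) (u du : plane -> R) : Prop :=
  exists ux uy uxx uyy : plane -> R, forall p, Omega p ->
  (continuous u p /\ continuous ux p /\ continuous uy p /\
   continuous uxx p /\ continuous uyy p) /\
  (is_derive (fun t => u (t, snd p)) (fst p) (ux p) /\
   is_derive (fun t => ux (t, snd p)) (fst p) (uxx p)) /\
  (is_derive (fun t => u (fst p, t)) (snd p) (uy p) /\
   is_derive (fun t => uy (fst p, t)) (snd p) (uyy p)) /\
  continuous du p /\ du p = uxx p + uyy p.

Definition everywhere : plane -> Prop := fun _ => True.

(** [phi] vanishes near every point outside [Omega], not just at that point, so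
    that its derivatives vanish there too. *)
Definition supported (Omega : plane -> Prop) (phi : plane -> R) : Prop :=
  forall p, Omega p \/ locally p (fun q => phi q = 0).

Definition in_box (Omega : plane -> Prop) : Prop :=
  forall p, Omega p -> (-1 < fst p < 1) /\ (-1 < snd p < 1).

Lemma continuous_locally_0 {U : UniformSpace} (f : U -> R) p :
  locally p (fun q => f q = 0) -> continuous f p.
Proof.
  intros H. apply continuous_ext_loc with (fun _ => 0).
  - revert H. apply filter_imp. auto.
  - apply continuous_const.
Qed.

(** Multiplication by a supported weight extends a function that is only known on
    [Omega] by zero; this is how functions on a punctured disc get integrated. *)
Lemma cont_supported (Omega : plane -> Prop) (phi F : plane -> R) :
  cont phi -> supported Omega phi -> (forall p, Omega p -> continuous F p) ->
  cont (fun p => phi p * F p).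
Proof.
  intros Hphi Hs HF p. destruct (Hs p) as [H|H].
  - apply continuous_Rmult; auto.
  - apply continuous_locally_0. revert H. apply filter_imp.
    intros q Hq. rewrite Hq; ring.
Qed.

Lemma has_laplacian_continuous Omega u du p :
  has_laplacian Omega u du -> Omega p -> continuous u p /\ continuous du p.
Proof.
  intros (ux & uy & uxx & uyy & H) Hp. destruct (H p Hp) as ((? & _) & _ & _ & ? & _). tauto.
Qed.

Lemma locally_slice_l (P : plane -> Prop) p :
  locally p P -> locally (fst p) (fun t => P (t, snd p)).
Proof.
  intros [d Hd]. exists d. intros t Ht. apply Hd. split; [exact Ht | apply ball_center].
Qed.

Lemma locally_slice_r (P : plane -> Prop) p :
  locally p P -> locally (snd p) (fun t => P (fst p, t)).
Proof.
  intros [d Hd]. exists d. intros t Ht. apply Hd. split; [apply ball_center | exact Ht].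
Qed.

Lemma is_derive_locally_0 (f : R -> R) x :
  locally x (fun t => f t = 0) -> is_derive f x 0.
Proof.
  intros H. apply is_derive_ext_loc with (fun _ => 0).
  - revert H; apply filter_imp; auto.
  - apply (is_derive_const (V := R_NormedModule) 0 x).
Qed.

Lemma is_derive_locally_0_eq (f : R -> R) x l :
  locally x (fun t => f t = 0) -> is_derive f x l -> l = 0.
Proof.
  intros H Hl. rewrite <- (is_derive_unique f x l Hl).
  apply is_derive_unique. now apply is_derive_locally_0.
Qed.

Lemma locally_0_derive_l (phi phix : plane -> R) p :
  (forall q, is_derive (fun t => phi (t, snd q)) (fst q) (phix q)) ->
  locally p (fun q => phi q = 0) -> locally p (fun q => phix q = 0).
Proof.
  intros Hd H. apply locally_locally in H. revert H. apply filter_imp.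
  intros q Hq. apply (is_derive_locally_0_eq _ _ _ (locally_slice_l _ q Hq) (Hd q)).
Qed.

Lemma locally_0_derive_r (phi phiy : plane -> R) p :
  (forall q, is_derive (fun t => phi (fst q, t)) (snd q) (phiy q)) ->
  locally p (fun q => phi q = 0) -> locally p (fun q => phiy q = 0).
Proof.
  intros Hd H. apply locally_locally in H. revert H. apply filter_imp.
  intros q Hq. apply (is_derive_locally_0_eq _ _ _ (locally_slice_r _ q Hq) (Hd q)).
Qed.

Lemma has_laplacian_supported Omega phi dphi :
  has_laplacian everywhere phi dphi -> supported Omega phi -> supported Omega dphi.
Proof.
  intros (fx & fy & fxx & fyy & H) Hs p. destruct (Hs p) as [Hp|Hp]; [now left|right].
  assert (Hx : locally p (fun q => fxx q = 0)).
  { apply (locally_0_derive_l fx). intros q; apply (H q I).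
    apply (locally_0_derive_l phi). intros q; apply (H q I). exact Hp. }
  assert (Hy : locally p (fun q => fyy q = 0)).
  { apply (locally_0_derive_r fy). intros q; apply (H q I).
    apply (locally_0_derive_r phi). intros q; apply (H q I). exact Hp. }
  generalize (filter_and _ _ Hx Hy). apply filter_imp. intros q [H1 H2].
  destruct (H q I) as (_ & _ & _ & _ & ->). rewrite H1, H2; ring.
Qed.

Lemma RInt_derive_0 (f df : R -> R) :
  (forall x : R, is_derive f x (df x)) -> cont df -> f (-1) = 0 -> f 1 = 0 ->
  RInt df (-1) 1 = 0.
Proof.
  intros Hd Hc H1 H2.
  rewrite (is_RInt_unique (V := R_CompleteNormedModule) df (-1) 1 (minus (f 1) (f (-1)))).
  - rewrite H1, H2. unfold minus, plus, opp; simpl; ring.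
  - apply (is_RInt_derive (V := R_CompleteNormedModule)); intros; [apply Hd | apply Hc].
Qed.

Lemma wronskian_derive (f f1 u u1 : R -> R) t f2 u2 :
  is_derive f t (f1 t) -> is_derive f1 t f2 -> is_derive u t (u1 t) -> is_derive u1 t u2 ->
  is_derive (fun t => f t * u1 t - f1 t * u t) t (f t * u2 - f2 * u t).
Proof.
  intros H1 H2 H3 H4.
  replace (f t * u2 - f2 * u t)
    with ((f1 t * u1 t + f t * u2) - (f2 * u t + f1 t * u1 t)) by ring.
  apply (is_derive_minus (V := R_NormedModule)).
  - apply (is_derive_mult (K := R_AbsRing) f u1 t (f1 t) u2); try assumption. intros; apply Rmult_comm.
  - apply (is_derive_mult (K := R_AbsRing) f1 u t f2 (u1 t)); try assumption. intros; apply Rmult_comm.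
Qed.

(** In each variable separately, [phi u'' - phi'' u] is the derivative of the
    Wronskian [phi u' - phi' u], which vanishes at both ends of the square. *)
Lemma green (Omega : plane -> Prop) (u du phi dphi : plane -> R) :
  in_box Omega -> has_laplacian Omega u du -> has_laplacian everywhere phi dphi ->
  supported Omega phi ->
  ∬ (fun p => phi p * du p) = ∬ (fun p => dphi p * u p).
Proof.
  intros Hbox Hu Hphi Hs.
  pose proof (has_laplacian_supported _ _ _ Hphi Hs) as Hsd.
  assert (Hc1 : cont (fun p => phi p * du p)).
  { apply (cont_supported Omega); try assumption.
    - intros p; apply (has_laplacian_continuous _ _ _ p Hphi I).
    - intros p Hp; apply (has_laplacian_continuous _ _ _ p Hu Hp). }
  assert (Hc2 : cont (fun p => dphi p * u p)).
  { apply (cont_supported Omega); try assumption.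
    - intros p; apply (has_laplacian_continuous _ _ _ p Hphi I).
    - intros p Hp; apply (has_laplacian_continuous _ _ _ p Hu Hp). }
  enough (∬ (fun p => phi p * du p - dphi p * u p) = 0) by
    (rewrite square_int_minus in H by assumption; lra).
  destruct Hu as (ux & uy & uxx & uyy & Hu).
  destruct Hphi as (fx & fy & fxx & fyy & Hphi).
  assert (Hx0 : forall p, locally p (fun q => phi q = 0) -> locally p (fun q => fx q = 0)).
  { intros p. apply locally_0_derive_l. intros q; apply (Hphi q I). }
  assert (Hy0 : forall p, locally p (fun q => phi q = 0) -> locally p (fun q => fy q = 0)).
  { intros p. apply locally_0_derive_r. intros q; apply (Hphi q I). }
  assert (Hxx0 : forall p, locally p (fun q => phi q = 0) -> locally p (fun q => fxx q = 0)).
  { intros p Hp. apply (locally_0_derive_l fx); auto. intros q; apply (Hphi q I). }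
  assert (Hyy0 : forall p, locally p (fun q => phi q = 0) -> locally p (fun q => fyy q = 0)).
  { intros p Hp. apply (locally_0_derive_r fy); auto. intros q; apply (Hphi q I). }
  set (A := fun p => phi p * uxx p - fxx p * u p).
  set (B := fun p => phi p * uyy p - fyy p * u p).
  assert (HA : cont A).
  { intros p. destruct (Hs p) as [Hp|Hp].
    - destruct (Hphi p I) as ((? & ? & ? & ? & ?) & _).
      destruct (Hu p Hp) as ((? & ? & ? & ? & ?) & _). unfold A; solve_cont; assumption.
    - apply continuous_locally_0. generalize (filter_and _ _ Hp (Hxx0 p Hp)).
      apply filter_imp. intros q [H1 H2]. unfold A; rewrite H1, H2; ring. }
  assert (HB : cont B).
  { intros p. destruct (Hs p) as [Hp|Hp].
    - destruct (Hphi p I) as ((? & ? & ? & ? & ?) & _).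
      destruct (Hu p Hp) as ((? & ? & ? & ? & ?) & _). unfold B; solve_cont; assumption.
    - apply continuous_locally_0. generalize (filter_and _ _ Hp (Hyy0 p Hp)).
      apply filter_imp. intros q [H1 H2]. unfold B; rewrite H1, H2; ring. }
  assert (Hout : forall p, ~ Omega p -> phi p = 0 /\ fx p = 0 /\ fy p = 0).
  { intros p Hp. destruct (Hs p) as [?|Hl]; [tauto|].
    split; [apply (locally_singleton _ _ Hl)|].
    split; [apply (locally_singleton _ _ (Hx0 p Hl)) | apply (locally_singleton _ _ (Hy0 p Hl))]. }
  assert (IA : ∬ A = 0).
  { unfold square_int. rewrite (RInt_swap A); try lra; [|exact HA].
    rewrite (RInt_ext _ (fun _ => 0)).
    - rewrite (RInt_const (V := R_CompleteNormedModule)). unfold scal; simpl; unfold mult; simpl; ring.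
    - intros y _. apply (RInt_derive_0 (fun x => phi (x, y) * ux (x, y) - fx (x, y) * u (x, y))).
      + intros x. destruct (Hs (x, y)) as [Hp|Hp].
        * apply (wronskian_derive (fun x => phi (x, y)) (fun x => fx (x, y))
            (fun x => u (x, y)) (fun x => ux (x, y)) x (fxx (x, y)) (uxx (x, y)));
          [apply (Hphi (x, y) I) | apply (Hphi (x, y) I) | apply (Hu (x, y) Hp) | apply (Hu (x, y) Hp)].
        * assert (E1 : phi (x, y) = 0) by exact (locally_singleton _ _ Hp).
          assert (E2 : fxx (x, y) = 0) by exact (locally_singleton _ _ (Hxx0 _ Hp)).
          unfold A. rewrite E1, E2.
          replace (0 * uxx (x, y) - 0 * u (x, y)) with 0 by ring.
          apply is_derive_locally_0.
          generalize (locally_slice_l _ _ (filter_and _ _ Hp (Hx0 _ Hp))).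
          apply filter_imp. simpl. intros t [H1 H2]. rewrite H1, H2; ring.
      + apply (cont_slice_l A y HA).
      + destruct (Hout (-1, y)) as (-> & -> & _); [|ring].
        intros Hp; apply Hbox in Hp; simpl in Hp; lra.
      + destruct (Hout (1, y)) as (-> & -> & _); [|ring].
        intros Hp; apply Hbox in Hp; simpl in Hp; lra. }
  assert (IB : ∬ B = 0).
  { unfold square_int.
    rewrite (RInt_ext _ (fun _ => 0)).
    - rewrite (RInt_const (V := R_CompleteNormedModule)). unfold scal; simpl; unfold mult; simpl; ring.
    - intros x _. apply (RInt_derive_0 (fun y => phi (x, y) * uy (x, y) - fy (x, y) * u (x, y))).
      + intros y. destruct (Hs (x, y)) as [Hp|Hp].
        * apply (wronskian_derive (fun y => phi (x, y)) (fun y => fy (x, y))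
            (fun y => u (x, y)) (fun y => uy (x, y)) y (fyy (x, y)) (uyy (x, y)));
          [apply (Hphi (x, y) I) | apply (Hphi (x, y) I) | apply (Hu (x, y) Hp) | apply (Hu (x, y) Hp)].
        * assert (E1 : phi (x, y) = 0) by exact (locally_singleton _ _ Hp).
          assert (E2 : fyy (x, y) = 0) by exact (locally_singleton _ _ (Hyy0 _ Hp)).
          unfold B. rewrite E1, E2.
          replace (0 * uyy (x, y) - 0 * u (x, y)) with 0 by ring.
          apply is_derive_locally_0.
          generalize (locally_slice_r _ _ (filter_and _ _ Hp (Hy0 _ Hp))).
          apply filter_imp. simpl. intros t [H1 H2]. rewrite H1, H2; ring.
      + apply (cont_slice_r B x HB).
      + destruct (Hout (x, -1)) as (-> & _ & ->); [|ring].
        intros Hp; apply Hbox in Hp; simpl in Hp; lra.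
      + destruct (Hout (x, 1)) as (-> & _ & ->); [|ring].
        intros Hp; apply Hbox in Hp; simpl in Hp; lra. }
  rewrite (square_int_ext _ (fun p => A p + B p)).
  - rewrite square_int_plus, IA, IB by assumption. ring.
  - intros p. destruct (Hs p) as [Hp|Hp].
    + destruct (Hphi p I) as (_ & _ & _ & _ & ->).
      destruct (Hu p Hp) as (_ & _ & _ & _ & ->). unfold A, B; ring.
    + unfold A, B. destruct (Hphi p I) as (_ & _ & _ & _ & ->).
      rewrite (locally_singleton _ _ Hp), (locally_singleton _ _ (Hxx0 p Hp)),
        (locally_singleton _ _ (Hyy0 p Hp)). ring.
Qed.

(** * Radial functions *)

(** Radial functions are written as functions of the squared distance, which is a
    polynomial. *)
Definition sqdist (p q : plane) : R := (fst p - fst q) ^ 2 + (snd p - snd q) ^ 2.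

Lemma sqdist_ge0 p q : 0 <= sqdist p q.
Proof. unfold sqdist. apply Rplus_le_le_0_compat; apply pow2_ge_0. Qed.

Lemma sqdist_sym p q : sqdist p q = sqdist q p.
Proof. unfold sqdist; ring. Qed.

Lemma sqdist_triangle p q r : sqdist p r <= 2 * sqdist p q + 2 * sqdist q r.
Proof.
  unfold sqdist.
  pose proof (pow2_ge_0 ((fst p - fst q) - (fst q - fst r))).
  pose proof (pow2_ge_0 ((snd p - snd q) - (snd q - snd r))). nra.
Qed.

Lemma continuous_sqdist {U : UniformSpace} (f g : U -> plane) z :
  continuous f z -> continuous g z -> continuous (fun z => sqdist (f z) (g z)) z.
Proof. intros Hf Hg. unfold sqdist. solve_cont; assumption. Qed.

Definition C2_on (D : R -> Prop) (F F1 F2 : R -> R) : Prop :=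
  forall s, D s -> is_derive F s (F1 s) /\ is_derive F1 s (F2 s) /\ continuous F2 s.

Lemma C2_on_continuous D F F1 F2 s :
  C2_on D F F1 F2 -> D s -> continuous F s /\ continuous F1 s /\ continuous F2 s.
Proof.
  intros H Hs. destruct (H s Hs) as (H1 & H2 & H3). split; [|split]; try assumption.
  - apply (ex_derive_continuous (V := R_NormedModule)). eexists; exact H1.
  - apply (ex_derive_continuous (V := R_NormedModule)). eexists; exact H2.
Qed.

Lemma radial_derive (F F1 F2 : R -> R) a c t :
  is_derive F ((t - a) ^ 2 + c) (F1 ((t - a) ^ 2 + c)) ->
  is_derive F1 ((t - a) ^ 2 + c) (F2 ((t - a) ^ 2 + c)) ->
  is_derive (fun t => F ((t - a) ^ 2 + c)) t (2 * (t - a) * F1 ((t - a) ^ 2 + c)) /\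
  is_derive (fun t => 2 * (t - a) * F1 ((t - a) ^ 2 + c)) t
     (2 * F1 ((t - a) ^ 2 + c) + 4 * (t - a) ^ 2 * F2 ((t - a) ^ 2 + c)).
Proof.
  intros H1 H2.
  assert (Hq : is_derive (fun t => (t - a) ^ 2 + c) t (2 * (t - a))).
  { auto_derive; [trivial|]. simpl; ring. }
  assert (Hlin : is_derive (fun t => 2 * (t - a)) t 2) by (auto_derive; [trivial | ring]).
  split.
  - exact (is_derive_comp (V := R_NormedModule) F (fun t => (t - a) ^ 2 + c) t _ _ H1 Hq).
  - pose proof (is_derive_comp (V := R_NormedModule) F1 (fun t => (t - a) ^ 2 + c) t _ _ H2 Hq) as H3.
    pose proof (is_derive_mult (K := R_AbsRing) _ _ t _ _ Hlin H3 Rmult_comm) as H4.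
    simpl in H4. unfold plus, mult, scal in H4; simpl in H4. unfold mult in H4; simpl in H4.
    replace (2 * F1 ((t - a) ^ 2 + c) + 4 * (t - a) ^ 2 * F2 ((t - a) ^ 2 + c))
     with (2 * F1 ((t - a) ^ 2 + c) + 2 * (t - a) * (2 * (t - a) * F2 ((t - a) ^ 2 + c))) by ring.
    exact H4.
Qed.

(** In terms of [s = |p - x|^2] the planar Laplacian is [4 (s F')'], that is,
    [4 / s] times the second derivative in [log s]. *)
Lemma radial_has_laplacian (F F1 F2 : R -> R) (x : plane) :
  C2_on (fun s => 0 <= s) F F1 F2 ->
  has_laplacian everywhere (fun p => F (sqdist p x))
    (fun p => 4 * (F1 (sqdist p x) + sqdist p x * F2 (sqdist p x))).
Proof.
  intros HF.
  assert (Hsq : forall p, continuous (fun p => sqdist p x) p).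
  { intros p. apply continuous_sqdist; solve_cont. }
  assert (Hc0 : forall p, continuous (fun p => F (sqdist p x)) p).
  { intros p. apply (continuous_comp_R (fun p => sqdist p x) F); [apply Hsq|].
    apply (C2_on_continuous _ F F1 F2 _ HF (sqdist_ge0 p x)). }
  assert (Hc1 : forall p, continuous (fun p => F1 (sqdist p x)) p).
  { intros p. apply (continuous_comp_R (fun p => sqdist p x) F1); [apply Hsq|].
    apply (C2_on_continuous _ F F1 F2 _ HF (sqdist_ge0 p x)). }
  assert (Hc2 : forall p, continuous (fun p => F2 (sqdist p x)) p).
  { intros p. apply (continuous_comp_R (fun p => sqdist p x) F2); [apply Hsq|].
    apply (C2_on_continuous _ F F1 F2 _ HF (sqdist_ge0 p x)). }
  exists (fun p => 2 * (fst p - fst x) * F1 (sqdist p x)),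
    (fun p => 2 * (snd p - snd x) * F1 (sqdist p x)),
    (fun p => 2 * F1 (sqdist p x) + 4 * (fst p - fst x) ^ 2 * F2 (sqdist p x)),
    (fun p => 2 * F1 (sqdist p x) + 4 * (snd p - snd x) ^ 2 * F2 (sqdist p x)).
  intros p _.
  pose proof (Hc0 p). pose proof (Hc1 p). pose proof (Hc2 p). pose proof (Hsq p).
  destruct (HF _ (sqdist_ge0 p x)) as (D1 & D2 & _).
  split; [|split; [|split; [|split]]].
  - repeat split; try apply Hc0; solve_cont; assumption.
  - apply (radial_derive F F1 F2 (fst x) ((snd p - snd x) ^ 2) (fst p)); assumption.
  - unfold sqdist in *. rewrite Rplus_comm in D1, D2.
    destruct (radial_derive F F1 F2 (snd x) ((fst p - fst x) ^ 2) (snd p) D1 D2) as [E1 E2].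
    split.
    + rewrite (Rplus_comm ((fst p - fst x) ^ 2)). revert E1.
      apply is_derive_ext. intros t; now rewrite Rplus_comm.
    + rewrite (Rplus_comm ((fst p - fst x) ^ 2)). revert E2.
      apply is_derive_ext. intros t; simpl; now rewrite Rplus_comm.
  - solve_cont; assumption.
  - unfold sqdist; ring.
Qed.

Lemma C2_on_weaken (D E : R -> Prop) F F1 F2 :
  (forall s, E s -> D s) -> C2_on D F F1 F2 -> C2_on E F F1 F2.
Proof. intros HED H s Hs. apply H, HED, Hs. Qed.

Lemma is_derive_Rmult (f g : R -> R) s f1 g1 :
  is_derive f s f1 -> is_derive g s g1 ->
  is_derive (fun s => f s * g s) s (f1 * g s + f s * g1).
Proof. intros Hf Hg. exact (is_derive_mult (K := R_AbsRing) f g s f1 g1 Hf Hg Rmult_comm). Qed.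

Lemma is_derive_Rcomp (f g : R -> R) s f1 g1 :
  is_derive f (g s) f1 -> is_derive g s g1 -> is_derive (fun s => f (g s)) s (f1 * g1).
Proof.
  intros Hf Hg. rewrite Rmult_comm.
  exact (is_derive_comp (V := R_NormedModule) f g s f1 g1 Hf Hg).
Qed.

Lemma is_derive_Rplus (f g : R -> R) s f1 g1 :
  is_derive f s f1 -> is_derive g s g1 -> is_derive (fun s => f s + g s) s (f1 + g1).
Proof. intros Hf Hg. exact (is_derive_plus (V := R_NormedModule) f g s f1 g1 Hf Hg). Qed.

Lemma C2_comp (D E : R -> Prop) F F1 F2 g g1 g2 :
  C2_on E F F1 F2 -> C2_on D g g1 g2 -> (forall s, D s -> E (g s)) ->
  C2_on D (fun s => F (g s)) (fun s => F1 (g s) * g1 s)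
    (fun s => F2 (g s) * g1 s ^ 2 + F1 (g s) * g2 s).
Proof.
  intros HF Hg HDE s Hs.
  destruct (HF (g s) (HDE s Hs)) as (A1 & A2 & A3). destruct (Hg s Hs) as (B1 & B2 & B3).
  destruct (C2_on_continuous _ _ _ _ s Hg Hs) as (C1 & C2 & _).
  destruct (C2_on_continuous _ _ _ _ _ HF (HDE s Hs)) as (_ & C3 & _).
  split; [|split].
  - now apply is_derive_Rcomp.
  - replace (F2 (g s) * g1 s ^ 2 + F1 (g s) * g2 s)
      with (F2 (g s) * g1 s * g1 s + F1 (g s) * g2 s) by ring.
    apply (is_derive_Rmult (fun s => F1 (g s))); [now apply is_derive_Rcomp | exact B2].
  - apply continuous_Rplus; apply continuous_Rmult; try assumption.
    + now apply (continuous_comp_R g F2).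
    + now apply continuous_Rpow.
    + now apply (continuous_comp_R g F1).
Qed.

Lemma C2_mult (D : R -> Prop) F F1 F2 G G1 G2 :
  C2_on D F F1 F2 -> C2_on D G G1 G2 ->
  C2_on D (fun s => F s * G s) (fun s => F1 s * G s + F s * G1 s)
    (fun s => F2 s * G s + 2 * (F1 s * G1 s) + F s * G2 s).
Proof.
  intros HF HG s Hs.
  destruct (HF s Hs) as (A1 & A2 & A3). destruct (HG s Hs) as (B1 & B2 & B3).
  destruct (C2_on_continuous _ _ _ _ s HF Hs) as (C1 & C2 & _).
  destruct (C2_on_continuous _ _ _ _ s HG Hs) as (C3 & C4 & _).
  split; [|split].
  - now apply is_derive_Rmult.
  - replace (F2 s * G s + 2 * (F1 s * G1 s) + F s * G2 s)
      with ((F2 s * G s + F1 s * G1 s) + (F1 s * G1 s + F s * G2 s)) by ring.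
    apply is_derive_Rplus; now apply is_derive_Rmult.
  - solve_cont; assumption.
Qed.

Lemma C2_affine D a b : C2_on D (fun s => a * s + b) (fun _ => a) (fun _ => 0).
Proof.
  intros s _. split; [|split].
  - auto_derive; [trivial | ring].
  - apply (is_derive_const (V := R_NormedModule)).
  - apply continuous_const.
Qed.

Lemma C2_scaled F F1 F2 a :
  C2_on (fun _ => True) F F1 F2 ->
  C2_on (fun _ => True) (fun s => F (s / a)) (fun s => F1 (s / a) / a) (fun s => F2 (s / a) / a ^ 2).
Proof.
  intros HF s _. destruct (HF (s / a) I) as (D1 & D2 & D3).
  assert (Hd : is_derive (fun s => s / a) s (/ a)).
  { unfold Rdiv. apply (is_derive_ext (fun s => / a * s)); [intros; apply Rmult_comm|].
    auto_derive; [trivial | ring]. }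
  split; [|split].
  - now apply (is_derive_Rcomp F (fun s => s / a)).
  - replace (F2 (s / a) / a ^ 2) with (F2 (s / a) * / a * / a + F1 (s / a) * 0)
      by (unfold Rdiv; rewrite <- pow_inv; ring).
    apply (is_derive_Rmult (fun s => F1 (s / a)) (fun _ => / a)); [now apply (is_derive_Rcomp F1 (fun s => s / a))|].
    apply (is_derive_const (V := R_NormedModule)).
  - unfold Rdiv at 1. apply continuous_Rmult; [|apply continuous_const].
    apply (continuous_comp_R (fun s => s / a) F2); [|exact D3].
    apply (continuous_Rmult (fun s => s)); [apply continuous_id | apply continuous_const].
Qed.

(** * Gluing with zero *)

Definition zero_below (c : R) (f : R -> R) (x : R) : R := if Rle_dec x c then 0 else f x.

Lemma zero_below_le c f x : x <= c -> zero_below c f x = 0.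
Proof. intros H. unfold zero_below. destruct (Rle_dec x c); [reflexivity | lra]. Qed.

Lemma zero_below_gt c f x : c < x -> zero_below c f x = f x.
Proof. intros H. unfold zero_below. destruct (Rle_dec x c); [lra | reflexivity]. Qed.

Lemma locally_gt c x : c < x -> locally x (fun t => c < t).
Proof. intros H. exact (open_gt c x H). Qed.

Lemma locally_lt c x : x < c -> locally x (fun t => t < c).
Proof. intros H. exact (open_lt c x H). Qed.

Lemma zero_below_continuous c f x :
  f c = 0 -> (forall x, c <= x -> continuous f x) -> continuous (zero_below c f) x.
Proof.
  intros H0 Hf. destruct (Rtotal_order x c) as [Hx|[->|Hx]].
  - apply continuous_locally_0. generalize (locally_lt c x Hx). apply filter_imp.
    intros t Ht. apply zero_below_le; lra.
  - apply filterlim_locally. intros eps.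
    destruct (proj1 (filterlim_locally _ _) (Hf c (Rle_refl c)) eps) as [d Hd].
    exists d. intros t Ht. rewrite (zero_below_le c f c) by lra.
    unfold zero_below. destruct (Rle_dec t c) as [_|_]; [apply ball_center|].
    rewrite <- H0. now apply Hd.
  - apply continuous_ext_loc with f.
    + generalize (locally_gt c x Hx). apply filter_imp. intros t Ht.
      symmetry; now apply zero_below_gt.
    + apply Hf; lra.
Qed.

(** At the junction the difference quotients are those of [f] or zero. *)
Lemma zero_below_derive c f f1 x :
  f c = 0 -> f1 c = 0 -> (forall x, c <= x -> is_derive f x (f1 x)) ->
  is_derive (zero_below c f) x (zero_below c f1 x).
Proof.
  intros H0 H1 Hf. destruct (Rtotal_order x c) as [Hx|[->|Hx]].
  - rewrite zero_below_le by lra. apply is_derive_locally_0.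
    generalize (locally_lt c x Hx). apply filter_imp. intros t Ht. apply zero_below_le; lra.
  - rewrite zero_below_le by lra. apply is_derive_Reals. intros eps Heps.
    pose proof (Hf c (Rle_refl c)) as Hc. rewrite H1 in Hc. apply is_derive_Reals in Hc.
    destruct (Hc eps Heps) as [d Hd]. exists d. intros h Hh Hhd.
    rewrite (zero_below_le c f c) by lra. unfold zero_below.
    destruct (Rle_dec (c + h) c) as [_|_].
    + replace ((0 - 0) / h - 0) with 0 by (field; exact Hh). rewrite Rabs_R0; exact Heps.
    + rewrite <- H0 at 1. now apply Hd.
  - rewrite zero_below_gt by lra. apply is_derive_ext_loc with f.
    + generalize (locally_gt c x Hx). apply filter_imp. intros t Ht.
      symmetry; now apply zero_below_gt.
    + apply Hf; lra.
Qed.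

Lemma zero_below_C2 c f f1 f2 :
  C2_on (fun x => c <= x) f f1 f2 -> f c = 0 -> f1 c = 0 -> f2 c = 0 ->
  C2_on (fun _ => True) (zero_below c f) (zero_below c f1) (zero_below c f2).
Proof.
  intros H H0 H1 H2 x _. split; [|split].
  - apply zero_below_derive; try assumption. intros; now apply H.
  - apply zero_below_derive; try assumption. intros; now apply H.
  - apply zero_below_continuous; try assumption. intros; now apply H.
Qed.

Lemma nondecreasing_of_derive (f f1 : R -> R) a b :
  a <= b -> (forall x, a <= x <= b -> is_derive f x (f1 x)) ->
  (forall x, a <= x <= b -> 0 <= f1 x) -> f a <= f b.
Proof.
  intros Hab Hd H0.
  destruct (MVT_gen f a b f1) as (c & Hc & E).
  - intros x. rewrite Rmin_left, Rmax_right by lra. intros; apply Hd; lra.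
  - intros x. rewrite Rmin_left, Rmax_right by lra. intros Hx.
    apply continuity_pt_filterlim. apply (ex_derive_continuous (V := R_NormedModule)).
    eexists; now apply Hd.
  - rewrite Rmin_left, Rmax_right in Hc by lra. specialize (H0 c Hc). nra.
Qed.

(** * The cutoff *)

Definition cube : R -> R := zero_below 0 (fun t => t ^ 3).
Definition cube1 : R -> R := zero_below 0 (fun t => 3 * t ^ 2).
Definition cube2 : R -> R := zero_below 0 (fun t => 6 * t).

Lemma cube_C2 : C2_on (fun _ => True) cube cube1 cube2.
Proof.
  apply zero_below_C2; try (simpl; ring).
  intros x _. split; [|split].
  - auto_derive; [trivial | simpl; ring].
  - auto_derive; [trivial | simpl; ring].
  - solve_cont.
Qed.

(** Of class C^2, because [t -> max (t, 0) ^ 3] is. The inner cube vanishes up to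
    [w = 1 / 2] and makes the outer one vanish from [w = 1] on. *)
Definition cutoff (w : R) : R := cube (-1 * cube (2 * w + -1) + 1).

Lemma cutoff_C2 :
  exists c1 c2, C2_on (fun _ => True) cutoff c1 c2 /\
  (forall w, w <= 1 / 2 \/ 1 <= w -> c1 w = 0 /\ c2 w = 0).
Proof.
  do 2 eexists. split.
  - apply (C2_comp (fun _ => True) (fun _ => True) cube cube1 cube2
      (fun w => -1 * cube (2 * w + -1) + 1)); [apply cube_C2 | | trivial].
    apply (C2_comp (fun _ => True) (fun _ => True) (fun s => -1 * s + 1) (fun _ => -1) (fun _ => 0)
      (fun w => cube (2 * w + -1))); [apply C2_affine | | trivial].
    apply (C2_comp (fun _ => True) (fun _ => True) cube cube1 cube2
      (fun w => 2 * w + -1) (fun _ => 2) (fun _ => 0)); [apply cube_C2 | apply C2_affine | trivial].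
  - intros w [Hw|Hw]; cbv beta.
    + unfold cube1, cube2. rewrite !(zero_below_le _ _ (2 * w + -1)) by lra. split; ring.
    + assert (H : -1 * cube (2 * w + -1) + 1 <= 0).
      { unfold cube; rewrite zero_below_gt by lra.
        pose proof (pow_incr 1 (2 * w + -1) 3). rewrite pow1 in H. lra. }
      unfold cube1, cube2.
      rewrite !(zero_below_le _ _ (-1 * cube (2 * w + -1) + 1)) by lra. split; ring.
Qed.

Lemma cube_ge0 t : 0 <= cube t.
Proof.
  unfold cube, zero_below. destruct (Rle_dec t 0); [lra|]. apply pow_le; lra.
Qed.

Lemma cutoff_bounds w : 0 <= cutoff w <= 1.
Proof.
  split; [apply cube_ge0|]. unfold cutoff.
  pose proof (cube_ge0 (2 * w + -1)). set (c := cube (2 * w + -1)) in *.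
  unfold cube, zero_below. destruct (Rle_dec (-1 * c + 1) 0); [lra|].
  rewrite <- (pow1 3). apply pow_incr; lra.
Qed.

Lemma cutoff_1 w : w <= 1 / 2 -> cutoff w = 1.
Proof.
  intros H. unfold cutoff, cube. rewrite (zero_below_le _ _ (2 * w + -1)) by lra.
  rewrite zero_below_gt by lra. ring.
Qed.

Lemma cutoff_0 w : 1 <= w -> cutoff w = 0.
Proof.
  intros Hw. unfold cutoff. 
  assert (H : -1 * cube (2 * w + -1) + 1 <= 0).
  { unfold cube; rewrite zero_below_gt by lra.
    pose proof (pow_incr 1 (2 * w + -1) 3). rewrite pow1 in H. lra. }
  unfold cube at 1. now apply zero_below_le.
Qed.

(** * The truncated logarithm *)

(** The logarithm minus its second-order Taylor polynomial at 1 in the variable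
    [1 - 1 / w], so that it glues with zero to a C^2 function. As a function of
    [w = |p|^2 / b] it is subharmonic off the origin, vanishes near the origin
    and differs from [ln w] by at most [3 / 2] for [w >= 1]. *)
Definition tlog : R -> R :=
  zero_below 1 (fun w => ln w - (1 - / w) - (1 - / w) ^ 2 / 2).
Definition tlog1 : R -> R := zero_below 1 (fun w => (w - 1) ^ 2 / w ^ 3).
Definition tlog2 : R -> R :=
  zero_below 1 (fun w => 2 * (w - 1) / w ^ 3 - 3 * (w - 1) ^ 2 / w ^ 4).

Lemma tlog_C2 : C2_on (fun _ => True) tlog tlog1 tlog2.
Proof.
  apply zero_below_C2.
  - intros x Hx. split; [|split].
    + auto_derive; [repeat split; lra | field; lra].
    + auto_derive; [simpl; repeat split; nra | field; lra].
    + solve_cont; apply pow_nonzero; lra.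
  - rewrite ln_1. field.
  - field.
  - field.
Qed.

Lemma tlog_0 w : w <= 1 -> tlog w = 0.
Proof. apply zero_below_le. Qed.

Lemma tlog1_ge0 w : 0 <= tlog1 w.
Proof.
  unfold tlog1, zero_below. destruct (Rle_dec w 1); [lra|].
  apply Rmult_le_pos; [apply pow2_ge_0|]. left; apply Rinv_0_lt_compat, pow_lt; lra.
Qed.

Lemma tlog_nondecreasing a b : a <= b -> tlog a <= tlog b.
Proof.
  intros H. apply (nondecreasing_of_derive tlog tlog1); [exact H | |].
  - intros; now apply tlog_C2.
  - intros; apply tlog1_ge0.
Qed.

Lemma tlog_ge0 w : 0 <= tlog w.
Proof.
  destruct (Rle_dec w 1) as [H|H]; [rewrite tlog_0 by exact H; lra|].
  rewrite <- (tlog_0 1) by lra. apply tlog_nondecreasing; lra.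
Qed.

Lemma tlog_le_ln w : 1 <= w -> tlog w <= ln w.
Proof.
  intros H. unfold tlog, zero_below. destruct (Rle_dec w 1).
  - replace w with 1 by lra. rewrite ln_1; lra.
  - assert (/ w < 1) by (rewrite <- Rinv_1; apply Rinv_lt_contravar; lra).
    pose proof (pow2_ge_0 (1 - / w)). lra.
Qed.

Lemma tlog_ge_ln w : 1 <= w -> ln w - 3 / 2 <= tlog w.
Proof.
  intros H. unfold tlog, zero_below. destruct (Rle_dec w 1).
  - replace w with 1 by lra. rewrite ln_1; lra.
  - assert (/ w < 1) by (rewrite <- Rinv_1; apply Rinv_lt_contravar; lra).
    assert (0 < / w) by (apply Rinv_0_lt_compat; lra). nra.
Qed.

Lemma tlog1_bound w : 0 <= w -> 0 <= w * tlog1 w <= 1.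
Proof.
  intros H. split; [apply Rmult_le_pos; [exact H | apply tlog1_ge0]|].
  unfold tlog1, zero_below. destruct (Rle_dec w 1); [lra|].
  replace (w * ((w - 1) ^ 2 / w ^ 3)) with ((1 - / w) ^ 2) by (field; lra).
  assert (/ w < 1) by (rewrite <- Rinv_1; apply Rinv_lt_contravar; lra).
  assert (0 < / w) by (apply Rinv_0_lt_compat; lra). nra.
Qed.

Lemma tlog_subharmonic w : 0 <= tlog1 w + w * tlog2 w.
Proof.
  unfold tlog1, tlog2, zero_below. destruct (Rle_dec w 1); [lra|].
  replace ((w - 1) ^ 2 / w ^ 3 + w * (2 * (w - 1) / w ^ 3 - 3 * (w - 1) ^ 2 / w ^ 4))
    with (2 * (w - 1) * (/ w ^ 3)) by (field; lra).
  apply Rmult_le_pos; [lra|]. left; apply Rinv_0_lt_compat, pow_lt; lra.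
Qed.

Lemma tlog_subharmonic_lower w : 2 <= w -> / w ^ 2 <= tlog1 w + w * tlog2 w.
Proof.
  intros Hw. unfold tlog1, tlog2. rewrite !zero_below_gt by lra.
  replace ((w - 1) ^ 2 / w ^ 3 + w * (2 * (w - 1) / w ^ 3 - 3 * (w - 1) ^ 2 / w ^ 4))
    with (/ w ^ 2 + (w - 2) * (/ w ^ 3)) by (field; lra).
  assert (0 < / w ^ 3) by (apply Rinv_0_lt_compat, pow_lt; lra). nra.
Qed.

(** * The truncated Green function *)

(** The Kelvin transform of [tlog]: [- ln w] up to a bounded term for [w <= 1] and
    zero for [w >= 1], so a substitute for the Green function of a disc which is C^2 across the
    boundary circle. *)
Definition tgreen (w : R) : R := tlog (/ w).
Definition tgreen1 (w : R) : R := - (Rmax 0 (1 - w)) ^ 2 / w.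
Definition tgreen2 (w : R) : R := Rmax 0 (/ w ^ 2 - 1).

Lemma Rinv_gt1 w : 0 < w < 1 -> 1 < / w.
Proof. intros H. rewrite <- Rinv_1 at 1. apply Rinv_lt_contravar; lra. Qed.

Lemma Rinv_le1 w : 1 <= w -> / w <= 1.
Proof. intros H. rewrite <- Rinv_1. apply Rinv_le_contravar; lra. Qed.

Lemma tgreen_C2 : C2_on (fun w => 0 < w) tgreen tgreen1 tgreen2.
Proof.
  assert (Hinv : C2_on (fun w => 0 < w) Rinv (fun w => - / w ^ 2) (fun w => 2 / w ^ 3)).
  { intros w Hw. split; [|split].
    - auto_derive; [lra | field; lra].
    - auto_derive; [nra | field; lra].
    - solve_cont; apply pow_nonzero; lra. }
  pose proof (C2_comp (fun w => 0 < w) (fun _ => True) tlog tlog1 tlog2 Rinv _ _ tlog_C2 Hinv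
    (fun _ _ => I)) as H.
  assert (E1 : forall w, 0 < w -> tlog1 (/ w) * - / w ^ 2 = tgreen1 w).
  { intros w Hw. unfold tgreen1, tlog1. destruct (Rlt_dec w 1) as [H1|H1].
    - rewrite zero_below_gt by (apply Rinv_gt1; lra). rewrite Rmax_right by lra. field; lra.
    - rewrite zero_below_le by (apply Rinv_le1; lra). rewrite Rmax_left by lra. field; lra. }
  assert (E2 : forall w, 0 < w ->
     tlog2 (/ w) * (- / w ^ 2) ^ 2 + tlog1 (/ w) * (2 / w ^ 3) = tgreen2 w).
  { intros w Hw. unfold tgreen2, tlog1, tlog2. destruct (Rlt_dec w 1) as [H1|H1].
    - rewrite !zero_below_gt by (apply Rinv_gt1; lra). rewrite Rmax_right. field; lra.
      assert (1 < / w) by (apply Rinv_gt1; lra). rewrite <- pow_inv. nra.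
    - rewrite !zero_below_le by (apply Rinv_le1; lra). rewrite Rmax_left. field; lra.
      assert (/ w <= 1) by (apply Rinv_le1; lra). 
      assert (0 < / w) by (apply Rinv_0_lt_compat; lra). rewrite <- pow_inv. nra. }
  intros w Hw. destruct (H w Hw) as (D1 & D2 & D3).
  pose proof (locally_gt 0 w Hw) as Hl. split; [|split].
  - rewrite <- E1 by exact Hw. exact D1.
  - rewrite <- E2 by exact Hw. eapply is_derive_ext_loc; [|exact D2].
    revert Hl. apply filter_imp. intros t Ht. now apply E1.
  - eapply continuous_ext_loc; [|exact D3].
    revert Hl. apply filter_imp. intros t Ht. now apply E2.
Qed.

(** [(w tgreen')' = 2 max (0, 1 - w)] is bounded: off its pole, the truncated Green
    function has a bounded nonnegative Laplacian. *)
Lemma tgreen_laplacian w : 0 < w -> tgreen1 w + w * tgreen2 w = 2 * Rmax 0 (1 - w).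
Proof.
  intros Hw. unfold tgreen1, tgreen2.
  assert (0 < / w) by (apply Rinv_0_lt_compat; lra).
  destruct (Rlt_dec w 1) as [H1|H1].
  - assert (1 < / w) by (apply Rinv_gt1; lra).
    assert (0 <= / w ^ 2 - 1) by (rewrite <- pow_inv; nra).
    rewrite !Rmax_right by lra. field; lra.
  - assert (/ w <= 1) by (apply Rinv_le1; lra).
    assert (/ w ^ 2 - 1 <= 0) by (rewrite <- pow_inv; nra).
    rewrite !Rmax_left by lra. field; lra.
Qed.

Lemma tgreen_0 w : 1 <= w -> tgreen w = 0.
Proof. intros H. apply tlog_0, Rinv_le1, H. Qed.

Lemma tgreen_le_ln w : 0 < w -> tgreen w <= Rmax 0 (- ln w).
Proof.
  intros Hw. destruct (Rle_dec 1 w) as [H|H].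
  - rewrite tgreen_0 by exact H. apply Rmax_l.
  - eapply Rle_trans; [|apply Rmax_r]. rewrite <- ln_Rinv by exact Hw.
    apply tlog_le_ln. left; apply Rinv_gt1; lra.
Qed.

Lemma exp_half_tgreen_le w : 0 < w -> exp (tgreen w / 2) <= 1 + / sqrt w.
Proof.
  intros Hw. pose proof (sqrt_lt_R0 w Hw) as Hs.
  assert (0 < / sqrt w) by now apply Rinv_0_lt_compat.
  destruct (Rle_dec 1 w) as [H1|H1].
  - rewrite tgreen_0 by exact H1. replace (0 / 2) with 0 by field. rewrite exp_0. lra.
  - pose proof (tgreen_le_ln w Hw) as Hle. rewrite Rmax_right in Hle.
    2:{ assert (ln w < 0) by (rewrite <- ln_1; apply ln_increasing; lra). lra. }
    apply Rle_trans with (/ sqrt w); [|lra].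
    rewrite <- (exp_ln (/ sqrt w)) by assumption.
    assert (E : ln (/ sqrt w) = - ln w / 2).
    { rewrite ln_Rinv by exact Hs.
      assert (ln w = ln (sqrt w) + ln (sqrt w)) by (rewrite <- ln_mult, sqrt_sqrt; lra). lra. }
    rewrite E. destruct (Req_dec (tgreen w / 2) (- ln w / 2)) as [->|]; [lra|].
    left; apply exp_increasing; lra.
Qed.

(** * Extrema on the square *)

Definition closed_square (p : plane) : Prop := -1 <= fst p <= 1 /\ -1 <= snd p <= 1.

Lemma cont_continuity_2d_pt (f : plane -> R) x y : cont f -> continuity_2d_pt (fun x y => f (x, y)) x y.
Proof.
  intros Hf. apply continuity_2d_pt_filterlim. apply filterlim_ext with f.
  - now intros [? ?].
  - apply (Hf (x, y)).
Qed.

Lemma cont_uniform (f : plane -> R) (eps : R) :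
  cont f -> 0 < eps -> exists d : R, 0 < d /\ forall p q,
    closed_square p -> closed_square q ->
    Rabs (fst q - fst p) < d -> Rabs (snd q - snd p) < d -> Rabs (f q - f p) < eps.
Proof.
  intros Hf He.
  destruct (uniform_continuity_2d (fun x y => f (x, y)) (-1) 1 (-1) 1
    (fun x y _ _ => cont_continuity_2d_pt f x y Hf) (mkposreal eps He)) as [d Hd].
  exists d. split; [apply cond_pos|]. intros [p1 p2] [q1 q2] [? ?] [? ?] Hx Hy.
  now apply Hd.
Qed.

(** The minimum over the second variable depends continuously on the first one. *)
Lemma cont_attains_min (f : plane -> R) :
  cont f -> exists p0, closed_square p0 /\ forall p, closed_square p -> f p0 <= f p.
Proof.
  intros Hf.
  assert (Hy : forall x : R, exists y0 : R, -1 <= y0 <= 1 /\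
     forall y, -1 <= y <= 1 -> f (x, y0) <= f (x, y)).
  { intros x. destruct (continuity_ab_min (fun y => f (x, y)) (-1) 1) as (y0 & H1 & H2); [lra| |].
    - intros c _. apply continuity_pt_filterlim. apply (cont_slice_r f x Hf c).
    - exists y0; split; assumption. }
  destruct (functional_choice _ Hy) as [y0 Hy0].
  destruct (continuity_ab_min (fun x => f (x, y0 x)) (-1) 1) as (x0 & H1 & H2); [lra| |].
  - intros x Hx. apply continuity_pt_filterlim. apply filterlim_locally. intros eps.
    destruct (uniform_continuity_2d (fun x y => f (x, y)) (-2) 2 (-1) 1
      (fun x y _ _ => cont_continuity_2d_pt f x y Hf) eps) as [d Hd].
    assert (Hm : 0 < Rmin d 1) by (apply Rmin_pos; [apply cond_pos | lra]).
    enough (Hball : forall t : R, Rabs (t - x) < Rmin d 1 ->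
      Rabs (f (t, y0 t) - f (x, y0 x)) < eps) by (exists (mkposreal _ Hm); exact Hball).
    intros t Ht.
    assert (Ht1 : Rabs (t - x) < d) by (eapply Rlt_le_trans; [exact Ht | apply Rmin_l]).
    assert (Ht2 : Rabs (t - x) < 1) by (eapply Rlt_le_trans; [exact Ht | apply Rmin_r]).
    apply Rabs_def2 in Ht2.
    assert (Hc : forall y, -1 <= y <= 1 -> Rabs (f (t, y) - f (x, y)) < eps).
    { intros y Hyy. apply Hd; try lra. rewrite Rminus_diag, Rabs_R0. apply cond_pos. }
    destruct (Hy0 t) as [K1 K2]. destruct (Hy0 x) as [K3 K4].
    specialize (K2 _ K3). specialize (K4 _ K1).
    pose proof (Rabs_def2 _ _ (Hc _ K1)). pose proof (Rabs_def2 _ _ (Hc _ K3)).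
    apply Rabs_def1; lra.
  - exists (x0, y0 x0). split; [split; [exact H2 | apply Hy0]|].
    intros [x y] [Hx Hyy]; simpl in *. eapply Rle_trans; [apply (H1 x Hx)|]. now apply Hy0.
Qed.

Lemma cont_bounded (f : plane -> R) :
  cont f -> exists M, 0 <= M /\ forall p, closed_square p -> Rabs (f p) <= M.
Proof.
  intros Hf.
  assert (Hf' : cont (fun p => - Rabs (f p))).
  { intros p. apply continuous_Ropp. apply (continuous_comp_R f Rabs); [apply Hf | apply continuous_Rabs]. }
  destruct (cont_attains_min _ Hf') as (p0 & _ & H). exists (Rabs (f p0)). split; [apply Rabs_pos|].
  intros p Hp. specialize (H p Hp). lra.
Qed.

(** Applying the mean value theorem to [f (t + s) + f (t - s)] makes it
    unnecessary to know that the first derivative vanishes. *)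
Lemma second_derivative_at_min (f f1 : R -> R) t f2 :
  locally t (fun s => is_derive f s (f1 s)) -> is_derive f1 t f2 ->
  locally t (fun s => f t <= f s) -> 0 <= f2.
Proof.
  intros Hd H2 Hmin. apply Rnot_lt_le. intros Hneg.
  destruct (filter_and _ _ Hd Hmin) as [d1 H1].
  apply is_derive_Reals in H2. destruct (H2 (- f2) ltac:(lra)) as [d2 Hd2].
  set (h := Rmin d1 d2 / 2).
  assert (Hm : 0 < Rmin d1 d2) by (apply Rmin_pos; apply cond_pos).
  pose proof (Rmin_l d1 d2). pose proof (Rmin_r d1 d2).
  assert (Hb : forall c, Rabs (c - t) <= h -> is_derive f c (f1 c) /\ f t <= f c).
  { intros c Hc. apply H1. change (Rabs (c - t) < d1). unfold h in Hc; lra. }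
  destruct (MVT_cor2 (fun s => f (t + s) + f (t - s)) (fun s => f1 (t + s) - f1 (t - s)) 0 h)
    as (c & E & Hc).
  - unfold h; lra.
  - intros c Hc. apply is_derive_Reals.
    destruct (Hb (t + c)) as [D1 _]; [apply Rabs_le; lra|].
    destruct (Hb (t - c)) as [D2 _]; [apply Rabs_le; lra|].
    replace (f1 (t + c) - f1 (t - c)) with (f1 (t + c) * 1 + f1 (t - c) * (-1)) by ring.
    apply is_derive_Rplus; apply is_derive_Rcomp; try assumption; auto_derive; trivial; ring.
  - assert (Hcd : c < d2) by (unfold h in Hc; lra).
    assert (A1 : f1 (t + c) < f1 t).
    { specialize (Hd2 c ltac:(lra)). rewrite Rabs_pos_eq in Hd2 by lra.
      specialize (Hd2 Hcd). apply Rabs_def2 in Hd2.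
      assert (Hq : (f1 (t + c) - f1 t) / c < 0) by lra.
      apply (Rmult_lt_compat_r c) in Hq; [|lra].
      unfold Rdiv in Hq. rewrite Rmult_assoc, Rinv_l in Hq; lra. }
    assert (A2 : f1 t < f1 (t - c)).
    { specialize (Hd2 (- c) ltac:(lra)). rewrite Rabs_Ropp, Rabs_pos_eq in Hd2 by lra.
      specialize (Hd2 Hcd). apply Rabs_def2 in Hd2.
      assert (Hq : (f1 (t + - c) - f1 t) / - c < 0) by lra.
      replace ((f1 (t + - c) - f1 t) / - c) with ((f1 t - f1 (t - c)) / c) in Hq
        by (change (t + - c) with (t - c); field; lra).
      apply (Rmult_lt_compat_r c) in Hq; [|lra].
      unfold Rdiv in Hq. rewrite Rmult_assoc, Rinv_l in Hq; lra. }
    destruct (Hb (t + h)) as [_ B1]; [apply Rabs_le; lra|].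
    destruct (Hb (t - h)) as [_ B2]; [apply Rabs_le; lra|].
    rewrite Rplus_0_r, Rminus_0_r in E. nra.
Qed.

(** * Superharmonic functions in a punctured disc *)

Notation sqnorm p := (sqdist p origin).

(** Radii are squared throughout: [A] bounds [|p|^2]. *)
Definition punctured_disc (A : R) (p : plane) : Prop := 0 < sqnorm p < A.

(** [h] is the density of the Riesz measure of [u], up to the factor [2 pi]. *)
Definition positive_superharmonic (A : R) (u h : plane -> R) : Prop :=
  has_laplacian (punctured_disc A) u (fun p => - h p) /\
  forall p, punctured_disc A p -> 0 < u p /\ 0 <= h p.

Lemma punctured_disc_in_box A : A <= 1 -> in_box (punctured_disc A).
Proof.
  intros HA [x y] [_ H]. unfold sqdist in H; simpl in *. split; split; nra.
Qed.

Lemma locally_sqdist_lt (x p : plane) s : sqdist p x < s -> locally p (fun q => sqdist q x < s).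
Proof.
  intros H. assert (Hc : continuous (fun q => sqdist q x) p) by (apply continuous_sqdist; solve_cont).
  exact (Hc _ (locally_lt s _ H)).
Qed.

Lemma locally_sqdist_gt (x p : plane) s : s < sqdist p x -> locally p (fun q => s < sqdist q x).
Proof.
  intros H. assert (Hc : continuous (fun q => sqdist q x) p) by (apply continuous_sqdist; solve_cont).
  exact (Hc _ (locally_gt s _ H)).
Qed.

Lemma cont_sqdist x : cont (fun p => sqdist p x).
Proof. intros p. apply continuous_sqdist; solve_cont. Qed.

Lemma punctured_disc_open A p : punctured_disc A p -> locally p (punctured_disc A).
Proof.
  intros [H1 H2]. apply filter_and; [now apply locally_sqdist_gt | now apply locally_sqdist_lt].
Qed.

Lemma supported_annulus A s a (theta : plane -> R) :
  0 < s -> a < A -> (forall p, sqnorm p <= s \/ a <= sqnorm p -> theta p = 0) ->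
  supported (punctured_disc A) theta.
Proof.
  intros Hs Ha H p. destruct (Rlt_dec (sqnorm p) s) as [H1|H1].
  - right. generalize (locally_sqdist_lt _ _ _ H1). apply filter_imp. intros q Hq. apply H; lra.
  - destruct (Rlt_dec a (sqnorm p)) as [H2|H2].
    + right. generalize (locally_sqdist_gt _ _ _ H2). apply filter_imp. intros q Hq. apply H; lra.
    + left. split; lra.
Qed.

Lemma supported_ball (Omega : plane -> Prop) x r (theta : plane -> R) :
  (forall p, sqdist p x <= r -> Omega p) -> (forall p, r <= sqdist p x -> theta p = 0) ->
  supported Omega theta.
Proof.
  intros H1 H2 p. destruct (Rlt_dec r (sqdist p x)) as [H|H].
  - right. generalize (locally_sqdist_gt _ _ _ H). apply filter_imp. intros q Hq. apply H2; lra.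
  - left. apply H1; lra.
Qed.

(** Continuity at a point of a zero set across which a function is replaced by zero. *)
Lemma continuous_vanishing (f G : plane -> R) p :
  continuous G p -> G p = 0 -> (forall q, f q = G q \/ f q = 0) -> continuous f p.
Proof.
  intros HG H0 H. apply filterlim_locally. intros eps.
  assert (Hfp : f p = 0) by (destruct (H p); lra).
  generalize (proj1 (filterlim_locally _ _) HG eps). apply filter_imp.
  intros q Hq. rewrite Hfp. rewrite H0 in Hq.
  destruct (H q) as [-> | ->]; [exact Hq | apply ball_center].
Qed.

(** * The minimum principle *)

Lemma strict_minimum_principle A u h (F F1 F2 : R -> R) p :
  positive_superharmonic A u h -> punctured_disc A p ->
  (forall s, 0 < s -> is_derive F s (F1 s) /\ is_derive F1 s (F2 s)) ->
  F1 (sqnorm p) + sqnorm p * F2 (sqnorm p) < 0 ->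
  ~ locally p (fun q => u p + F (sqnorm p) <= u q + F (sqnorm q)).
Proof.
  intros [(ux & uy & uxx & uyy & Hu) Hh] Hp HF Hneg Hmin.
  assert (Hd : forall q : plane, punctured_disc A q ->
    is_derive (fun t => u (t, snd q) + F (sqnorm (t, snd q))) (fst q)
      (ux q + 2 * fst q * F1 (sqnorm q)) /\
    is_derive (fun t => ux (t, snd q) + 2 * t * F1 (sqnorm (t, snd q))) (fst q)
      (uxx q + (2 * F1 (sqnorm q) + 4 * fst q ^ 2 * F2 (sqnorm q))) /\
    is_derive (fun t => u (fst q, t) + F (sqnorm (fst q, t))) (snd q)
      (uy q + 2 * snd q * F1 (sqnorm q)) /\
    is_derive (fun t => uy (fst q, t) + 2 * t * F1 (sqnorm (fst q, t))) (snd q)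
      (uyy q + (2 * F1 (sqnorm q) + 4 * snd q ^ 2 * F2 (sqnorm q)))).
  { intros q Hq. destruct (HF (sqnorm q) (proj1 Hq)) as [D1 D2].
    destruct (Hu q Hq) as (_ & [X1 X2] & [Y1 Y2] & _).
    assert (Es : sqnorm q = (fst q - 0) ^ 2 + (snd q - 0) ^ 2) by reflexivity.
    assert (Es' : sqnorm q = (snd q - 0) ^ 2 + (fst q - 0) ^ 2) by (rewrite Es; ring).
    pose proof D1 as D1'. pose proof D2 as D2'.
    rewrite Es in D1, D2. rewrite Es' in D1', D2'.
    destruct (radial_derive F F1 F2 _ _ _ D1 D2) as [R1 R2].
    destruct (radial_derive F F1 F2 _ _ _ D1' D2') as [R3 R4].
    rewrite <- Es in R1, R2. rewrite <- Es' in R3, R4.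
    split; [|split; [|split]].
    - apply is_derive_Rplus; [exact X1|].
      replace (2 * fst q) with (2 * (fst q - 0)) by ring. exact R1.
    - apply is_derive_Rplus; [exact X2|].
      replace (4 * fst q ^ 2) with (4 * (fst q - 0) ^ 2) by ring.
      revert R2. apply is_derive_ext. intros t. cbv beta.
      replace (2 * (t - 0)) with (2 * t) by ring. reflexivity.
    - apply is_derive_Rplus; [exact Y1|].
      replace (2 * snd q) with (2 * (snd q - 0)) by ring.
      revert R3. apply is_derive_ext. intros t. cbv beta. f_equal.
      unfold sqdist, origin; simpl; ring.
    - apply is_derive_Rplus; [exact Y2|].
      replace (4 * snd q ^ 2) with (4 * (snd q - 0) ^ 2) by ring.
      revert R4. apply is_derive_ext. intros t. cbv beta.
      replace (2 * (t - 0)) with (2 * t) by ring. do 2 f_equal.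
      unfold sqdist, origin; simpl; ring. }
  pose proof (punctured_disc_open A p Hp) as Hopen.
  assert (Hxx : 0 <= uxx p + (2 * F1 (sqnorm p) + 4 * fst p ^ 2 * F2 (sqnorm p))).
  { eapply (second_derivative_at_min (fun t => u (t, snd p) + F (sqnorm (t, snd p)))
      (fun t => ux (t, snd p) + 2 * t * F1 (sqnorm (t, snd p)))).
    - generalize (locally_slice_l _ _ Hopen). apply filter_imp. intros t Ht. apply (Hd (t, snd p) Ht).
    - apply (Hd p Hp).
    - generalize (locally_slice_l _ _ Hmin). apply filter_imp. intros t Ht.
      destruct p as [p1 p2]. exact Ht. }
  assert (Hyy : 0 <= uyy p + (2 * F1 (sqnorm p) + 4 * snd p ^ 2 * F2 (sqnorm p))).
  { eapply (second_derivative_at_min (fun t => u (fst p, t) + F (sqnorm (fst p, t)))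
      (fun t => uy (fst p, t) + 2 * t * F1 (sqnorm (fst p, t)))).
    - generalize (locally_slice_r _ _ Hopen). apply filter_imp. intros t Ht. apply (Hd (fst p, t) Ht).
    - apply (Hd p Hp).
    - generalize (locally_slice_r _ _ Hmin). apply filter_imp. intros t Ht.
      destruct p as [p1 p2]. exact Ht. }
  destruct (Hu p Hp) as (_ & _ & _ & _ & E). destruct (Hh p Hp) as [_ Hh0].
  assert (Es : sqnorm p = fst p ^ 2 + snd p ^ 2) by (unfold sqdist, origin; simpl; ring).
  rewrite Es in Hneg at 2. lra.
Qed.

Lemma superharmonic_continuous A u h p :
  positive_superharmonic A u h -> punctured_disc A p -> continuous u p /\ continuous h p.
Proof.
  intros [Hl _] Hp. destruct (has_laplacian_continuous _ _ _ p Hl Hp) as [H1 H2].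
  split; [exact H1|]. apply continuous_ext with (fun q => - - h q).
  - intros q. apply Ropp_involutive.
  - now apply continuous_Ropp.
Qed.

Lemma closed_square_of_sqnorm p : sqnorm p <= 1 -> closed_square p.
Proof. destruct p as [x y]. unfold sqdist, origin, closed_square; simpl. intros H. split; split; nra. Qed.

Lemma positive_on_circle A u h a :
  A <= 1 -> 0 < a < A -> positive_superharmonic A u h ->
  exists m, 0 < m /\ forall p, sqnorm p = a -> m <= u p.
Proof.
  intros HA Ha Hu.
  set (r := Rmin a (A - a) / 2).
  assert (Hr : 0 < r /\ r < a /\ r < A - a).
  { assert (0 < Rmin a (A - a)) by (apply Rmin_pos; lra).
    pose proof (Rmin_l a (A - a)). pose proof (Rmin_r a (A - a)). unfold r. lra. }
  set (zeta := fun p => Rmax 0 (1 - Rabs (sqnorm p - a) / r)).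
  assert (Hz : cont zeta).
  { intros p. apply continuous_Rmax; [apply continuous_const|].
    apply continuous_Rminus; [apply continuous_const|].
    apply continuous_Rdiv; [|apply continuous_const | lra].
    apply (continuous_comp_R (fun p => sqnorm p - a) Rabs); [|apply continuous_Rabs].
    apply continuous_Rminus; [apply cont_sqdist | apply continuous_const]. }
  assert (Hz0 : forall p, r <= Rabs (sqnorm p - a) -> zeta p = 0).
  { intros p Hp. unfold zeta. apply Rmax_left.
    assert (1 <= Rabs (sqnorm p - a) / r); [|lra].
    apply Rmult_le_reg_r with r; [lra|]. unfold Rdiv. rewrite Rmult_assoc, Rinv_l; lra. }
  assert (Hz1 : forall p, 0 <= zeta p <= 1).
  { intros p. unfold zeta. split; [apply Rmax_l|]. apply Rmax_lub; [lra|].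
    assert (0 <= Rabs (sqnorm p - a) / r); [|lra].
    apply Rmult_le_pos; [apply Rabs_pos | left; apply Rinv_0_lt_compat; lra]. }
  assert (Hc : cont (fun p => zeta p * u p + (1 - zeta p))).
  { intros p. apply continuous_Rplus.
    - revert p. apply (cont_supported (punctured_disc A)); [exact Hz| |].
      + apply (supported_annulus A (a - r) (a + r)); try lra.
        intros p Hp. apply Hz0. unfold Rabs; destruct Rcase_abs; lra.
      + intros p Hp. now apply (superharmonic_continuous A u h).
    - apply continuous_Rminus; [apply continuous_const | apply Hz]. }
  destruct (cont_attains_min _ Hc) as (p0 & _ & Hmin).
  exists (zeta p0 * u p0 + (1 - zeta p0)). split.
  - destruct (Hz1 p0) as [Z0 Z1].
    destruct (Rle_dec r (Rabs (sqnorm p0 - a))) as [H|H].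
    + rewrite (Hz0 p0 H); lra.
    + assert (Hp : punctured_disc A p0).
      { apply Rnot_le_lt in H. apply Rabs_def2 in H. split; lra. }
      destruct Hu as [_ Hpos]. destruct (Hpos p0 Hp) as [Hup _].
      destruct (Req_dec (zeta p0) 1) as [->|]; nra.
  - intros p Hp. specialize (Hmin p). replace (zeta p) with 1 in Hmin.
    + replace (u p) with (1 * u p + (1 - 1)) by ring. apply Hmin.
      apply closed_square_of_sqnorm; lra.
    + unfold zeta. rewrite Hp, Rminus_diag, Rabs_R0, Rmax_right; unfold Rdiv; lra.
Qed.

(** Adding [- delta ln (|p|^2 / a) - kappa |p|^2] to [u] makes it strictly
    superharmonic and infinite at the origin, so its minimum over the disc lies
    on the circle. With [kappa = m / (2 a)] the second term costs [m / 2] there. *)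
Lemma superharmonic_barrier A u h a m delta p :
  A <= 1 -> 0 < a < A -> positive_superharmonic A u h -> 0 < m ->
  (forall p, sqnorm p = a -> m <= u p) -> 0 < delta -> 0 < sqnorm p <= a ->
  m / 2 <= u p - delta * (ln (sqnorm p) - ln a) - m / (2 * a) * sqnorm p.
Proof.
  intros HA Ha Hu Hm Hcirc Hdelta Hp.
  set (kappa := m / (2 * a)).
  assert (Hk : 0 < kappa) by (apply Rdiv_lt_0_compat; lra).
  assert (Hka : kappa * a = m / 2) by (unfold kappa; field; lra).
  set (F := fun s => - delta * (ln s - ln a) - kappa * s).
  set (F1 := fun s => - delta / s - kappa).
  set (F2 := fun s => delta / s ^ 2).
  assert (HF : forall s, 0 < s -> is_derive F s (F1 s) /\ is_derive F1 s (F2 s)).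
  { intros s Hs. unfold F, F1, F2. split; (auto_derive; [lra | field; lra]). }
  apply Rnot_lt_le. intros Hneg.
  assert (Hneg' : u p + F (sqnorm p) < m / 2) by (unfold F; lra). clear Hneg.
  set (s1 := a * exp (- m / delta)).
  assert (Hs1 : 0 < s1) by (apply Rmult_lt_0_compat; [lra | apply exp_pos]).
  assert (Hs1a : s1 < a).
  { unfold s1. rewrite <- (Rmult_1_r a) at 2. apply Rmult_lt_compat_l; [lra|].
    rewrite <- exp_0. apply exp_increasing. apply Rmult_lt_reg_r with delta; [lra|].
    unfold Rdiv. rewrite Rmult_assoc, Rinv_l; lra. }
  assert (Hinner : forall q, 0 < sqnorm q <= s1 -> m / 2 < u q + F (sqnorm q)).
  { intros q Hq. destruct Hu as [_ Hpos].
    assert (Hq' : 0 < u q) by (apply Hpos; split; lra).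
    assert (Hln : ln (sqnorm q) - ln a <= - m / delta).
    { assert (ln (sqnorm q) <= ln s1) by (apply ln_le; lra).
      unfold s1 in H. rewrite ln_mult, ln_exp in H; [lra | lra | apply exp_pos]. }
    assert (delta * (ln (sqnorm q) - ln a) <= - m).
    { apply (Rmult_le_compat_l delta) in Hln; [|lra].
      replace (delta * (- m / delta)) with (- m) in Hln by (field; lra). exact Hln. }
    assert (kappa * sqnorm q <= kappa * a) by (apply Rmult_le_compat_l; lra).
    unfold F; lra. }
  (* [u + F - m / 2], cut off above at 0 and extended by 0, is a continuous function
     on the whole square, and a negative minimum of it is a minimum of [u + F] *)
  set (G := fun q => Rmin 0 (u q + F (sqnorm q) - m / 2)).
  set (f := fun q => if Rlt_dec s1 (sqnorm q) then if Rlt_dec (sqnorm q) a then G q else 0 else 0).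
  assert (Hf : forall q, f q = G q \/ f q = 0).
  { intros q; unfold f. destruct Rlt_dec; [destruct Rlt_dec|]; auto. }
  assert (Hfc : cont f).
  { intros q. destruct (Rlt_dec (sqnorm q) s1) as [H|H].
    { apply continuous_locally_0. generalize (locally_sqdist_lt _ _ _ H). apply filter_imp.
      intros t Ht. unfold f. destruct Rlt_dec; [lra | reflexivity]. }
    destruct (Rlt_dec a (sqnorm q)) as [H'|H'].
    { apply continuous_locally_0. generalize (locally_sqdist_gt _ _ _ H'). apply filter_imp.
      intros t Ht. unfold f. destruct Rlt_dec; [destruct Rlt_dec; [lra|]|]; reflexivity. }
    assert (HG : continuous G q).
    { apply continuous_Rmin; [apply continuous_const|].
      apply continuous_Rminus; [|apply continuous_const].
      apply continuous_Rplus.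
      - apply (superharmonic_continuous A u h q Hu). split; lra.
      - apply (continuous_comp_R (fun q => sqnorm q) F); [apply cont_sqdist|].
        apply (ex_derive_continuous (V := R_NormedModule)). eexists. apply HF. lra. }
    destruct (Req_dec (sqnorm q) s1) as [E|E].
    { apply continuous_vanishing with G; try assumption.
      unfold G. apply Rmin_left. assert (m / 2 < u q + F (sqnorm q)) by (apply Hinner; lra). lra. }
    destruct (Req_dec (sqnorm q) a) as [E'|E'].
    { apply continuous_vanishing with G; try assumption.
      unfold G. apply Rmin_left. rewrite E'. unfold F. specialize (Hcirc q E'). 
      replace (ln a - ln a) with 0 by ring. lra. }
    assert (Hq1 : s1 < sqnorm q) by (apply Rnot_le_lt; intros ?; apply E; lra).
    assert (Hq2 : sqnorm q < a) by (apply Rnot_le_lt; intros ?; apply E'; lra).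
    apply continuous_ext_loc with G; [|exact HG].
    generalize (filter_and _ _ (locally_sqdist_gt origin q s1 Hq1)
      (locally_sqdist_lt origin q a Hq2)). apply filter_imp. intros t [T1 T2].
    unfold f. destruct Rlt_dec; [destruct Rlt_dec; [reflexivity | lra] | lra]. }
  destruct (cont_attains_min f Hfc) as (p0 & _ & Hmin).
  assert (Hp0 : f p0 < 0).
  { apply Rle_lt_trans with (f p).
    - apply Hmin, closed_square_of_sqnorm; lra.
    - unfold f. destruct Rlt_dec as [?|n].
      + destruct Rlt_dec as [?|n].
        * unfold G. rewrite Rmin_right; lra.
        * assert (E : sqnorm p = a) by lra. specialize (Hcirc p E).
          rewrite E in Hneg'. unfold F in Hneg'. replace (ln a - ln a) with 0 in Hneg' by ring. lra.
      + specialize (Hinner p). lra. }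
  assert (Hin : s1 < sqnorm p0 < a).
  { unfold f in Hp0. destruct Rlt_dec; [destruct Rlt_dec|]; lra. }
  apply (strict_minimum_principle A u h F F1 F2 p0 Hu); [split; lra | exact HF | |].
  - unfold F1, F2. replace (- delta / sqnorm p0 - kappa + sqnorm p0 * (delta / sqnorm p0 ^ 2))
      with (- kappa) by (field; lra). lra.
  - generalize (filter_and _ _ (locally_sqdist_gt origin p0 s1 (proj1 Hin))
      (locally_sqdist_lt origin p0 a (proj2 Hin))). apply filter_imp. intros t [T1 T2].
    assert (Ht : closed_square t) by (apply closed_square_of_sqnorm; lra).
    specialize (Hmin t Ht).
    unfold f in Hmin, Hp0. repeat (destruct Rlt_dec; [|lra]).
    unfold G in Hmin, Hp0. revert Hmin Hp0. unfold Rmin. repeat destruct Rle_dec; lra.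
Qed.

(** Let [delta] tend to 0 in the barrier estimate. *)
Lemma superharmonic_lower_bound A u h a :
  A <= 1 -> 0 < a < A -> positive_superharmonic A u h ->
  exists c, 0 < c /\ forall p, 0 < sqnorm p <= a -> c <= u p.
Proof.
  intros HA Ha Hu. destruct (positive_on_circle A u h a HA Ha Hu) as (m & Hm & Hcirc).
  exists (m / 2). split; [lra|]. intros p Hp. apply Rnot_lt_le. intros Hlt.
  assert (Hln : ln (sqnorm p) - ln a <= 0).
  { assert (ln (sqnorm p) <= ln a) by (apply ln_le; lra). lra. }
  assert (Hk : 0 <= m / (2 * a) * sqnorm p).
  { apply Rmult_le_pos; [|lra]. left; apply Rdiv_lt_0_compat; lra. }
  set (d := (m / 2 - u p) / (2 * (1 - (ln (sqnorm p) - ln a)))).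
  assert (Hd : 0 < d) by (apply Rdiv_lt_0_compat; lra).
  pose proof (superharmonic_barrier A u h a m d p HA Ha Hu Hm Hcirc Hd Hp) as H.
  assert (E : d * (1 - (ln (sqnorm p) - ln a)) = (m / 2 - u p) / 2) by (unfold d; field; lra).
  lra.
Qed.

(** * Averages and mass near the origin *)

Lemma has_laplacian_everywhere_cont u du :
  has_laplacian everywhere u du -> cont u /\ cont du.
Proof. intros H; split; intros p; now apply (has_laplacian_continuous everywhere u du p). Qed.

Lemma cont_mult (f g : plane -> R) : cont f -> cont g -> cont (fun p => f p * g p).
Proof. intros Hf Hg p. apply continuous_Rmult; auto. Qed.

Lemma cont_plus (f g : plane -> R) : cont f -> cont g -> cont (fun p => f p + g p).
Proof. intros Hf Hg p. apply continuous_Rplus; auto. Qed.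

Lemma cont_const (k : R) : cont (fun _ : plane => k).
Proof. intros p. apply continuous_const. Qed.

Lemma cont_radial (F : R -> R) x : cont F -> cont (fun p => F (sqdist p x)).
Proof. intros HF p. apply (continuous_comp_R (fun p => sqdist p x) F); [apply cont_sqdist | apply HF]. Qed.

Lemma C2_everywhere_cont F F1 F2 : C2_on (fun _ => True) F F1 F2 -> cont F /\ cont F1 /\ cont F2.
Proof.
  intros H. split; [|split]; intros s; now apply (C2_on_continuous _ F F1 F2 s H I).
Qed.

(** Green's identity with the test function [tlog (|p|^2 / b)], cut off at
    [|p|^2 = a]. Its Laplacian is nonnegative except where the cutoff varies, in a
    fixed compact annulus; there it is at most a multiple of [1 + ln (a / b)]. *)
Lemma log_growth A u h a :
  A <= 1 -> 0 < a < A -> positive_superharmonic A u h ->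
  exists C, 0 < C /\ forall b, 0 < b <= a / 2 ->
    ∬ (fun p => tlog (sqnorm p / b) * cutoff (sqnorm p / a) * h p) +
    ∬ (fun p => 4 / b * (tlog1 (sqnorm p / b) + sqnorm p / b * tlog2 (sqnorm p / b)) *
                cutoff (sqnorm p / a) * u p)
    <= C * (1 + ln (a / b)).
Proof.
  intros HA Ha Hu. destruct cutoff_C2 as (c1 & c2 & Hcut & Hc12).
  pose proof (C2_scaled _ _ _ a Hcut) as Hcuta.
  destruct (C2_everywhere_cont _ _ _ Hcuta) as (K0 & K1 & K2).
  destruct (C2_everywhere_cont _ _ _ tlog_C2) as (T0 & T1 & T2).
  assert (Hout : forall p, sqnorm p <= a / 2 \/ a <= sqnorm p ->
    c1 (sqnorm p / a) = 0 /\ c2 (sqnorm p / a) = 0).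
  { intros p Hp. apply Hc12. destruct Hp as [Hp|Hp]; [left|right].
    - apply Rmult_le_reg_r with a; [lra|]. unfold Rdiv. rewrite Rmult_assoc, Rinv_l; lra.
    - apply Rmult_le_reg_r with a; [lra|]. unfold Rdiv. rewrite Rmult_assoc, Rinv_l; lra. }
  set (E1 := fun p => (c1 (sqnorm p / a) / a + sqnorm p * (c2 (sqnorm p / a) / a ^ 2)) * u p).
  set (E2 := fun p => c1 (sqnorm p / a) / a * u p).
  assert (Hucont : forall p, punctured_disc A p -> continuous u p).
  { intros p Hp. now apply (superharmonic_continuous A u h). }
  assert (HE1 : cont E1).
  { apply (cont_supported (punctured_disc A)); [| | exact Hucont].
    - apply cont_plus; [apply (cont_radial _ origin K1)|].
      apply cont_mult; [apply cont_sqdist | apply (cont_radial _ origin K2)].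
    - apply (supported_annulus A (a / 2) a); try lra.
      intros p Hp. destruct (Hout p Hp) as [-> ->]. unfold Rdiv; ring. }
  assert (HE2 : cont E2).
  { apply (cont_supported (punctured_disc A)); [| | exact Hucont].
    - apply (cont_radial _ origin K1).
    - apply (supported_annulus A (a / 2) a); try lra.
      intros p Hp. destruct (Hout p Hp) as [-> _]. unfold Rdiv; ring. }
  destruct (cont_bounded E1 HE1) as (M1 & HM1 & B1).
  destruct (cont_bounded E2 HE2) as (M2 & HM2 & B2).
  exists (16 * (M1 + 2 * M2 + 1)). split; [lra|]. intros b Hb.
  pose proof (C2_scaled _ _ _ b tlog_C2) as Htb.
  destruct (C2_everywhere_cont _ _ _ Htb) as (L0 & L1 & L2).
  pose proof (C2_mult _ _ _ _ _ _ _ Htb Hcuta) as HF.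
  apply (C2_on_weaken _ (fun s => 0 <= s)) in HF; [|trivial].
  pose proof (radial_has_laplacian _ _ _ origin HF) as Hphi. cbv beta in Hphi.
  destruct (has_laplacian_everywhere_cont _ _ Hphi) as [Cphi Cdphi].
  assert (Hsup : supported (punctured_disc A)
     (fun p => tlog (sqnorm p / b) * cutoff (sqnorm p / a))).
  { apply (supported_annulus A b a); try lra. intros p [Hp|Hp].
    - rewrite tlog_0; [ring|]. apply Rmult_le_reg_r with b; [lra|].
      unfold Rdiv. rewrite Rmult_assoc, Rinv_l; lra.
    - rewrite cutoff_0; [ring|]. apply Rmult_le_reg_r with a; [lra|].
      unfold Rdiv. rewrite Rmult_assoc, Rinv_l; lra. }
  pose proof (has_laplacian_supported _ _ _ Hphi Hsup) as Hsupd.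
  pose proof (green _ _ _ _ _ (punctured_disc_in_box A HA) (proj1 Hu) Hphi Hsup) as HG.
  set (P1 := fun p => tlog (sqnorm p / b) * cutoff (sqnorm p / a) * h p).
  set (P2 := fun p => 4 / b * (tlog1 (sqnorm p / b) + sqnorm p / b * tlog2 (sqnorm p / b)) *
                cutoff (sqnorm p / a) * u p).
  set (E := fun p => 4 * (tlog (sqnorm p / b) * E1 p + 2 * (sqnorm p / b * tlog1 (sqnorm p / b)) * E2 p)).
  assert (CP1 : cont P1).
  { apply (cont_supported (punctured_disc A)); try assumption.
    intros p Hp. now apply (superharmonic_continuous A u h). }
  assert (CE : cont E).
  { intros p. unfold E. apply continuous_Rmult; [apply continuous_const|].
    apply continuous_Rplus; (apply continuous_Rmult; [|auto]).
    - apply (cont_radial _ origin L0).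
    - apply continuous_Rmult; [apply continuous_const|].
      apply (continuous_ext (fun p => sqnorm p * (tlog1 (sqnorm p / b) / b))).
      + intros q. change (sqnorm q * (tlog1 (sqnorm q / b) / b) = sqnorm q / b * tlog1 (sqnorm q / b)).
        unfold Rdiv. ring.
      + apply continuous_Rmult; [apply cont_sqdist | apply (cont_radial _ origin L1)]. }
  assert (Hlhs : ∬ (fun p => tlog (sqnorm p / b) * cutoff (sqnorm p / a) * - h p) = - ∬ P1).
  { rewrite (square_int_ext _ (fun p => (-1) * P1 p)) by (intros p; unfold P1; ring).
    rewrite square_int_scal by exact CP1. ring. }
  cbv beta in HG. rewrite Hlhs in HG.
  match type of HG with _ = square_int ?X => set (D := X) in HG end.
  assert (CD : cont D).
  { apply (cont_supported (punctured_disc A)); assumption. }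
  assert (HP2 : ∬ P2 = ∬ D - ∬ E).
  { rewrite <- square_int_minus by assumption. apply square_int_ext. intros p.
    unfold P2, D, E, E1, E2. field. lra. }
  change (∬ P1 + ∬ P2 <= 16 * (M1 + 2 * M2 + 1) * (1 + ln (a / b))).
  rewrite HP2, <- HG.
  assert (Hln : 0 <= ln (a / b)).
  { rewrite <- ln_1. apply ln_le; [lra|]. apply Rmult_le_reg_r with b; [lra|].
    unfold Rdiv. rewrite Rmult_assoc, Rinv_l; lra. }
  assert (HEb : ∬ (fun _ => - (4 * (M1 + 2 * M2) * (1 + ln (a / b)))) <= ∬ E).
  { apply square_int_le; [apply cont_const | exact CE|]. intros p Hx Hy.
    assert (Hp : closed_square p) by (split; assumption).
    specialize (B1 p Hp). specialize (B2 p Hp).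
    apply Rabs_le_between in B1. apply Rabs_le_between in B2.
    pose proof (sqdist_ge0 p origin) as Hs0.
    assert (Hsb : 0 <= sqnorm p / b).
    { apply Rmult_le_pos; [exact Hs0|]. left; apply Rinv_0_lt_compat; lra. }
    destruct (tlog1_bound (sqnorm p / b) Hsb) as [W1 W2].
    set (W := sqnorm p / b * tlog1 (sqnorm p / b)) in *.
    assert (Hor : (E1 p = 0 /\ E2 p = 0) \/ 0 <= tlog (sqnorm p / b) <= ln (a / b)).
    { destruct (Rle_dec a (sqnorm p)) as [H|H].
      - left. unfold E1, E2. destruct (Hout p (or_intror H)) as [-> ->]. unfold Rdiv; split; ring.
      - right. split; [apply tlog_ge0|]. apply Rle_trans with (tlog (a / b)).
        + apply tlog_nondecreasing. apply Rmult_le_compat_r; [left; apply Rinv_0_lt_compat|]; lra.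
        + apply tlog_le_ln. apply Rmult_le_reg_r with b; [lra|].
          unfold Rdiv. rewrite Rmult_assoc, Rinv_l; lra. }
    unfold E. fold W. destruct Hor as [[-> ->]|[N0 N1]].
    - assert (0 <= (M1 + 2 * M2) * (1 + ln (a / b))) by (apply Rmult_le_pos; lra). lra.
    - set (N := tlog (sqnorm p / b)) in *. set (l := ln (a / b)) in *.
      assert (- (l * M1) <= N * E1 p) by nra.
      assert (- M2 <= W * E2 p) by nra.
      assert (0 <= l * M2) by nra. lra. }
  rewrite square_int_const in HEb.
  assert (0 <= ln (a / b) + 1) by lra. lra.
Qed.

(** Weights replace indicator functions, to keep all integrands continuous. *)
Definition annular_weight (s r : R) (theta : plane -> R) : Prop :=
  cont theta /\ (forall p, 0 <= theta p <= 1) /\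
  (forall p, sqnorm p <= s \/ r <= sqnorm p -> theta p = 0).

Lemma annular_weight_cont A u h s r theta :
  positive_superharmonic A u h -> 0 < s -> r < A -> annular_weight s r theta ->
  cont (fun p => theta p * h p) /\ cont (fun p => theta p * u p) /\
  (forall p, 0 <= theta p * h p) /\ (forall p, 0 <= theta p * u p).
Proof.
  intros Hu Hs Hr (H1 & H2 & H3).
  assert (Hsup : supported (punctured_disc A) theta) by now apply (supported_annulus A s r).
  split; [|split; [|split]].
  - apply (cont_supported (punctured_disc A)); try assumption.
    intros p Hp. now apply (superharmonic_continuous A u h).
  - apply (cont_supported (punctured_disc A)); try assumption.
    intros p Hp. now apply (superharmonic_continuous A u h).
  - intros p. destruct (Hsup p) as [Hp|Hp].
    + apply Rmult_le_pos; [apply H2 | apply Hu, Hp].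
    + rewrite (locally_singleton _ _ Hp). lra.
  - intros p. destruct (Hsup p) as [Hp|Hp].
    + apply Rmult_le_pos; [apply H2 | left; apply Hu, Hp].
    + rewrite (locally_singleton _ _ Hp). lra.
Qed.

Lemma div_le_iff x b y : 0 < b -> (x / b <= y <-> x <= y * b).
Proof.
  intros Hb. split; intros H.
  - apply (Rmult_le_compat_r b) in H; [|lra]. unfold Rdiv in H. rewrite Rmult_assoc, Rinv_l in H; lra.
  - apply Rmult_le_reg_r with b; [lra|]. unfold Rdiv. rewrite Rmult_assoc, Rinv_l; lra.
Qed.

Lemma le_div_iff x b y : 0 < b -> (y <= x / b <-> y * b <= x).
Proof.
  intros Hb. split; intros H.
  - apply (Rmult_le_compat_r b) in H; [|lra]. unfold Rdiv in H. rewrite Rmult_assoc, Rinv_l in H; lra.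
  - apply Rmult_le_reg_r with b; [lra|]. unfold Rdiv. rewrite Rmult_assoc, Rinv_l; lra.
Qed.

Lemma log_growth_terms A u h a b :
  A <= 1 -> 0 < a < A -> positive_superharmonic A u h -> 0 < b <= a / 2 ->
  let P1 := fun p => tlog (sqnorm p / b) * cutoff (sqnorm p / a) * h p in
  let P2 := fun p => 4 / b * (tlog1 (sqnorm p / b) + sqnorm p / b * tlog2 (sqnorm p / b)) *
                cutoff (sqnorm p / a) * u p in
  cont P1 /\ cont P2 /\ (forall p, 0 <= P1 p) /\ (forall p, 0 <= P2 p).
Proof.
  intros HA Ha Hu Hb P1 P2. destruct cutoff_C2 as (c1 & c2 & Hcut & _).
  pose proof (C2_scaled _ _ _ a Hcut) as Hcuta.
  destruct (C2_everywhere_cont _ _ _ Hcuta) as (K0 & _ & _).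
  destruct (C2_everywhere_cont _ _ _ (C2_scaled _ _ _ b tlog_C2)) as (L0 & L1 & L2).
  set (w1 := fun p => tlog (sqnorm p / b) * cutoff (sqnorm p / a)).
  set (w2 := fun p => 4 / b * (tlog1 (sqnorm p / b) + sqnorm p / b * tlog2 (sqnorm p / b)) *
                cutoff (sqnorm p / a)).
  assert (C1 : cont w1).
  { apply cont_mult; [apply (cont_radial _ origin L0) | apply (cont_radial _ origin K0)]. }
  assert (C2 : cont w2).
  { apply cont_mult; [|apply (cont_radial _ origin K0)].
    intros p. apply (continuous_ext (fun p => 4 * (tlog1 (sqnorm p / b) / b +
        sqnorm p * (tlog2 (sqnorm p / b) / b ^ 2)))).
    - intros q. change (4 * (tlog1 (sqnorm q / b) / b + sqnorm q * (tlog2 (sqnorm q / b) / b ^ 2)) =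
        4 / b * (tlog1 (sqnorm q / b) + sqnorm q / b * tlog2 (sqnorm q / b))). field. lra.
    - apply continuous_Rmult; [apply continuous_const|]. apply continuous_Rplus.
      + apply (cont_radial _ origin L1).
      + apply continuous_Rmult; [apply cont_sqdist | apply (cont_radial _ origin L2)]. }
  assert (Z : forall p, sqnorm p <= b \/ a <= sqnorm p -> w1 p = 0 /\ w2 p = 0).
  { intros p [Hp|Hp].
    - assert (Hw : sqnorm p / b <= 1) by (apply div_le_iff; lra).
      unfold w1, w2. rewrite tlog_0 by exact Hw. 
      unfold tlog1, tlog2. rewrite !zero_below_le by exact Hw. split; ring.
    - unfold w1, w2. rewrite (cutoff_0 (sqnorm p / a)) by (apply le_div_iff; lra). split; ring. }
  assert (S1 : supported (punctured_disc A) w1) by (apply (supported_annulus A b a); [lra|lra|apply Z]).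
  assert (S2 : supported (punctured_disc A) w2) by (apply (supported_annulus A b a); [lra|lra|apply Z]).
  assert (N1 : forall p, 0 <= w1 p).
  { intros p. apply Rmult_le_pos; [apply tlog_ge0 | apply cutoff_bounds]. }
  assert (N2 : forall p, 0 <= w2 p).
  { intros p. apply Rmult_le_pos; [|apply cutoff_bounds]. apply Rmult_le_pos; [|apply tlog_subharmonic].
    left; apply Rdiv_lt_0_compat; lra. }
  split; [|split; [|split]].
  - apply (cont_supported (punctured_disc A) w1); try assumption.
    intros p Hp. now apply (superharmonic_continuous A u h).
  - apply (cont_supported (punctured_disc A) w2); try assumption.
    intros p Hp. now apply (superharmonic_continuous A u h).
  - intros p. destruct (S1 p) as [Hp|Hp].
    + apply Rmult_le_pos; [apply N1 | apply Hu, Hp].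
    + change (0 <= w1 p * h p). rewrite (locally_singleton _ _ Hp). lra.
  - intros p. destruct (S2 p) as [Hp|Hp].
    + apply Rmult_le_pos; [apply N2 | left; apply Hu, Hp].
    + change (0 <= w2 p * u p). rewrite (locally_singleton _ _ Hp). lra.
Qed.

(** Both sides of [log_growth] grow like [ln (1 / b)] as [b -> 0], since the test
    function does so at every fixed point; divide by [ln (1 / b)]. *)
Lemma mass_bounded A u h :
  0 < A <= 1 -> positive_superharmonic A u h ->
  exists C, 0 < C /\ forall s theta, 0 < s -> annular_weight s (A / 4) theta ->
    ∬ (fun p => theta p * h p) <= C.
Proof.
  intros HA Hu. set (a := A / 2).
  destruct (log_growth A u h a) as (C & HC & Hgrow); [lra | unfold a; lra | exact Hu|].
  exists (4 * C). split; [lra|]. intros s theta Hs Htheta.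
  (* [b] so small that [tlog (s / b) >= (1 + ln (a / b)) / 4] *)
  set (b := Rmin (a / 2) (Rmin s (exp (4 * ln s - 10)))).
  assert (Hb : 0 < b) by (unfold b; repeat apply Rmin_pos; try apply exp_pos; unfold a; lra).
  assert (Hba : b <= a / 2) by apply Rmin_l.
  assert (Hbs : b <= s) by (unfold b; eapply Rle_trans; [apply Rmin_r | apply Rmin_l]).
  assert (Hbe : b <= exp (4 * ln s - 10)) by (unfold b; eapply Rle_trans; [apply Rmin_r | apply Rmin_r]).
  assert (Hlb : ln b <= 4 * ln s - 10).
  { rewrite <- (ln_exp (4 * ln s - 10)). now apply ln_le. }
  assert (Hlba : ln b <= ln a) by (apply ln_le; unfold a in *; lra).
  assert (Hla : ln a <= 0).
  { rewrite <- ln_1. apply ln_le; unfold a; lra. }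
  assert (Hrat : forall t, 0 < t -> ln (t / b) = ln t - ln b) by (intros t Ht; now apply ln_div).
  pose proof (Hgrow b (conj Hb Hba)) as H1.
  destruct (log_growth_terms A u h a b) as (CP1 & CP2 & NP1 & NP2);
    [lra | unfold a; lra | exact Hu | lra |].
  set (k := ln (s / b) - 3 / 2).
  destruct (annular_weight_cont A u h s (A / 4) theta Hu Hs) as (Ct & _ & Nt & _); [lra | exact Htheta|].
  assert (Hk : ∬ (fun p => k * (theta p * h p)) <=
     ∬ (fun p => tlog (sqnorm p / b) * cutoff (sqnorm p / a) * h p)).
  { apply square_int_le; [|exact CP1|].
    - intros p. apply continuous_Rmult; [apply continuous_const | apply Ct].
    - intros p _ _. destruct Htheta as (_ & T1 & T0).
      destruct (Rle_dec (sqnorm p) s) as [Hp|Hp].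
      { rewrite (T0 p (or_introl Hp)). specialize (NP1 p). simpl in NP1. lra. }
      destruct (Rle_dec (A / 4) (sqnorm p)) as [Hp'|Hp'].
      { rewrite (T0 p (or_intror Hp')). specialize (NP1 p). simpl in NP1. lra. }
      rewrite cutoff_1, Rmult_1_r by (apply div_le_iff; unfold a; lra).
      assert (Hh : 0 <= h p) by (apply Hu; split; lra).
      assert (Hkt : k <= tlog (sqnorm p / b)).
      { apply Rle_trans with (tlog (s / b)).
        - apply tlog_ge_ln. apply le_div_iff; lra.
        - apply tlog_nondecreasing. apply Rmult_le_compat_r; [left; apply Rinv_0_lt_compat; lra | lra]. }
      assert (k * theta p <= tlog (sqnorm p / b)).
      { specialize (T1 p). destruct (Rle_dec 0 k); [|pose proof (tlog_ge0 (sqnorm p / b)); nra]. nra. }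
      rewrite <- Rmult_assoc. now apply Rmult_le_compat_r. }
  rewrite square_int_scal in Hk by exact Ct.
  assert (HP2 : 0 <= ∬ (fun p => 4 / b * (tlog1 (sqnorm p / b) + sqnorm p / b * tlog2 (sqnorm p / b)) *
                cutoff (sqnorm p / a) * u p)) by (apply square_int_ge0; [exact CP2 | intros; apply NP2]).
  set (I0 := ∬ (fun p => theta p * h p)) in *.
  unfold k in Hk. rewrite Hrat in Hk by lra. rewrite Hrat in H1 by (unfold a; lra).
  assert (HI : (ln s - ln b - 3 / 2) * I0 <= C * (1 + (ln a - ln b))) by lra.
  apply Rnot_lt_le. intros Hlt.
  assert (0 < ln s - ln b - 3 / 2).
  { assert (ln s <= 0 \/ 0 < ln s) by lra. destruct H; [lra|].
    assert (s <= 1 \/ 1 < s) by lra. lra. }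
  assert ((ln s - ln b - 3 / 2) * (4 * C) < (ln s - ln b - 3 / 2) * I0)
    by (apply Rmult_lt_compat_l; lra).
  assert (1 + (ln a - ln b) <= 4 * (ln s - ln b - 3 / 2)) by lra.
  assert (C * (1 + (ln a - ln b)) <= C * (4 * (ln s - ln b - 3 / 2))) by (apply Rmult_le_compat_l; lra).
  lra.
Qed.

(** A weight that nearly exhausts the total mass leaves little mass nearer the origin. *)
Lemma mass_vanishing A u h d :
  0 < A <= 1 -> positive_superharmonic A u h -> 0 < d ->
  exists r, 0 < r <= A / 4 /\ forall s theta, 0 < s -> annular_weight s r theta ->
    ∬ (fun p => theta p * h p) <= d.
Proof.
  intros HA Hu Hd. destruct (mass_bounded A u h HA Hu) as (C & HC & Hmass).
  set (E := fun m => exists s theta, 0 < s /\ annular_weight s (A / 4) theta /\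
    m = ∬ (fun p => theta p * h p)).
  assert (Hb : bound E).
  { exists C. intros m (s & theta & Hs & Ht & ->). now apply Hmass with s. }
  assert (Hne : exists m, E m).
  { exists (∬ (fun p => 0 * h p)), 1, (fun _ => 0). split; [lra|]. split; [|reflexivity].
    split; [apply cont_const|]. split; [intros; lra | reflexivity]. }
  destruct (completeness E Hb Hne) as [S [HS1 HS2]].
  assert (Hex : exists m, E m /\ S - d < m).
  { apply NNPP. intros Hn. assert (S <= S - d); [|lra]. apply HS2. intros m Hm.
    apply Rnot_lt_le. intros Hlt. apply Hn. now exists m. }
  destruct Hex as (m & (s1 & t1 & Hs1 & Ht1 & ->) & Hm).
  exists (Rmin s1 (A / 4)). split; [split; [apply Rmin_pos; lra | apply Rmin_r]|].
  intros s theta Hs Ht. pose proof (Rmin_l s1 (A / 4)). pose proof (Rmin_r s1 (A / 4)).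
  destruct (annular_weight_cont A u h s1 (A / 4) t1 Hu Hs1) as (C1 & _); [lra | exact Ht1 |].
  destruct (annular_weight_cont A u h s (Rmin s1 (A / 4)) theta Hu Hs) as (C2 & _); [lra | exact Ht |].
  assert (Hsum : E (∬ (fun p => (t1 p + theta p) * h p))).
  { exists (Rmin s s1), (fun p => t1 p + theta p).
    destruct Ht1 as (K1 & K2 & K3). destruct Ht as (L1 & L2 & L3).
    split; [now apply Rmin_pos|]. split; [|reflexivity]. split; [|split].
    - now apply cont_plus.
    - intros p. specialize (K2 p). specialize (L2 p).
      destruct (Rle_dec (sqnorm p) s1) as [Hp|Hp].
      + rewrite (K3 p (or_introl Hp)). lra.
      + rewrite (L3 p) by lra. lra.
    - intros p Hp. pose proof (Rmin_l s s1). pose proof (Rmin_r s s1).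
      rewrite K3, L3 by lra. ring. }
  apply HS1 in Hsum.
  rewrite (square_int_ext _ (fun p => t1 p * h p + theta p * h p)) in Hsum by (intros; ring).
  rewrite square_int_plus in Hsum by assumption. lra.
Qed.

(** For [b = |x|^2 / 8] the Laplacian of the test function of [log_growth] is at
    least a constant times [1 / |x|^2] on the annulus where the weight lives. *)
Lemma average_bound A u h :
  0 < A <= 1 -> positive_superharmonic A u h ->
  exists C r, 0 < C /\ 0 < r /\ 4 * r < A /\ (forall X, 0 < X < r -> 1 <= - ln X) /\
  forall x psi, 0 < sqnorm x < r -> annular_weight (sqnorm x / 4) (4 * sqnorm x) psi ->
    ∬ (fun p => psi p * u p) <= C * sqnorm x * (- ln (sqnorm x)).
Proof.
  intros HA Hu. set (a := A / 2).
  destruct (log_growth A u h a) as (C & HC & Hgrow); [lra | unfold a; lra | exact Hu|].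
  exists (32 * (C * 5)), (Rmin (A / 16) (exp (-1))).
  assert (Hr : 0 < Rmin (A / 16) (exp (-1))) by (apply Rmin_pos; [lra | apply exp_pos]).
  pose proof (Rmin_l (A / 16) (exp (-1))). pose proof (Rmin_r (A / 16) (exp (-1))).
  assert (HL : forall X, 0 < X < Rmin (A / 16) (exp (-1)) -> 1 <= - ln X).
  { intros X HX. assert (ln X <= ln (exp (-1))) by (apply ln_le; lra). rewrite ln_exp in H1. lra. }
  repeat split; try lra; [exact HL|].
  intros x psi Hx Hpsi. specialize (HL _ Hx). set (X := sqnorm x) in *.
  set (b := X / 8).
  destruct (annular_weight_cont A u h _ _ psi Hu (ltac:(lra) : 0 < X / 4) (ltac:(lra) : 4 * X < A) Hpsi)
    as (_ & Cpsi & _ & _).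
  assert (Hb : 0 < b <= a / 2) by (unfold a, b; lra).
  destruct (log_growth_terms A u h a b) as (CP1 & CP2 & NP1 & NP2);
    [lra | unfold a; lra | exact Hu | exact Hb |].
  specialize (Hgrow b Hb).
  assert (HP1 : 0 <= ∬ (fun p => tlog (sqnorm p / b) * cutoff (sqnorm p / a) * h p))
    by (apply square_int_ge0; [exact CP1 | intros; apply NP1]).
  assert (Hle : ∬ (fun p => / (32 * X) * (psi p * u p)) <=
    ∬ (fun p => 4 / b * (tlog1 (sqnorm p / b) + sqnorm p / b * tlog2 (sqnorm p / b)) *
                cutoff (sqnorm p / a) * u p)).
  { apply square_int_le; [|exact CP2|].
    - intros p. apply continuous_Rmult; [apply continuous_const | apply Cpsi].
    - intros p _ _. destruct Hpsi as (_ & B & Z).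
      destruct (Rle_dec (sqnorm p) (X / 4)) as [Hp|Hp].
      { rewrite (Z p (or_introl Hp)). specialize (NP2 p). simpl in NP2. lra. }
      destruct (Rle_dec (4 * X) (sqnorm p)) as [Hp'|Hp'].
      { rewrite (Z p (or_intror Hp')). specialize (NP2 p). simpl in NP2. lra. }
      rewrite cutoff_1, Rmult_1_r by (apply div_le_iff; unfold a; lra).
      rewrite <- Rmult_assoc. apply Rmult_le_compat_r.
      { left. apply Hu. split; lra. }
      set (w := sqnorm p / b).
      assert (Hw : 2 <= w) by (apply le_div_iff; unfold b; lra).
      assert (Hw' : w <= 32) by (apply div_le_iff; unfold b; lra).
      pose proof (tlog_subharmonic_lower w Hw) as HD.
      assert (Hi : / 32 ^ 2 <= / w ^ 2) 
        by (apply Rinv_le_contravar; [apply pow_lt; lra | apply pow_incr; lra]).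
      assert (Hx0 : 0 < / (32 * X)) by (apply Rinv_0_lt_compat; lra).
      specialize (B p).
      apply Rle_trans with (/ (32 * X)); [nra|].
      replace (/ (32 * X)) with (4 / b * / 32 ^ 2) by (unfold b; field; lra).
      apply Rmult_le_compat_l; [left; apply Rdiv_lt_0_compat; lra | lra]. }
  rewrite square_int_scal in Hle by exact Cpsi.
  assert (Hln : 1 + ln (a / b) <= 5 * (- ln X)).
  { unfold b. rewrite ln_div by (unfold a; lra). unfold Rdiv at 1.
    rewrite ln_mult by lra. rewrite ln_Rinv by lra.
    assert (ln a <= 0) by (rewrite <- ln_1; apply ln_le; unfold a; lra).
    assert (ln 8 <= 3).
    { replace 8 with (2 * 2 * 2) by ring. rewrite !ln_mult by lra.
      pose proof ln_lt_2. assert (ln 2 < 1); [|lra].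
      rewrite <- (ln_exp 1). apply ln_increasing; [lra|].
      pose proof (exp_ineq1 1). lra. }
    lra. }
  set (J := ∬ (fun p => psi p * u p)) in *.
  assert (H3 : / (32 * X) * J <= C * (5 * - ln X)).
  { apply Rle_trans with (C * (1 + ln (a / b))); [lra|]. apply Rmult_le_compat_l; lra. }
  apply (Rmult_le_compat_l (32 * X)) in H3; [|lra].
  rewrite <- Rmult_assoc, Rinv_r in H3 by lra. lra.
Qed.

(** * The local potential *)

(** Green's identity with the truncated Green function centred at [x]. The
    regularisation [e] turns the Dirac mass into a positive kernel which gives
    mass bounded below to the set where [u] is close to [u x]. *)
Lemma potential_estimate A u h x q e :
  0 < A <= 1 -> positive_superharmonic A u h -> 0 < e <= q / 4 ->
  (forall p, sqdist p x <= q -> punctured_disc A p) ->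
  (forall p, sqdist p x <= e -> u x / 2 <= u p) ->
  u x <= 2 * ∬ (fun p => tgreen ((sqdist p x + e) / q) * h p) +
    16 / q * ∬ (fun p => Rmax 0 (1 - (sqdist p x + e) / q) * u p).
Proof.
  intros HA Hu He Hball Hnear.
  assert (Hxx : sqdist x x = 0) by (unfold sqdist; ring).
  assert (Hux : 0 < u x) by (apply Hu, Hball; rewrite Hxx; lra).
  assert (Haff : C2_on (fun s => 0 <= s) (fun s => / q * s + e / q) (fun _ => / q) (fun _ => 0))
    by apply C2_affine.
  assert (Hpos : forall s, 0 <= s -> 0 < / q * s + e / q).
  { intros s Hs. assert (0 < / q) by (apply Rinv_0_lt_compat; lra).
    assert (0 < e / q) by (apply Rdiv_lt_0_compat; lra). nra. }
  pose proof (C2_comp _ _ _ _ _ _ _ _ tgreen_C2 Haff Hpos) as HF.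
  pose proof (radial_has_laplacian _ _ _ x HF) as Hphi. cbv beta in Hphi.
  set (w := fun p => / q * sqdist p x + e / q) in *.
  assert (Hw : forall p, (sqdist p x + e) / q = w p) by (intros p; unfold w; field; lra).
  assert (Hw0 : forall p, 0 < w p) by (intros p; apply Hpos, sqdist_ge0).
  assert (Hw1 : forall p, q <= sqdist p x -> 1 <= w p).
  { intros p Hp. rewrite <- Hw. apply le_div_iff; lra. }
  assert (Hwc : cont w).
  { intros p. apply continuous_Rplus; [|apply continuous_const].
    apply continuous_Rmult; [apply continuous_const | apply cont_sqdist]. }
  assert (Hsup : supported (punctured_disc A) (fun p => tgreen (w p))).
  { apply (supported_ball _ x q); [exact Hball|]. intros p Hp. now apply tgreen_0, Hw1. }
  assert (Hsup1 : supported (punctured_disc A) (fun p => Rmax 0 (1 - w p))).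
  { apply (supported_ball _ x q); [exact Hball|]. intros p Hp. apply Rmax_left.
    specialize (Hw1 p Hp). lra. }
  assert (Hg2 : forall p, 1 <= w p -> tgreen2 (w p) = 0).
  { intros p Hp. unfold tgreen2. apply Rmax_left.
    assert (0 < / w p <= 1) by (split; [apply Rinv_0_lt_compat; lra | now apply Rinv_le1]).
    rewrite <- pow_inv. nra. }
  assert (Hsup2 : supported (punctured_disc A) (fun p => tgreen2 (w p))).
  { apply (supported_ball _ x q); [exact Hball|]. intros p Hp. now apply Hg2, Hw1. }
  destruct (has_laplacian_everywhere_cont _ _ Hphi) as [Cphi _].
  assert (Cm : cont (fun p => Rmax 0 (1 - w p))).
  { intros p. apply continuous_Rmax; [apply continuous_const|].
    apply continuous_Rminus; [apply continuous_const | apply Hwc]. }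
  assert (C2 : cont (fun p => tgreen2 (w p))).
  { intros p. apply (continuous_comp_R w tgreen2); [apply Hwc|]. now apply tgreen_C2. }
  assert (Hucont : forall p, punctured_disc A p -> continuous u p).
  { intros p Hp. now apply (superharmonic_continuous A u h). }
  assert (I1 : cont (fun p => tgreen (w p) * h p)).
  { apply (cont_supported (punctured_disc A)); try assumption.
    intros p Hp. now apply (superharmonic_continuous A u h). }
  assert (I2 : cont (fun p => Rmax 0 (1 - w p) * u p)) by now apply (cont_supported (punctured_disc A)).
  assert (I3 : cont (fun p => tgreen2 (w p) * u p)) by now apply (cont_supported (punctured_disc A)).
  pose proof (green _ _ _ _ _ (punctured_disc_in_box A (proj2 HA)) (proj1 Hu) Hphi Hsup) as HG.
  cbv beta in HG.
  rewrite (square_int_ext _ (fun p => (-1) * (tgreen (w p) * h p))) in HG by (intros p; unfold w; ring).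
  rewrite square_int_scal in HG by exact I1.
  match type of HG with _ = square_int ?X =>
    rewrite (square_int_ext X (fun p => 8 / q * (Rmax 0 (1 - w p) * u p) -
      4 * e / q ^ 2 * (tgreen2 (w p) * u p))) in HG end.
  2:{ intros p. fold (w p).
      assert (E : sqdist p x = q * w p - e) by (rewrite <- Hw; field; lra).
      pose proof (tgreen_laplacian (w p) (Hw0 p)) as HL.
      replace (8 / q * (Rmax 0 (1 - w p) * u p)) with (4 / q * (2 * Rmax 0 (1 - w p)) * u p)
        by (field; lra).
      rewrite <- HL. rewrite E at 1. field. lra. }
  rewrite square_int_minus in HG.
  2:{ intros p; apply continuous_Rmult; [apply continuous_const | apply I2]. }
  2:{ intros p; apply continuous_Rmult; [apply continuous_const | apply I3]. }
  rewrite !square_int_scal in HG by assumption.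
  rewrite (square_int_ext (fun p => tgreen ((sqdist p x + e) / q) * h p)
    (fun p => tgreen (w p) * h p)) by (intros p; now rewrite Hw).
  rewrite (square_int_ext (fun p => Rmax 0 (1 - (sqdist p x + e) / q) * u p)
    (fun p => Rmax 0 (1 - w p) * u p)) by (intros p; now rewrite Hw).
  (* the square of half-side [d] around [x] lies in the disc [|p - x|^2 <= e] *)
  set (d := sqrt (e / 2)).
  assert (Hd : d ^ 2 = e / 2) by (unfold d; simpl; rewrite Rmult_1_r; apply sqrt_sqrt; lra).
  assert (Hd0 : 0 <= d) by apply sqrt_pos.
  assert (Hcorner : forall s t, s ^ 2 <= d ^ 2 -> t ^ 2 <= d ^ 2 ->
     -1 < fst x + s < 1 /\ -1 < snd x + t < 1).
  { intros s t Hs Ht.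
    apply (punctured_disc_in_box A (proj2 HA) (fst x + s, snd x + t)), Hball.
    unfold sqdist; simpl fst; simpl snd. replace (fst x + s - fst x) with s by ring.
    replace (snd x + t - snd x) with t by ring. lra. }
  assert (Hlow : 4 * d ^ 2 * (q ^ 2 / (8 * e ^ 2) * (u x / 2)) <= ∬ (fun p => tgreen2 (w p) * u p)).
  { destruct (Hcorner d d) as [K1 K2]; [lra|lra|].
    destruct (Hcorner (- d) (- d)) as [K3 K4]; [nra|nra|].
    apply (square_int_ge_on_subsquare _ x d); try assumption; try lra.
    - intros p. destruct (Hsup2 p) as [Hp|Hp].
      + apply Rmult_le_pos; [apply Rmax_l | left; apply Hu, Hp].
      + rewrite (locally_singleton _ _ Hp). lra.
    - intros p H1 H2.
      assert (Hp : sqdist p x <= e).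
      { unfold sqdist. rewrite <- (pow2_abs (fst p - fst x)), <- (pow2_abs (snd p - snd x)).
        pose proof (Rabs_pos (fst p - fst x)). pose proof (Rabs_pos (snd p - snd x)).
        pose proof (pow_incr _ _ 2 (conj H H1)). pose proof (pow_incr _ _ 2 (conj H0 H2)). lra. }
      apply Rmult_le_compat; [| lra | | now apply Hnear].
      + apply Rmult_le_pos; [apply pow2_ge_0 | left; apply Rinv_0_lt_compat; nra].
      + assert (Hwp : w p <= 2 * e / q).
        { rewrite <- Hw; apply Rmult_le_compat_r; [left; apply Rinv_0_lt_compat|]; lra. }
        assert (Hi : / (2 * e / q) <= / w p) by (apply Rinv_le_contravar; [apply Hw0 | exact Hwp]).
        replace (/ (2 * e / q)) with (q / (2 * e)) in Hi by (field; lra).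
        unfold tgreen2. eapply Rle_trans; [|apply Rmax_r].
        replace (q ^ 2 / (8 * e ^ 2)) with ((q / (2 * e)) ^ 2 / 2) by (field; lra).
        rewrite <- pow_inv.
        assert (H2' : 2 <= q / (2 * e)) by (apply le_div_iff; lra). nra. }
  apply (Rmult_le_compat_l (4 * e / q ^ 2)) in Hlow.
  2:{ left. apply Rdiv_lt_0_compat; [lra | nra]. }
  rewrite Hd in Hlow.
  replace (4 * e / q ^ 2 * (4 * (e / 2) * (q ^ 2 / (8 * e ^ 2) * (u x / 2)))) with (u x / 2) in Hlow
    by (field; lra).
  lra.
Qed.

Lemma annular_weight_near x theta :
  cont theta -> (forall p, 0 <= theta p <= 1) -> 
  (forall p, sqnorm x / 4 <= sqdist p x -> theta p = 0) ->
  annular_weight (sqnorm x / 4) (4 * sqnorm x) theta.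
Proof.
  intros H1 H2 H3. split; [exact H1|]. split; [exact H2|]. intros p Hp. apply H3.
  pose proof (sqdist_triangle x p origin). pose proof (sqdist_triangle p x origin).
  rewrite (sqdist_sym x p) in *. pose proof (sqdist_ge0 x origin). destruct Hp; lra.
Qed.

Lemma sqnorm_near x p : sqdist p x <= sqnorm x / 4 -> sqnorm x / 4 <= sqnorm p <= 5 / 2 * sqnorm x.
Proof.
  intros H. pose proof (sqdist_triangle x p origin). pose proof (sqdist_triangle p x origin).
  rewrite (sqdist_sym x p) in *. lra.
Qed.

Lemma cont_cutoff x a : 0 < a -> cont (fun p => cutoff (sqdist p x / a)).
Proof.
  intros Ha. destruct cutoff_C2 as (c1 & c2 & Hcut & _).
  destruct (C2_everywhere_cont _ _ _ (C2_scaled _ _ _ a Hcut)) as (K0 & _).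
  apply (cont_radial _ x K0).
Qed.

Lemma annular_cutoff x a :
  0 < a <= sqnorm x / 4 ->
  annular_weight (sqnorm x / 4) (4 * sqnorm x) (fun p => cutoff (sqdist p x / a)).
Proof.
  intros Ha. apply annular_weight_near.
  - apply cont_cutoff; lra.
  - intros p; apply cutoff_bounds.
  - intros p Hp. apply cutoff_0, le_div_iff; lra.
Qed.

(** Averages of [u] near [x] are [O (log (1 / |x|))], so only the potential of the
    nearby mass can make [u] larger. One regularisation parameter serves a whole
    ball, by uniform continuity and the positive lower bound of [u]. *)
Lemma pointwise_bound A u h :
  0 < A <= 1 -> positive_superharmonic A u h ->
  exists C r, 0 < C /\ 0 < r /\ 4 * r < A /\ (forall X, 0 < X < r -> 1 <= - ln X) /\
  forall x, 0 < sqnorm x < r -> exists e, 0 < e <= 1 /\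
    forall y, sqdist y x <= sqnorm x / 32 ->
      u y <= C * (- ln (sqnorm x)) +
        2 * ∬ (fun z => tgreen ((sqdist z y + e) / (sqnorm x / 64)) * h z).
Proof.
  intros HA Hu. destruct (average_bound A u h HA Hu) as (C & r & HC & Hr & HrA & HL & Hav).
  destruct (superharmonic_lower_bound A u h (5 / 2 * r)) as (c & Hc & Hlow); [lra | lra | exact Hu |].
  exists (1024 * C), r. split; [lra|]. split; [exact Hr|]. split; [exact HrA|]. split; [exact HL|].
  intros x Hx. set (X := sqnorm x) in *.
  pose proof (annular_cutoff x (X / 4)) as Hcut. fold X in Hcut. specialize (Hcut ltac:(lra)).
  destruct (annular_weight_cont A u h _ _ _ Hu (ltac:(lra) : 0 < X / 4) (ltac:(lra) : 4 * X < A) Hcut)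
    as (_ & Ccut & _ & _).
  destruct (cont_uniform _ (c / 2) Ccut ltac:(lra)) as (d & Hd & Hunif).
  set (e := Rmin (d ^ 2 / 2) (X / 256)).
  assert (He : 0 < e) by (apply Rmin_pos; [apply Rdiv_lt_0_compat; [now apply pow_lt | lra] | lra]).
  assert (He1 : e <= d ^ 2 / 2) by apply Rmin_l.
  assert (He2 : e <= X / 256) by apply Rmin_r.
  exists e. split; [lra|]. intros y Hy.
  assert (Hnear : forall p, sqdist p y <= e ->  u y / 2 <= u p).
  { intros p Hp.
    assert (Hpx : sqdist p x <= X / 8) by (pose proof (sqdist_triangle p y x); lra).
    assert (Hp1 : cutoff (sqdist p x / (X / 4)) = 1) by (apply cutoff_1, div_le_iff; lra).
    assert (Hy1 : cutoff (sqdist y x / (X / 4)) = 1) by (apply cutoff_1, div_le_iff; lra).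
    pose proof (sqnorm_near x p ltac:(fold X; lra)) as Np. fold X in Np.
    pose proof (sqnorm_near x y ltac:(fold X; lra)) as Ny. fold X in Ny.
    pose proof (Hunif y p) as Hcl. rewrite Hp1, Hy1, !Rmult_1_l in Hcl.
    assert (Hsm : forall s, s ^ 2 <= e -> Rabs s < d).
    { intros s Hs. apply Rnot_le_lt. intros Hds.
      pose proof (pow_incr d (Rabs s) 2 ltac:(lra)). rewrite pow2_abs in H.
      assert (0 < d ^ 2) by now apply pow_lt. lra. }
    assert (Habs : Rabs (u p - u y) < c / 2).
    { apply Hcl.
      - apply closed_square_of_sqnorm; lra.
      - apply closed_square_of_sqnorm; lra.
      - apply Hsm. unfold sqdist in Hp. pose proof (pow2_ge_0 (snd p - snd y)). lra.
      - apply Hsm. unfold sqdist in Hp. pose proof (pow2_ge_0 (fst p - fst y)). lra. }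
    apply Rabs_def2 in Habs. pose proof (Hlow y ltac:(lra)). lra. }
  set (q := X / 64).
  pose proof (potential_estimate A u h y q e HA Hu) as Hpot.
  assert (Hbig : 16 / q * ∬ (fun p => Rmax 0 (1 - (sqdist p y + e) / q) * u p) <= 1024 * C * - ln X).
  { assert (Hw : annular_weight (X / 4) (4 * X) (fun p => Rmax 0 (1 - (sqdist p y + e) / q))).
    { apply (annular_weight_near x).
      - intros p. apply continuous_Rmax; [apply continuous_const|].
        apply continuous_Rminus; [apply continuous_const|].
        apply continuous_Rdiv; [|apply continuous_const | unfold q; lra].
        apply continuous_Rplus; [apply cont_sqdist | apply continuous_const].
      - intros p. split; [apply Rmax_l|]. apply Rmax_lub; [lra|].
        assert (0 <= (sqdist p y + e) / q); [|lra].
        pose proof (sqdist_ge0 p y). apply Rmult_le_pos; [lra|].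
        left; apply Rinv_0_lt_compat; unfold q; lra.
      - intros p Hp. fold X in Hp. apply Rmax_left.
        assert (1 <= (sqdist p y + e) / q); [|lra]. apply le_div_iff; unfold q; [lra|].
        pose proof (sqdist_triangle p y x). lra. }
    specialize (Hav x _ Hx Hw). fold X in Hav.
    apply (Rmult_le_compat_l (16 / q)) in Hav; [|left; apply Rdiv_lt_0_compat; unfold q; lra].
    eapply Rle_trans; [exact Hav|]. unfold q. right. field. lra. }
  enough (u y <= 2 * ∬ (fun p => tgreen ((sqdist p y + e) / q) * h p) +
     16 / q * ∬ (fun p => Rmax 0 (1 - (sqdist p y + e) / q) * u p)) by (unfold q in *; lra).
  apply Hpot.
  - unfold q; lra.
  - intros p Hp. pose proof (sqdist_triangle p y x).
    pose proof (sqnorm_near x p ltac:(fold X; unfold q in Hp; lra)) as Np. fold X in Np. split; lra.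
  - exact Hnear.
Qed.

(** * Integrability of exponentials *)

(** A fixed weight: the constants obtained from it do not depend on [x]. *)
Definition disc_weight (p : plane) : R := cutoff (sqnorm p / (1 / 4)).

Lemma disc_weight_cont : cont disc_weight.
Proof. apply cont_cutoff; lra. Qed.

Lemma disc_weight_bounds p : 0 <= disc_weight p <= 1.
Proof. apply cutoff_bounds. Qed.

Lemma disc_weight_1 p : sqnorm p <= 1 / 8 -> disc_weight p = 1.
Proof. intros H. apply cutoff_1, div_le_iff; lra. Qed.

Lemma cont_kernel (e : R) : 0 < e ->
  cont (fun z : plane * plane => / sqrt (sqdist (fst z) (snd z) + e)).
Proof.
  intros He z.
  apply (continuous_Rinv' (fun z : plane * plane => sqrt (sqdist (fst z) (snd z) + e))).
  - apply (continuous_sqrt_comp' (fun z : plane * plane => sqdist (fst z) (snd z) + e)).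
    apply (continuous_Rplus (fun z : plane * plane => sqdist (fst z) (snd z)) (fun _ => e));
      [|apply continuous_const].
    apply continuous_sqdist; solve_cont.
  - apply Rgt_not_eq, sqrt_lt_R0, Rplus_le_lt_0_compat; [apply sqdist_ge0 | exact He].
Qed.

(** Green's identity with [sqrt (|y - z|^2 + e)], whose Laplacian dominates the
    kernel: the singularity of [1 / |y - z|] is integrable, uniformly in [e]. *)
Lemma kernel_integral_bound :
  exists C, 0 < C /\ forall e z, 0 < e <= 1 -> sqnorm z <= 2 ->
    ∬ (fun y => disc_weight y * / sqrt (sqdist y z + e)) <= C.
Proof.
  destruct cutoff_C2 as (c1 & c2 & Hcut & _).
  pose proof (C2_scaled _ _ _ (1 / 4) Hcut) as Hcuta.
  apply (C2_on_weaken _ (fun s => 0 <= s)) in Hcuta; [|trivial].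
  pose proof (radial_has_laplacian _ _ _ origin Hcuta) as Hphi. cbv beta in Hphi.
  match type of Hphi with has_laplacian _ _ ?X => set (dphi := X) in Hphi end.
  destruct (has_laplacian_everywhere_cont _ _ Hphi) as [Cphi Cdphi].
  destruct (cont_bounded dphi Cdphi) as (M & HM & Hbd).
  exists (4 * (3 * M + 1)). split; [lra|]. intros e z He Hz.
  set (Omega := fun p : plane => sqnorm p < 1 / 2).
  assert (Hbox : in_box Omega).
  { intros [p1 p2] Hp. unfold Omega, sqdist, origin in Hp; simpl in *. split; split; nra. }
  assert (Hsup : supported Omega disc_weight).
  { apply (supported_ball _ origin (1 / 4)).
    - intros p Hp. unfold Omega; lra.
    - intros p Hp. apply cutoff_0, le_div_iff; lra. }
  set (F := fun s => sqrt (s + e)).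
  set (F1 := fun s => / (2 * sqrt (s + e))).
  set (F2 := fun s => - / (4 * (s + e) * sqrt (s + e))).
  assert (HF : C2_on (fun s => 0 <= s) F F1 F2).
  { intros s Hs. pose proof (sqrt_lt_R0 (s + e) ltac:(lra)) as Hsq.
    pose proof (sqrt_sqrt (s + e) ltac:(lra)) as Hss. unfold F, F1, F2. split; [|split].
    - auto_derive; [lra | field; lra].
    - auto_derive; [lra|]. set (t := sqrt (s + e)) in *. rewrite <- Hss. field. lra.
    - apply continuous_Ropp, continuous_Rinv'.
      + solve_cont.
      + assert (0 < 4 * (s + e) * sqrt (s + e)) by (apply Rmult_lt_0_compat; lra). lra. }
  pose proof (radial_has_laplacian _ _ _ z HF) as HV.
  destruct (has_laplacian_everywhere_cont _ _ HV) as [CV CdV].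
  assert (HV' : has_laplacian Omega (fun p => F (sqdist p z))
    (fun p => 4 * (F1 (sqdist p z) + sqdist p z * F2 (sqdist p z)))).
  { destruct HV as (a1 & a2 & a3 & a4 & Ha). exists a1, a2, a3, a4. intros p _. apply Ha. exact I. }
  pose proof (green Omega _ _ _ _ Hbox HV' Hphi Hsup) as HG.
  assert (Hle1 : ∬ (fun y => disc_weight y * / sqrt (sqdist y z + e)) <=
    ∬ (fun p => disc_weight p * (4 * (F1 (sqdist p z) + sqdist p z * F2 (sqdist p z))))).
  { apply square_int_le.
    - apply cont_mult; [apply disc_weight_cont|].
      apply (cont_slice_l (fun w : plane * plane => / sqrt (sqdist (fst w) (snd w) + e)) z).
      apply cont_kernel; lra.
    - apply cont_mult; [apply disc_weight_cont | exact CdV].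
    - intros y _ _. apply Rmult_le_compat_l; [apply disc_weight_bounds|].
      pose proof (sqdist_ge0 y z) as Hs. set (s := sqdist y z) in *.
      pose proof (sqrt_lt_R0 (s + e) ltac:(lra)) as Hsq. unfold F1, F2.
      replace (4 * (/ (2 * sqrt (s + e)) + s * - / (4 * (s + e) * sqrt (s + e))))
        with (/ sqrt (s + e) + / sqrt (s + e) * (e / (s + e))) by (field; lra).
      assert (0 < / sqrt (s + e)) by now apply Rinv_0_lt_compat.
      assert (0 < e / (s + e)) by (apply Rdiv_lt_0_compat; lra). nra. }
  eapply Rle_trans; [exact Hle1|].
  change (∬ (fun p => disc_weight p * (4 * (F1 (sqdist p z) + sqdist p z * F2 (sqdist p z)))) =
    ∬ (fun p => dphi p * F (sqdist p z))) in HG.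
  rewrite HG. rewrite <- square_int_const. apply square_int_le.
  - now apply cont_mult.
  - apply cont_const.
  - intros p H1 H2. specialize (Hbd p (conj H1 H2)).
    assert (Hs : sqnorm p <= 2).
    { unfold sqdist, origin; simpl. nra. }
    pose proof (sqdist_triangle p origin z) as Ht. rewrite (sqdist_sym origin z) in Ht.
    assert (HF3 : F (sqdist p z) <= 3).
    { unfold F. rewrite <- (sqrt_Rsqr 3) by lra. apply sqrt_le_1_alt. unfold Rsqr. lra. }
    assert (HF0 : 0 <= F (sqdist p z)) by apply sqrt_pos.
    apply Rabs_le_between in Hbd. nra.
Qed.

(** Jensen's inequality from the tangent line of [exp] at [∬ f nu]. *)
Lemma jensen_exp (f nu : plane -> R) :
  cont f -> cont nu -> (forall p, 0 <= nu p) -> ∬ nu <= 1 ->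
  exp (∬ (fun p => f p * nu p)) <= 1 + ∬ (fun p => exp (f p) * nu p).
Proof.
  intros Hf Hnu H0 H1. set (a := ∬ (fun p => f p * nu p)).
  assert (C1 : cont (fun p => f p * nu p)) by now apply cont_mult.
  assert (C2 : cont (fun p => exp (f p) * nu p)).
  { apply cont_mult; [|exact Hnu]. intros p. now apply continuous_exp_comp'. }
  assert (Hle : ∬ (fun p => exp a * (f p * nu p) + exp a * (1 - a) * nu p) <=
                ∬ (fun p => exp (f p) * nu p)).
  { apply square_int_le; [|exact C2|].
    - intros p. apply continuous_Rplus; (apply continuous_Rmult; [apply continuous_const|]); auto.
    - intros p _ _. replace (f p) with (a + (f p - a)) at 2 by ring. rewrite exp_plus.
      pose proof (exp_ineq1_le (f p - a)). pose proof (exp_pos a). specialize (H0 p).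
      assert (exp a * (1 + (f p - a)) * nu p <= exp a * exp (f p - a) * nu p).
      { apply Rmult_le_compat_r; [exact H0|]. apply Rmult_le_compat_l; lra. }
      lra. }
  rewrite square_int_plus in Hle.
  2, 3: intros p; (apply continuous_Rmult; [apply continuous_const|]); auto.
  rewrite !square_int_scal in Hle by assumption. fold a in Hle.
  (* the missing mass [1 - ∬ nu] is placed where the exponent vanishes *)
  assert (Ha : exp a * (1 - a) <= 1).
  { pose proof (exp_ineq1_le (- a)). pose proof (exp_pos a).
    assert (exp a * exp (- a) = 1) by (rewrite <- exp_plus, Rplus_opp_r; apply exp_0). nra. }
  assert (Hn : 0 <= ∬ nu) by (apply square_int_ge0; auto).
  set (n := ∬ nu) in *. set (E := exp a * (1 - a)) in *.
  assert (E * (1 - n) <= 1 * (1 - n)) by (apply Rmult_le_compat_r; lra).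
  assert (exp a = exp a * a + E) by (unfold E; ring). lra.
Qed.

Lemma exp_le_compat a b : a <= b -> exp a <= exp b.
Proof. intros [H| ->]; [left; now apply exp_increasing | right; reflexivity]. Qed.

(** Exponentiating half of the logarithmic singularity leaves an integrable one. *)
Lemma exp_tgreen_kernel p y e q :
  0 < e -> 0 < q <= 1 ->
  exp (tgreen ((sqdist p y + e) / q) / 2) <= 1 + / sqrt (sqdist p y + e).
Proof.
  intros He Hq. pose proof (sqdist_ge0 p y).
  eapply Rle_trans; [apply exp_half_tgreen_le; apply Rdiv_lt_0_compat; lra|].
  apply Rplus_le_compat_l. apply Rinv_le_contravar; [apply sqrt_lt_R0; lra|].
  apply sqrt_le_1_alt. apply le_div_iff; [lra|]. nra.
Qed.

Lemma cont_tgreen y e q :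
  0 < e -> 0 < q -> cont (fun p => tgreen ((sqdist p y + e) / q)).
Proof.
  intros He Hq p. pose proof (sqdist_ge0 p y).
  assert (Hw : 0 < (sqdist p y + e) / q) by (apply Rdiv_lt_0_compat; lra).
  apply (continuous_comp_R (fun p => (sqdist p y + e) / q) tgreen).
  - apply continuous_Rdiv; [|apply continuous_const | lra].
    apply continuous_Rplus; [apply cont_sqdist | apply continuous_const].
  - apply (C2_on_continuous _ _ _ _ _ tgreen_C2 Hw).
Qed.

Lemma annular_weight_weaken s r r' theta :
  r <= r' -> annular_weight s r theta -> annular_weight s r' theta.
Proof.
  intros Hr (H1 & H2 & H3). split; [exact H1|]. split; [exact H2|]. intros p Hp. apply H3. lra.
Qed.

(** * Pointwise bounds *)

Definition near_weight (x y : plane) : R := cutoff (sqdist y x / (sqnorm x / 32)).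

Lemma near_weight_annular x :
  0 < sqnorm x -> annular_weight (sqnorm x / 4) (4 * sqnorm x) (near_weight x).
Proof. intros Hx. apply annular_cutoff. lra. Qed.

Lemma near_weight_0 x y : 0 < sqnorm x -> sqnorm x / 32 <= sqdist y x -> near_weight x y = 0.
Proof. intros Hx H. apply cutoff_0, le_div_iff; lra. Qed.

Lemma near_weight_1 x y : 0 < sqnorm x -> sqdist y x <= sqnorm x / 64 -> near_weight x y = 1.
Proof. intros Hx H. apply cutoff_1, div_le_iff; lra. Qed.

Lemma near_weight_le_disc_weight x y :
  0 < sqnorm x <= 1 / 20 -> near_weight x y <= disc_weight y.
Proof.
  intros Hx. destruct (Rle_dec (sqnorm x / 32) (sqdist y x)) as [H|H].
  - rewrite near_weight_0 by lra. apply disc_weight_bounds.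
  - pose proof (sqnorm_near x y ltac:(lra)). rewrite disc_weight_1 by lra. apply cutoff_bounds.
Qed.

Lemma cont_comp_fst (f : plane -> R) : cont f -> cont (fun w : plane * plane => f (fst w)).
Proof. intros Hf w. apply (continuous_comp (fun w : plane * plane => fst w) f); [solve_cont | apply Hf]. Qed.

Lemma cont_comp_snd (f : plane -> R) : cont f -> cont (fun w : plane * plane => f (snd w)).
Proof. intros Hf w. apply (continuous_comp (fun w : plane * plane => snd w) f); [solve_cont | apply Hf]. Qed.

(** The Brezis-Merle argument: when the mass is at most [1 / (4 p)], Jensen's
    inequality bounds [exp (p u)] by an average of the kernels [1 / |y - z|] over
    the mass, and Fubini's theorem integrates these first. The bound is a power
    of [1 / |x|]. *)
Lemma exponential_integrability A u h p :
  0 < A <= 1 -> positive_superharmonic A u h -> 0 < p ->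
  exists C r, 0 < C /\ 0 < r /\ 4 * r < A /\ (forall X, 0 < X < r -> 1 <= - ln X) /\
  forall x, 0 < sqnorm x < r ->
    ∬ (fun y => near_weight x y * exp (p * u y)) <= exp (C * - ln (sqnorm x)).
Proof.
  intros HA Hu Hp. destruct (pointwise_bound A u h HA Hu) as (Cu & r0 & HCu & Hr0 & Hr0A & HL & Hpt).
  destruct (mass_vanishing A u h (/ (4 * p)) HA Hu) as (r1 & Hr1 & Hmass).
  { apply Rinv_0_lt_compat; lra. }
  destruct kernel_integral_bound as (Ck & HCk & Hker).
  set (r := Rmin r0 (Rmin (r1 / 4) (1 / 20))).
  assert (Hr : 0 < r) by (unfold r; repeat apply Rmin_pos; lra).
  assert (Hra : r <= r0) by apply Rmin_l.
  assert (Hrb : r <= r1 / 4) by (eapply Rle_trans; [apply Rmin_r | apply Rmin_l]).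
  assert (Hrc : r <= 1 / 20) by (eapply Rle_trans; [apply Rmin_r | apply Rmin_r]).
  exists (p * Cu + (8 + Ck)), r. split; [nra|]. split; [exact Hr|]. split; [lra|].
  split; [intros X HX; apply HL; lra|].
  intros x Hx. destruct (Hpt x ltac:(lra)) as (e & He & Hy). 
  assert (HL1 : 1 <= - ln (sqnorm x)) by (apply HL; lra).
  set (X := sqnorm x) in *. set (L := - ln X) in *. set (q := X / 64) in *.
  (* [theta] is 1 on the disc of squared radius [6 q], which contains the
     supports of the Green functions centred at [y] whenever [|y - x|^2 <= 2 q] *)
  set (theta := fun z => cutoff (sqdist z x / (12 * q))).
  assert (Htheta : annular_weight (X / 4) r1 theta).
  { apply annular_weight_weaken with (4 * X); [lra|]. apply annular_cutoff. fold X. unfold q; lra. }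
  destruct (annular_weight_cont A u h _ _ _ Hu (ltac:(lra) : 0 < X / 4) (ltac:(lra) : r1 < A) Htheta)
    as (Cth & _ & Nth & _).
  pose proof (Hmass (X / 4) theta ltac:(lra) Htheta) as Hm.
  set (nu := fun z => 4 * p * (theta z * h z)).
  assert (Cnu : cont nu) by (intros z; apply continuous_Rmult; [apply continuous_const | apply Cth]).
  assert (Nnu : forall z, 0 <= nu z) by (intros z; apply Rmult_le_pos; [lra | apply Nth]).
  assert (Mnu : ∬ nu <= 1).
  { unfold nu. rewrite square_int_scal by exact Cth.
    apply (Rmult_le_compat_l (4 * p)) in Hm; [|lra]. rewrite Rinv_r in Hm; lra. }
  destruct (annular_weight_cont A u h _ _ _ Hu (ltac:(lra) : 0 < X / 4) (ltac:(lra) : 4 * X < A)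
    (near_weight_annular x ltac:(fold X; lra))) as (_ & Cu0 & _ & _).
  set (G := fun w : plane * plane => disc_weight (fst w) *
     ((1 + / sqrt (sqdist (fst w) (snd w) + e)) * nu (snd w))).
  assert (CG : cont G).
  { intros w. apply continuous_Rmult; [apply (cont_comp_fst _ disc_weight_cont)|].
    apply continuous_Rmult; [|apply (cont_comp_snd _ Cnu)].
    apply continuous_Rplus; [apply continuous_const | apply cont_kernel; lra]. }
  assert (Hpoint : forall y, near_weight x y * exp (p * u y) <=
    exp (p * Cu * L) * (disc_weight y + ∬ (fun z => G (y, z)))).
  { intros y.
    assert (HG0 : 0 <= ∬ (fun z => G (y, z))).
    { apply square_int_ge0; [apply cont_slice_r, CG|]. intros z _ _. unfold G; simpl.
      apply Rmult_le_pos; [apply disc_weight_bounds|]. apply Rmult_le_pos; [|apply Nnu].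
      pose proof (sqdist_ge0 y z).
      assert (0 < / sqrt (sqdist y z + e)) by (apply Rinv_0_lt_compat, sqrt_lt_R0; lra). lra. }
    pose proof (disc_weight_bounds y) as Hd. pose proof (exp_pos (p * Cu * L)) as Hex.
    destruct (Rle_dec (X / 32) (sqdist y x)) as [Hfar|Hfar].
    { rewrite near_weight_0 by (fold X; lra). rewrite Rmult_0_l. apply Rmult_le_pos; lra. }
    specialize (Hy y ltac:(lra)).
    pose proof (sqnorm_near x y ltac:(fold X; lra)) as Ny. fold X in Ny.
    rewrite disc_weight_1 by lra.
    set (f := fun z => tgreen ((sqdist z y + e) / q) / 2).
    assert (Cf : cont f).
    { intros z. apply continuous_Rmult; [|apply continuous_const].
      apply cont_tgreen; unfold q; lra. }
    assert (Epot : p * (2 * ∬ (fun z => tgreen ((sqdist z y + e) / q) * h z)) = ∬ (fun z => f z * nu z)).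
    { rewrite <- Rmult_assoc, <- square_int_scal.
      - apply square_int_ext. intros z. unfold f, nu.
        destruct (Rle_dec q (sqdist z y)) as [Hz|Hz].
        + rewrite tgreen_0; [field|]. apply le_div_iff; unfold q in *; lra.
        + pose proof (sqdist_triangle z y x).
          replace (theta z) with 1; [field|]. symmetry. apply cutoff_1, div_le_iff; unfold q in *; lra.
      - apply (cont_supported (punctured_disc A)).
        + apply cont_tgreen; unfold q; lra.
        + apply (supported_ball _ y q).
          * intros z Hz. pose proof (sqdist_triangle z y x).
            pose proof (sqnorm_near x z ltac:(fold X; unfold q in Hz; lra)) as Nz. fold X in Nz. split; lra.
          * intros z Hz. apply tgreen_0, le_div_iff; unfold q in *; lra.
        + intros z Hz. now apply (superharmonic_continuous A u h). }
    assert (Hexp : exp (p * u y) <= exp (p * Cu * L) * (1 + ∬ (fun z => exp (f z) * nu z))).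
    { eapply Rle_trans; [|apply Rmult_le_compat_l; [lra | apply jensen_exp; assumption]].
      rewrite <- exp_plus. apply exp_le_compat. rewrite <- Epot.
      apply (Rmult_le_compat_l p) in Hy; [|lra]. lra. }
    assert (Hker2 : ∬ (fun z => exp (f z) * nu z) <= ∬ (fun z => G (y, z))).
    { apply square_int_le.
      - apply cont_mult; [|exact Cnu]. intros z. apply continuous_exp_comp', Cf.
      - apply cont_slice_r, CG.
      - intros z _ _. unfold G; simpl. rewrite disc_weight_1, Rmult_1_l by lra.
        apply Rmult_le_compat_r; [apply Nnu|]. rewrite (sqdist_sym y z).
        apply exp_tgreen_kernel; unfold q; lra. }
    pose proof (cutoff_bounds (sqdist y x / (X / 32))) as Hc. fold X in Hc.
    change (near_weight x y) with (cutoff (sqdist y x / (X / 32))).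
    pose proof (exp_pos (p * u y)).
    apply Rle_trans with (1 * exp (p * u y)); [apply Rmult_le_compat_r; lra|].
    rewrite Rmult_1_l. eapply Rle_trans; [exact Hexp|]. apply Rmult_le_compat_l; lra. }
  assert (CGi : cont (fun y => ∬ (fun z => G (y, z)))) by now apply cont_square_int.
  assert (Hdouble : ∬ (fun y => ∬ (fun z => G (y, z))) <= 4 + Ck).
  { rewrite square_int_swap by exact CG.
    apply Rle_trans with (∬ (fun z => (4 + Ck) * nu z)).
    - apply square_int_le.
      + apply (cont_square_int (fun w : plane * plane => G (snd w, fst w))).
        now apply cont_swap.
      + intros z. apply continuous_Rmult; [apply continuous_const | apply Cnu].
      + intros z Hz1 Hz2.
        assert (Ck1 : cont (fun y => disc_weight y * / sqrt (sqdist y z + e))).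
        { apply cont_mult; [apply disc_weight_cont|].
          apply (cont_slice_l (fun w : plane * plane => / sqrt (sqdist (fst w) (snd w) + e)) z).
          apply cont_kernel; lra. }
        rewrite (square_int_ext _ (fun y => nu z *
           (disc_weight y + disc_weight y * / sqrt (sqdist y z + e)))) by (intros y; unfold G; simpl; ring).
        rewrite square_int_scal by (apply cont_plus; [apply disc_weight_cont | exact Ck1]).
        rewrite square_int_plus by (try apply disc_weight_cont; exact Ck1).
        rewrite Rmult_comm. apply Rmult_le_compat_r; [apply Nnu|]. apply Rplus_le_compat.
        * replace 4 with (4 * 1) by ring. rewrite <- square_int_const.
          apply square_int_le; [apply disc_weight_cont | apply cont_const | intros; apply disc_weight_bounds].
        * apply Hker; [lra|]. unfold sqdist, origin; simpl. nra.
    - rewrite square_int_scal by exact Cnu. nra. }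
  apply Rle_trans with (∬ (fun y => exp (p * Cu * L) * (disc_weight y + ∬ (fun z => G (y, z))))).
  { apply square_int_le.
    - apply (cont_supported (punctured_disc A)).
      + apply cont_cutoff; fold X; lra.
      + apply (supported_annulus A (X / 4) (4 * X)); [lra | lra |].
        apply (near_weight_annular x); fold X; lra.
      + intros y Hyy. apply continuous_exp_comp'. apply continuous_Rmult; [apply continuous_const|].
        now apply (superharmonic_continuous A u h).
    - intros y. apply continuous_Rmult; [apply continuous_const|].
      apply continuous_Rplus; [apply disc_weight_cont | apply CGi].
    - intros y _ _. apply Hpoint. }
  rewrite square_int_scal by (apply cont_plus; [apply disc_weight_cont | exact CGi]).
  rewrite square_int_plus by (try apply disc_weight_cont; exact CGi).
  assert (Hdw : ∬ disc_weight <= 4).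
  { replace 4 with (4 * 1) by ring. rewrite <- square_int_const.
    apply square_int_le; [apply disc_weight_cont | apply cont_const | intros; apply disc_weight_bounds]. }
  (* the constant is absorbed in the exponent, as [L >= 1] *)
  rewrite Rmult_plus_distr_r, exp_plus. apply Rmult_le_compat_l; [left; apply exp_pos|].
  apply Rle_trans with (8 + Ck); [lra|].
  apply Rle_trans with (1 + (8 + Ck) * L); [nra | apply exp_ineq1_le].
Qed.

(** With [P] the Green kernel, [P <= kappa + 4 exp ((P - kappa) / 4)]. The first
    term sees only the mass of [h]; in the second, a bound [B] for [h] may be as
    large as [exp (kappa / 8)], because [exp (P / 2)] is still integrable. *)
Lemma value_bound A v h :
  0 < A <= 1 -> positive_superharmonic A v h ->
  exists C r, 0 < C /\ 0 < r /\ 4 * r < A /\ (forall X, 0 < X < r -> 1 <= - ln X) /\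
  forall x kappa B, 0 < sqnorm x < r -> 0 <= kappa ->
    cont (fun y => near_weight x y * B y ^ 2) ->
    (forall y, sqdist y x <= sqnorm x / 32 -> h y <= B y) ->
    v x <= C * - ln (sqnorm x) + 2 * kappa * ∬ (fun y => near_weight x y * h y) +
      4 * exp (- kappa / 4) * (C + ∬ (fun y => near_weight x y * B y ^ 2)).
Proof.
  intros HA Hv. destruct (pointwise_bound A v h HA Hv) as (Cv & r0 & HCv & Hr0 & Hr0A & HL & Hpt).
  destruct kernel_integral_bound as (Ck & HCk & Hker).
  set (r := Rmin r0 (1 / 20)).
  assert (Hr : 0 < r) by (unfold r; apply Rmin_pos; lra).
  assert (Hra : r <= r0) by apply Rmin_l.
  assert (Hrc : r <= 1 / 20) by apply Rmin_r.
  exists (Cv + 4 + Ck), r. split; [lra|]. split; [exact Hr|]. split; [lra|].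
  split; [intros X HX; apply HL; lra|].
  intros x kappa B Hx Hkappa CB HB. destruct (Hpt x ltac:(lra)) as (e & He & Hy).
  assert (HL1 : 1 <= - ln (sqnorm x)) by (apply HL; lra).
  specialize (Hy x). 
  assert (Hxx : sqdist x x = 0) by (unfold sqdist; ring).
  specialize (Hy ltac:(lra)).
  set (X := sqnorm x) in *. set (L := - ln X) in *. set (q := X / 64) in *.
  set (P := fun y => tgreen ((sqdist y x + e) / q)) in *.
  assert (CP : cont P) by (apply cont_tgreen; unfold q; lra).
  pose proof (near_weight_annular x ltac:(fold X; lra)) as Hw. fold X in Hw.
  destruct (annular_weight_cont A v h _ _ _ Hv (ltac:(lra) : 0 < X / 4) (ltac:(lra) : 4 * X < A) Hw)
    as (Ch & _ & Nh & _).
  destruct Hw as (Cw & Bw & Zw).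
  assert (CPh : cont (fun y => P y * h y)).
  { apply (cont_supported (punctured_disc A)); [exact CP | |].
    - apply (supported_ball _ x q).
      + intros z Hz. pose proof (sqnorm_near x z ltac:(fold X; unfold q in Hz; lra)) as Nz.
        fold X in Nz. split; lra.
      + intros z Hz. apply tgreen_0, le_div_iff; unfold q in *; lra.
    - intros z Hz. now apply (superharmonic_continuous A v h). }
  assert (CwP : cont (fun y => near_weight x y * exp (P y / 2))).
  { apply cont_mult; [exact Cw|]. intros y. apply continuous_exp_comp'.
    apply continuous_Rmult; [apply CP | apply continuous_const]. }
  set (ek := exp (- kappa / 4)) in *. assert (Hek : 0 < ek) by apply exp_pos.
  assert (Hpt2 : ∬ (fun y => P y * h y) <= ∬ (fun y => kappa * (near_weight x y * h y) +
     2 * ek * (near_weight x y * exp (P y / 2) + near_weight x y * B y ^ 2))).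
  { apply square_int_le; [exact CPh | |].
    - intros y. apply continuous_Rplus; (apply continuous_Rmult; [apply continuous_const|]); [apply Ch|].
      apply continuous_Rplus; [apply CwP | apply CB].
    - intros y _ _. destruct (Rle_dec q (sqdist y x)) as [Hfar|Hfar].
      { replace (P y) with 0 at 1 by (symmetry; apply tgreen_0, le_div_iff; unfold q in *; lra).
        specialize (Bw y). specialize (Nh y). pose proof (exp_pos (P y / 2)).
        rewrite Rmult_0_l. apply Rplus_le_le_0_compat; [now apply Rmult_le_pos|].
        apply Rmult_le_pos; [lra|]. apply Rplus_le_le_0_compat; (apply Rmult_le_pos; [lra|]);
          [lra | apply pow2_ge_0]. }
      pose proof (sqnorm_near x y ltac:(fold X; unfold q in *; lra)) as Ny. fold X in Ny.
      assert (Hh : 0 <= h y) by (apply Hv; split; lra).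
      specialize (HB y ltac:(unfold q in *; lra)).
      assert (HP : P y <= kappa + 4 * (ek * exp (P y / 4))).
      { unfold ek. rewrite <- exp_plus. pose proof (exp_ineq1_le (- kappa / 4 + P y / 4)). lra. }
      rewrite near_weight_1 by (fold X; unfold q in *; lra). rewrite !Rmult_1_l.
      set (E4 := exp (P y / 4)) in *.
      replace (exp (P y / 2)) with (E4 * E4) by (unfold E4; rewrite <- exp_plus; f_equal; field).
      assert (HE4 : 0 < E4) by apply exp_pos.
      apply Rle_trans with ((kappa + 4 * (ek * E4)) * h y); [now apply Rmult_le_compat_r|].
      assert (ek * (2 * (E4 * h y)) <= ek * (E4 * E4 + B y ^ 2)).
      { apply Rmult_le_compat_l; [lra|].
        assert (E4 * h y <= E4 * B y) by (apply Rmult_le_compat_l; lra).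
        pose proof (pow2_ge_0 (E4 - B y)). nra. }
      lra. }
  rewrite square_int_plus in Hpt2.
  2:{ intros y. apply continuous_Rmult; [apply continuous_const | apply Ch]. }
  2:{ intros y. apply continuous_Rmult; [apply continuous_const|].
      apply continuous_Rplus; [apply CwP | apply CB]. }
  rewrite square_int_scal in Hpt2 by exact Ch.
  rewrite square_int_scal in Hpt2 by (apply cont_plus; assumption).
  rewrite square_int_plus in Hpt2 by assumption.
  assert (HwP : ∬ (fun y => near_weight x y * exp (P y / 2)) <= 4 + Ck).
  { assert (Ck1 : cont (fun y => disc_weight y * / sqrt (sqdist y x + e))).
    { apply cont_mult; [apply disc_weight_cont|].
      apply (cont_slice_l (fun w : plane * plane => / sqrt (sqdist (fst w) (snd w) + e)) x).
      apply cont_kernel; lra. }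
    apply Rle_trans with (∬ (fun y => disc_weight y + disc_weight y * / sqrt (sqdist y x + e))).
    - apply square_int_le; [exact CwP | apply cont_plus; [apply disc_weight_cont | exact Ck1]|].
      intros y _ _. pose proof (near_weight_le_disc_weight x y ltac:(fold X; lra)) as H1.
      pose proof (exp_tgreen_kernel y x e q ltac:(lra) ltac:(unfold q; lra)) as H2.
      fold (P y) in H2. pose proof (exp_pos (P y / 2)). specialize (Bw y).
      replace (disc_weight y + disc_weight y * / sqrt (sqdist y x + e)) with
        (disc_weight y * (1 + / sqrt (sqdist y x + e))) by ring.
      apply Rmult_le_compat; lra.
    - rewrite square_int_plus by (try apply disc_weight_cont; exact Ck1).
      apply Rplus_le_compat.
      + replace 4 with (4 * 1) by ring. rewrite <- square_int_const.
        apply square_int_le; [apply disc_weight_cont | apply cont_const | intros; apply disc_weight_bounds].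
      + apply Hker; [lra|]. fold X. lra. }
  set (I1 := ∬ (fun y => near_weight x y * h y)) in *.
  set (I2 := ∬ (fun y => near_weight x y * B y ^ 2)) in *.
  set (I3 := ∬ (fun y => near_weight x y * exp (P y / 2))) in *.
  set (I4 := ∬ (fun y => P y * h y)) in *.
  assert (ek * I3 <= ek * (Cv + 4 + Ck)) by (apply Rmult_le_compat_l; lra).
  assert (Cv * L <= (Cv + 4 + Ck) * L) by (apply Rmult_le_compat_r; lra).
  change (v x <= Cv * L + 2 * I4) in Hy. lra.
Qed.

(** * The two growth bounds *)

(** The lower bound [c] keeps the argument away from 0, where [g] is uncontrolled. *)
Lemma growth_bound (g phi : R -> R) c :
  pos_continuous g -> 0 < c -> (forall t, 0 < t -> 0 <= phi t) ->
  is_bigO (Rbar_locally p_infty) (fun t => log_plus (g t)) phi ->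
  exists C, 0 < C /\ forall t, c <= t -> g t <= exp (C * (1 + phi t)).
Proof.
  intros [Hpos Hcont] Hc Hphi (C0 & M & HM).
  set (T := Rmax c (M + 1)). pose proof (Rmax_l c (M + 1)). pose proof (Rmax_r c (M + 1)).
  destruct (continuity_ab_maj g c T) as (m & Hm & Hmc); [exact H | |].
  { intros t Ht. apply continuity_pt_filterlim.
    apply (continuous_continuous_on (fun t => 0 < t) g t); [|exact Hcont].
    apply locally_gt; lra. }
  assert (HG : 0 < g m) by (apply Hpos; lra).
  exists (Rabs C0 + g m). pose proof (Rabs_pos C0). split; [lra|]. intros t Ht.
  assert (Hpt : 0 <= phi t) by (apply Hphi; lra).
  destruct (Rle_dec t T) as [Htt|Htt].
  - apply Rle_trans with (g m); [apply Hm; lra|].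
    apply Rle_trans with (exp (g m)); [pose proof (exp_ineq1_le (g m)); lra|].
    apply exp_le_compat. nra.
  - assert (HMt : M < t) by (unfold T in *; lra). specialize (HM t HMt).
    apply Rle_trans with (exp (log_plus (g t))).
    + unfold log_plus. destruct (Rlt_dec 1 (g t)).
      * rewrite exp_ln by lra. lra.
      * rewrite exp_0. lra.
    + apply exp_le_compat. rewrite (Rabs_pos_eq (phi t)) in HM by exact Hpt.
      pose proof (Rle_abs (log_plus (g t))). pose proof (Rle_abs C0).
      assert (C0 * phi t <= Rabs C0 * phi t) by now apply Rmult_le_compat_r.
      assert (0 <= g m * (1 + phi t)) by (apply Rmult_le_pos; lra). lra.
Qed.

(** [- Delta v <= exp (k (1 + u))], and the square of the right-hand side has
    integral at most a power of [1 / |x|]; [kappa] is the multiple of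
    [log (1 / |x|)] that beats this power. *)
Lemma logarithmic_bound A u v hu hv g :
  0 < A <= 1 -> positive_superharmonic A u hu -> positive_superharmonic A v hv ->
  pos_continuous g ->
  is_bigO (Rbar_locally p_infty) (fun t => log_plus (g t)) (fun t => t) ->
  (forall p, punctured_disc A p -> hv p <= g (u p)) ->
  exists C r, 0 < C /\ 0 < r /\ 4 * r < A /\ (forall X, 0 < X < r -> 1 <= - ln X) /\
  forall x, 0 < sqnorm x < r -> v x <= C * - ln (sqnorm x).
Proof.
  intros HA Hu Hv Hg Hgexp Hhv.
  destruct (superharmonic_lower_bound A u hu (A / 2)) as (c & Hc & Hlow); [lra | lra | exact Hu|].
  destruct (growth_bound g (fun t => t) c Hg Hc ltac:(intros; lra) Hgexp) as (k & Hk & Hgk).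
  destruct (exponential_integrability A u hu (2 * k) HA Hu ltac:(lra))
    as (Ce & r1 & HCe & Hr1 & Hr1A & HL1 & Hint).
  destruct (value_bound A v hv HA Hv) as (Cv & r2 & HCv & Hr2 & Hr2A & HL2 & Hval).
  destruct (mass_bounded A v hv HA Hv) as (Cm & HCm & Hmass).
  set (r := Rmin r1 (Rmin r2 (A / 32))).
  assert (Hr : 0 < r) by (unfold r; repeat apply Rmin_pos; lra).
  assert (Hra : r <= r1) by apply Rmin_l.
  assert (Hrb : r <= r2) by (eapply Rle_trans; [apply Rmin_r | apply Rmin_l]).
  assert (Hrc : r <= A / 32) by (eapply Rle_trans; [apply Rmin_r | apply Rmin_r]).
  pose proof (exp_pos (2 * k)) as Hek.
  exists (Cv + 8 * Ce * Cm + 4 * (Cv + exp (2 * k))), r.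
  split; [nra|]. split; [exact Hr|]. split; [lra|]. split; [intros X HX; apply HL1; lra|].
  intros x Hx. assert (HL : 1 <= - ln (sqnorm x)) by (apply HL1; lra).
  specialize (Hint x ltac:(lra)). set (X := sqnorm x) in *. set (L := - ln X) in *.
  pose proof (near_weight_annular x ltac:(fold X; lra)) as Hw. fold X in Hw.
  destruct (annular_weight_cont A v hv _ _ _ Hv (ltac:(lra) : 0 < X / 4) (ltac:(lra) : 4 * X < A) Hw)
    as (Ch & _ & Nh & _).
  assert (Hm : ∬ (fun y => near_weight x y * hv y) <= Cm).
  { apply (Hmass (X / 4)); [lra|]. apply annular_weight_weaken with (4 * X); [lra | exact Hw]. }
  assert (Hm0 : 0 <= ∬ (fun y => near_weight x y * hv y)) by (apply square_int_ge0; auto).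
  assert (Hsup : supported (punctured_disc A) (near_weight x)).
  { apply (supported_annulus A (X / 4) (4 * X)); [lra | lra | apply Hw]. }
  assert (CE : cont (fun y => near_weight x y * exp (2 * k * u y))).
  { apply (cont_supported (punctured_disc A)); [apply Hw | exact Hsup |].
    intros y Hy. apply continuous_exp_comp'. apply continuous_Rmult; [apply continuous_const|].
    now apply (superharmonic_continuous A u hu). }
  set (B := fun y => exp (k * (1 + u y))).
  assert (EB : forall y, exp (2 * k) * (near_weight x y * exp (2 * k * u y)) = near_weight x y * B y ^ 2).
  { intros y. unfold B. simpl. rewrite Rmult_1_r, <- exp_plus.
    replace (k * (1 + u y) + k * (1 + u y)) with (2 * k + 2 * k * u y) by ring.
    rewrite exp_plus. ring. }
  assert (CB : cont (fun y => near_weight x y * B y ^ 2)).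
  { intros y. apply (continuous_ext _ _ y EB). apply continuous_Rmult; [apply continuous_const | apply CE]. }
  assert (HCL : 0 <= Ce * L) by (apply Rmult_le_pos; lra).
  specialize (Hval x (4 * Ce * L) B ltac:(fold X; lra) ltac:(lra) CB). fold X in Hval. fold L in Hval.
  rewrite <- (square_int_ext _ _ EB), square_int_scal in Hval by exact CE.
  assert (HB : forall y, sqdist y x <= X / 32 -> hv y <= B y).
  { intros y Hy. pose proof (sqnorm_near x y ltac:(fold X; lra)) as Ny. fold X in Ny.
    eapply Rle_trans; [apply Hhv; split; lra|]. apply Hgk, Hlow. lra. }
  specialize (Hval HB).
  replace (- (4 * Ce * L) / 4) with (- (Ce * L)) in Hval by field.
  set (I1 := ∬ (fun y => near_weight x y * hv y)) in *.
  set (I2 := ∬ (fun y => near_weight x y * exp (2 * k * u y))) in *.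
  assert (Hs : 0 < exp (- (Ce * L)) <= 1).
  { split; [apply exp_pos|]. rewrite <- exp_0. apply exp_le_compat; lra. }
  assert (HI2 : exp (- (Ce * L)) * I2 <= 1).
  { apply Rle_trans with (exp (- (Ce * L)) * exp (Ce * L)); [apply Rmult_le_compat_l; lra|].
    rewrite <- exp_plus, Rplus_opp_l, exp_0. lra. }
  assert (T1 : exp (- (Ce * L)) * Cv <= Cv) by nra.
  assert (T2 : exp (2 * k) * (exp (- (Ce * L)) * I2) <= exp (2 * k)) by nra.
  assert (T3 : Ce * L * I1 <= Ce * L * Cm) by (apply Rmult_le_compat_l; lra).
  assert (T4 : Cv + exp (2 * k) <= (Cv + exp (2 * k)) * L) by nra.
  lra.
Qed.

Lemma Rpower_nonneg x y : 0 <= Rpower x y.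
Proof. left; apply exp_pos. Qed.

Lemma linear_le_Rpower lambda K eps :
  1 < lambda -> 0 < eps -> exists L0, 1 <= L0 /\ forall L, L0 <= L -> K * L <= eps * Rpower L lambda.
Proof.
  intros Hl He. set (M := Rmax 1 (K / eps)).
  assert (HM : 1 <= M) by apply Rmax_l. assert (HMK : K / eps <= M) by apply Rmax_r.
  assert (Hinv : 0 < / (lambda - 1)) by (apply Rinv_0_lt_compat; lra).
  exists (Rpower M (/ (lambda - 1))). split.
  - apply Rle_trans with (Rpower M 0); [rewrite Rpower_O; lra | apply Rle_Rpower; lra].
  - intros L HL. assert (HL0 : 0 < L) by (eapply Rlt_le_trans; [apply exp_pos | exact HL]).
    replace lambda with ((lambda - 1) + 1) by ring. rewrite Rpower_plus, Rpower_1 by exact HL0.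
    assert (HML : M <= Rpower L (lambda - 1)).
    { apply Rle_trans with (Rpower (Rpower M (/ (lambda - 1))) (lambda - 1)).
      - rewrite Rpower_mult, Rinv_l, Rpower_1 by lra. lra.
      - apply Rle_Rpower_l; [lra|]. split; [apply exp_pos | exact HL]. }
    rewrite <- Rmult_assoc. apply Rmult_le_compat_r; [lra|].
    apply (proj1 (div_le_iff K eps _ He)) in HMK. nra.
Qed.

(** Near [x], [- Delta u] is at most [exp (D L ^ lambda)] with [L = - ln |x|^2]. Taking
    [kappa] of order [L ^ lambda] absorbs this, and the factor of [kappa] is the
    mass near the origin, which tends to 0: hence the little-o. *)
Lemma power_bound A u v hu f lambda C r :
  0 < A <= 1 -> positive_superharmonic A u hu ->
  (forall p, punctured_disc A p -> 0 < v p) ->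
  (exists c, 0 < c /\ forall p, 0 < sqnorm p <= A / 2 -> c <= v p) ->
  0 < C -> 0 < r -> 4 * r < A -> 
  (forall x, 0 < sqnorm x < r -> v x <= C * - ln (sqnorm x)) ->
  1 < lambda -> pos_continuous f ->
  is_bigO (Rbar_locally p_infty) (fun t => log_plus (f t)) (fun t => Rpower t lambda) ->
  (forall p, punctured_disc A p -> hu p <= f (v p)) ->
  forall eps, 0 < eps -> exists r', 0 < r' /\ forall x, 0 < sqnorm x < r' ->
    0 < u x <= eps * Rpower (- ln (sqnorm x)) lambda.
Proof.
  intros HA Hu Hv (c & Hc & Hlow) HC Hr HrA Hvb Hl Hf Hfexp Hhu eps Heps.
  destruct (growth_bound f (fun t => Rpower t lambda) c Hf Hc (fun t _ => Rpower_nonneg t lambda) Hfexp)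
    as (k & Hk & Hfk).
  destruct (value_bound A u hu HA Hu) as (Cu & r2 & HCu & Hr2 & Hr2A & HL2 & Hval).
  set (D := k * (1 + Rpower (3 * C) lambda)).
  pose proof (Rpower_nonneg (3 * C) lambda) as HP0.
  assert (HD : 0 < D) by (apply Rmult_lt_0_compat; lra).
  set (dm := eps / (32 * D)).
  assert (Hdm : 0 < dm) by (apply Rdiv_lt_0_compat; lra).
  destruct (mass_vanishing A u hu dm HA Hu Hdm) as (r3 & Hr3 & Hmass).
  destruct (linear_le_Rpower lambda (Cu + 4 * (Cu + 4)) (eps / 2) Hl ltac:(lra)) as (L0 & HL0 & Hlin).
  set (r' := Rmin (Rmin (r / 4) r2) (Rmin (r3 / 4) (exp (- L0)))).
  assert (Hr' : 0 < r') by (unfold r'; repeat apply Rmin_pos; try apply exp_pos; lra).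
  assert (Hra : r' <= r / 4) by (eapply Rle_trans; [apply Rmin_l | apply Rmin_l]).
  assert (Hrb : r' <= r2) by (eapply Rle_trans; [apply Rmin_l | apply Rmin_r]).
  assert (Hrc : r' <= r3 / 4) by (eapply Rle_trans; [apply Rmin_r | apply Rmin_l]).
  assert (Hrd : r' <= exp (- L0)) by (eapply Rle_trans; [apply Rmin_r | apply Rmin_r]).
  exists r'. split; [exact Hr'|]. intros x Hx.
  assert (HL : L0 <= - ln (sqnorm x)).
  { assert (ln (sqnorm x) <= ln (exp (- L0))) by (apply ln_le; lra). rewrite ln_exp in H. lra. }
  split; [apply Hu; split; lra|].
  set (X := sqnorm x) in *. set (L := - ln X) in *. specialize (Hlin L HL).
  set (Lp := Rpower L lambda) in *.
  assert (HLp : 1 <= Lp).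
  { apply Rle_trans with (Rpower L 0); [rewrite Rpower_O; lra | apply Rle_Rpower; lra]. }
  pose proof (near_weight_annular x ltac:(fold X; lra)) as Hw. fold X in Hw.
  destruct (annular_weight_cont A u hu _ _ _ Hu (ltac:(lra) : 0 < X / 4) (ltac:(lra) : 4 * X < A) Hw)
    as (Ch & _ & Nh & _).
  assert (Hm : ∬ (fun y => near_weight x y * hu y) <= dm).
  { apply (Hmass (X / 4)); [lra|]. apply annular_weight_weaken with (4 * X); [lra | exact Hw]. }
  assert (CB : cont (fun y => near_weight x y * exp (D * Lp) ^ 2)).
  { apply cont_mult; [apply Hw | apply cont_const]. }
  assert (HDL : 0 < D * Lp) by (apply Rmult_lt_0_compat; lra).
  specialize (Hval x (8 * (D * Lp)) (fun _ => exp (D * Lp)) ltac:(fold X; lra) ltac:(lra) CB).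
  fold X in Hval. fold L in Hval.
  assert (HB : forall y, sqdist y x <= X / 32 -> hu y <= exp (D * Lp)).
  { intros y Hy. pose proof (sqnorm_near x y ltac:(fold X; lra)) as Ny. fold X in Ny.
    eapply Rle_trans; [apply Hhu; split; lra|].
    eapply Rle_trans; [apply Hfk, Hlow; lra|]. apply exp_le_compat.
    assert (Hvy : v y <= 3 * C * L).
    { eapply Rle_trans; [apply Hvb; lra|].
      assert (ln (X / 4) <= ln (sqnorm y)) by (apply ln_le; lra).
      rewrite ln_div in H by lra.
      assert (ln 4 <= 2).
      { replace 4 with (2 * 2) by ring. rewrite ln_mult by lra.
        assert (ln 2 < 1); [|lra]. rewrite <- (ln_exp 1). apply ln_increasing; [lra|].
        pose proof (exp_ineq1 1). lra. }
      unfold L in *. assert (- ln (sqnorm y) <= 3 * - ln X) by lra. 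
      apply (Rmult_le_compat_l C) in H1; lra. }
    assert (Hvp : Rpower (v y) lambda <= Rpower (3 * C) lambda * Lp).
    { unfold Lp. rewrite Rpower_mult_distr by lra. apply Rle_Rpower_l; [lra|].
      split; [apply Hv; split; lra | exact Hvy]. }
    unfold D. 
    assert (k * Rpower (v y) lambda <= k * (Rpower (3 * C) lambda * Lp)) by (apply Rmult_le_compat_l; lra).
    assert (k * 1 <= k * Lp) by (apply Rmult_le_compat_l; lra). lra. }
  specialize (Hval HB). cbv beta in Hval.
  replace (- (8 * (D * Lp)) / 4) with (- (2 * (D * Lp))) in Hval by field.
  assert (HI2 : ∬ (fun y => near_weight x y * exp (D * Lp) ^ 2) <= 4 * exp (D * Lp) ^ 2).
  { rewrite <- square_int_const. apply square_int_le; [exact CB | apply cont_const|].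
    intros y _ _. rewrite <- (Rmult_1_l (exp (D * Lp) ^ 2)) at 2.
    apply Rmult_le_compat_r; [apply pow2_ge_0 | apply Hw]. }
  set (I1 := ∬ (fun y => near_weight x y * hu y)) in *.
  set (I2 := ∬ (fun y => near_weight x y * exp (D * Lp) ^ 2)) in *.
  set (s := exp (- (2 * (D * Lp)))) in *.
  assert (Hs : 0 < s <= 1).
  { split; [apply exp_pos|]. unfold s. rewrite <- exp_0. apply exp_le_compat; lra. }
  assert (HsI : s * I2 <= 4).
  { apply Rle_trans with (s * (4 * exp (D * Lp) ^ 2)); [apply Rmult_le_compat_l; lra|].
    right. unfold s. replace (exp (D * Lp) ^ 2) with (exp (2 * (D * Lp))).
    - rewrite <- (Rmult_comm (exp (2 * (D * Lp)))), <- Rmult_assoc, <- exp_plus.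
      replace (- (2 * (D * Lp)) + 2 * (D * Lp)) with 0 by ring. rewrite exp_0. ring.
    - simpl. rewrite Rmult_1_r, <- exp_plus. f_equal; ring. }
  assert (T1 : s * Cu <= Cu) by nra.
  assert (T2 : D * Lp * I1 <= D * Lp * dm) by (apply Rmult_le_compat_l; lra).
  assert (T3 : D * Lp * dm = eps / 32 * Lp) by (unfold dm; field; lra).
  assert (T4 : 4 * (Cu + 4) <= 4 * (Cu + 4) * L) by nra.
  lra.
Qed.

(** * Punctured neighbourhoods *)

Lemma punctured_nbhd_disc (P : plane -> Prop) :
  punctured_nbhd P -> exists A, 0 < A <= 1 /\ forall p, punctured_disc A p -> P p.
Proof.
  intros [d Hd]. exists (Rmin (d ^ 2) 1).
  assert (Hd2 : 0 < d ^ 2) by (apply pow_lt, cond_pos).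
  split; [split; [apply Rmin_pos; lra | apply Rmin_r]|].
  intros [p1 p2] [H1 H2]. pose proof (Rmin_l (d ^ 2) 1). pose proof (cond_pos d).
  unfold sqdist, origin in H1, H2; simpl fst in *; simpl snd in *.
  rewrite !Rminus_0_r in H1, H2.
  apply Hd.
  - assert (Hc : forall s, s ^ 2 < d ^ 2 -> Rabs (s - 0) < d).
    { intros s Hs. rewrite Rminus_0_r. apply Rnot_le_lt. intros Hds.
      pose proof (pow_incr d (Rabs s) 2 ltac:(lra)). rewrite pow2_abs in H3. lra. }
    pose proof (pow2_ge_0 p1). pose proof (pow2_ge_0 p2).
    split; apply Hc; simpl in *; lra.
  - intros E. injection E as -> ->. lra.
Qed.

Lemma disc_punctured_nbhd (P : plane -> Prop) r :
  0 < r -> (forall p, 0 < sqnorm p < r -> P p) -> punctured_nbhd P.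
Proof.
  intros Hr H. assert (Ho : sqnorm origin < r) by (unfold sqdist; lra).
  generalize (locally_sqdist_lt origin origin r Ho).
  unfold punctured_nbhd, locally', within. apply filter_imp. intros [p1 p2] Hp Hne.
  apply H. split; [|exact Hp]. unfold sqdist, origin; simpl fst; simpl snd.
  pose proof (pow2_ge_0 (p1 - 0)). pose proof (pow2_ge_0 (p2 - 0)).
  apply Rnot_le_lt. intros Hle. apply Hne. unfold origin.
  assert (E1 : (p1 - 0) ^ 2 = 0) by lra. assert (E2 : (p2 - 0) ^ 2 = 0) by lra.
  f_equal; nra.
Qed.

Lemma C2_positive_superharmonic A (u : plane -> R) :
  (forall p, punctured_disc A p -> C2_at u p /\ 0 < u p /\ 0 <= - laplacian u p) ->
  positive_superharmonic A u (fun p => - laplacian u p).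
Proof.
  intros H. split; [|intros p Hp; apply H, Hp].
  exists (fun p => Derive (fun z => u (z, snd p)) (fst p)),
    (fun p => Derive (fun z => u (fst p, z)) (snd p)),
    (fun p => Derive (fun t => Derive (fun z => u (z, snd p)) t) (fst p)),
    (fun p => Derive (fun t => Derive (fun z => u (fst p, z)) t) (snd p)).
  intros p Hp. destruct (H p Hp) as (HC & _ & _).
  destruct p as [x y]. unfold C2_at in HC. simpl fst in *; simpl snd in *.
  destruct HC as (C0 & Dx & Dy & (Cx & Dxx & _ & (Cxx & _) & _) & (Cy & _ & Dyy & _ & (Cyy & _))).
  apply continuity_2d_pt_filterlim in C0, Cx, Cy, Cxx, Cyy.
  assert (Hu : continuous u (x, y)).
  { apply continuous_ext with (2 := C0). now intros [? ?]. }
  assert (E : - - laplacian u (x, y) = Derive (fun t => Derive (fun z => u (z, y)) t) x +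
     Derive (fun t => Derive (fun z => u (x, z)) t) y).
  { rewrite Ropp_involutive. reflexivity. }
  split; [|split; [|split; [|split]]].
  - split; [exact Hu|]. split; [exact Cx|]. split; [exact Cy|]. split; [exact Cxx | exact Cyy].
  - split; now apply Derive_correct.
  - split; now apply Derive_correct.
  - apply continuous_ext with (fun p => Derive (fun t => Derive (fun z => u (z, snd p)) t) (fst p) +
      Derive (fun t => Derive (fun z => u (fst p, z)) t) (snd p)).
    + intros p. rewrite Ropp_involutive. reflexivity.
    + apply continuous_Rplus; [exact Cxx | exact Cyy].
  - exact E.
Qed.

Lemma ln_inv_eucl_norm x : 0 < sqnorm x -> ln (1 / eucl_norm x) = - ln (sqnorm x) / 2.
Proof.
  intros Hx. assert (E : eucl_norm x = sqrt (sqnorm x)).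
  { destruct x as [x1 x2]. unfold eucl_norm, norm; simpl. unfold prod_norm, norm; simpl. unfold abs; simpl.
    unfold sqdist, origin; simpl. f_equal. rewrite !Rmult_1_r, !Rminus_0_r.
    rewrite <- !Rabs_mult, !Rabs_pos_eq by apply Rle_0_sqr. reflexivity. }
  rewrite E. pose proof (sqrt_lt_R0 _ Hx). unfold Rdiv at 1. rewrite Rmult_1_l, ln_Rinv by assumption.
  assert (ln (sqnorm x) = ln (sqrt (sqnorm x)) + ln (sqrt (sqnorm x)))
    by (rewrite <- ln_mult, sqrt_sqrt; lra). lra.
Qed.

Theorem theorem2p3 (u v : plane -> R) (g : R -> R)
  (u_C2 : punctured_nbhd (C2_at u))
  (v_C2 : punctured_nbhd (C2_at v))
  (u_pos : punctured_nbhd (fun x => 0 < u x))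
  (v_pos : punctured_nbhd (fun x => 0 < v x))
  (g_cont : pos_continuous g)
  (g_exp : is_bigO (Rbar_locally p_infty) (fun t => log_plus (g t)) (fun t => t))
  (u_ineq : punctured_nbhd (fun x => 0 <= - laplacian u x))
  (v_ineq : punctured_nbhd (fun x => 0 <= - laplacian v x <= g (u x))) :
  is_bigO punctured_nbhd v (fun x => ln (1 / eucl_norm x)) /\
  (forall (f : R -> R) (lambda : R),
     1 < lambda ->
     pos_continuous f ->
     is_bigO (Rbar_locally p_infty)
       (fun t => log_plus (f t)) (fun t => Rpower t lambda) ->
     punctured_nbhd (fun x => - laplacian u x <= f (v x)) ->
     is_littleo punctured_nbhd u
       (fun x => Rpower (ln (1 / eucl_norm x)) lambda)).
Proof.
  pose proof (filter_and _ _ u_C2 (filter_and _ _ v_C2 (filter_and _ _ u_pos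
    (filter_and _ _ v_pos (filter_and _ _ u_ineq v_ineq))))) as Hall.
  assert (Hmain : forall A, 0 < A <= 1 ->
    (forall p, punctured_disc A p -> C2_at u p /\ C2_at v p /\ 0 < u p /\ 0 < v p /\
      0 <= - laplacian u p /\ 0 <= - laplacian v p <= g (u p)) ->
    positive_superharmonic A u (fun p => - laplacian u p) /\
    positive_superharmonic A v (fun p => - laplacian v p) /\
    exists C r, 0 < C /\ 0 < r /\ 4 * r < A /\ (forall X, 0 < X < r -> 1 <= - ln X) /\
      forall x, 0 < sqnorm x < r -> v x <= C * - ln (sqnorm x)).
  { intros A HA Hp.
    assert (Hu : positive_superharmonic A u (fun p => - laplacian u p)).
    { apply C2_positive_superharmonic. intros p Hpp. specialize (Hp p Hpp). tauto. }
    assert (Hv : positive_superharmonic A v (fun p => - laplacian v p)).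
    { apply C2_positive_superharmonic. intros p Hpp. specialize (Hp p Hpp). tauto. }
    split; [exact Hu|]. split; [exact Hv|].
    apply (logarithmic_bound A u v _ _ g HA Hu Hv g_cont g_exp). intros p Hpp. now apply Hp. }
  split.
  - destruct (punctured_nbhd_disc _ Hall) as (A & HA & Hp).
    destruct (Hmain A HA Hp) as (_ & _ & C & r & HC & Hr & HrA & HL & Hb).
    exists (2 * C). apply (disc_punctured_nbhd _ r Hr). intros x Hx.
    rewrite ln_inv_eucl_norm by lra. specialize (HL _ Hx).
    rewrite !Rabs_pos_eq.
    + specialize (Hb x Hx). lra.
    + lra.
    + left. apply Hp. split; lra.
  - intros f lambda Hl Hf Hfexp Hu_f eps.
    destruct (punctured_nbhd_disc _ (filter_and _ _ Hall Hu_f)) as (A & HA & Hp).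
    destruct (Hmain A HA (fun p Hpp => proj1 (Hp p Hpp))) as (Hu & Hv & C & r & HC & Hr & HrA & HL & Hb).
    destruct (power_bound A u v _ f lambda C r HA Hu (fun p Hpp => proj1 (proj2 Hv p Hpp))
      (superharmonic_lower_bound A v _ (A / 2) (proj2 HA) ltac:(lra) Hv)
      HC Hr HrA Hb Hl Hf Hfexp (fun p Hpp => proj2 (Hp p Hpp))
      (eps * Rpower (/ 2) lambda)) as (r' & Hr' & Hbound).
    { apply Rmult_lt_0_compat; [apply cond_pos | apply exp_pos]. }
    apply (disc_punctured_nbhd _ (Rmin r r')); [now apply Rmin_pos|]. intros x Hx.
    pose proof (Rmin_l r r'). pose proof (Rmin_r r r').
    specialize (Hbound x ltac:(lra)). specialize (HL (sqnorm x) ltac:(lra)).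
    rewrite ln_inv_eucl_norm by lra.
    change (Rabs (u x) <= eps * Rabs (Rpower (- ln (sqnorm x) / 2) lambda)).
    rewrite !Rabs_pos_eq; [|apply Rpower_nonneg | lra].
    unfold Rdiv. rewrite <- Rpower_mult_distr by lra. lra.
Qed.
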